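(* Let $d\ge1$, let $E$ be the set of edges of the integer lattice $\mathbb{Z}^d$, and let $(\omega_e)_{e\in E}$ be i.i.d. edge weights drawn from a continuous probability distribution on the positive real numbers with bounded support. For each $n\ge1$, let $M_n$ be the sum of the edge weights of the minimal spanning tree on $G_n=(V_n,E_n)$ with edge weights $(\omega_e)_{e\in E_n}$. Let $\mu_n:=\mathbb{E}M_n$, $\sigma_n^2:=\mathrm{Var}\,M_n$, and \[ f_n:=\frac{M_n-\mu_n}{\sigma_n}. \] Then $f_n$ converges in law to the standard normal distribution as $n\to\infty$.
   Context: The edges of $\mathbb{Z}^d$ join nearest neighbours (points at Euclidean distance $1$). For each $n$, $V_n:=[-n,n]^d\cap\mathbb{Z}^d$ and $E_n$ is the set of lattice edges with both endpoints in $V_n$. The minimal spanning tree on $G_n=(V_n,E_n)$ is the spanning tree that minimizes the sum of edge weights; it is unique with probability one because the edge-weight distribution is continuous (i.e. has no atoms). *)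

(* Defs.v *)
From HB Require Import structures.
From mathcomp Require Import all_boot all_order all_algebra finmap.
From mathcomp Require Import all_classical all_reals all_analysis.

Set Implicit Arguments.
Unset Strict Implicit.
Unset Printing Implicit Defensive.

Import Order.TTheory GRing.Theory Num.Theory.
Import numFieldNormedType.Exports.

Local Open Scope classical_set_scope.
Local Open Scope ring_scope.

(** ** The lattice and the boxes *)

Definition lattice (d : nat) := {ffun 'I_d -> int}.

(* Integer points are at Euclidean distance 1 iff their squared distance is 1. *)
Definition neighbours (d : nat) (x y : lattice d) : bool :=
  \sum_(i < d) (x i - y i) ^+ 2 == 1.

Definition is_edge (d : nat) (e : {fset lattice d}) : bool :=
  [exists x : e, exists y : e,
     (e == [fset val x; val y]%fset) && neighbours (val x) (val y)].

(* An (unoriented) edge is the set of its two endpoints. *)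
Definition edge (d : nat) := {e : {fset lattice d} | is_edge e}.

Definition box (d n : nat) : {pred lattice d} :=
  [pred x : lattice d | [forall i, `|x i| <= n%:Z]].
Arguments box : clear implicits.

Definition box_edges (d n : nat) : set (edge d) :=
  [set e | {subset val e <= box d n}].
Arguments box_edges : clear implicits.

(** ** Minimal spanning trees *)

Definition linked (d : nat) (F : {fset edge d}) : rel (lattice d) :=
  fun x y => has (fun e => val e == [fset x; y]%fset) F.

(* As the edges of [F] lie in [box d n], so do the paths below. *)
Definition spanning_tree (d n : nat) (F : {fset edge d}) : Prop :=
  [/\ [set` F] `<=` box_edges d n,
      {in box d n &, forall x y,
         exists2 p, path (linked F) x p & last x p = y}
    & forall c, ucycle (linked F) c -> (size c < 3)%N].

Definition weight (R : realType) (d : nat) (w : edge d -> R)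
  (F : {fset edge d}) : R := \sum_(e <- F) w e.

Definition is_mst (R : realType) (d n : nat) (w : edge d -> R)
    (F : {fset edge d}) : Prop :=
  spanning_tree n F /\
  forall F', spanning_tree n F' -> weight w F <= weight w F'.

(* All minimal spanning trees have the same weight, so the choice made by
   [xget] is irrelevant when ties occur; the box graph is finite and connected, so
   the default [fset0] is used only if it is itself a minimal spanning tree. *)
Definition mst (R : realType) (d n : nat) (w : edge d -> R) : {fset edge d} :=
  xget fset0 [set F | is_mst n w F].

Section RandomWeights.
Context (R : realType) (dT : measure_display) (T : measurableType dT).
Variable P : probability T R.

Definition mst_weight (d : nat) (omega : edge d -> {RV P >-> R}) (n : nat)
    (t : T) : R :=
  let w e := omega e t in weight w (mst n w).

Lemma measurable_mst_weight (d : nat) (omega : edge d -> {RV P >-> R})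
  (n : nat) : measurable_fun setT (mst_weight omega n).
Proof.
pose W (F : {fset edge d}) (t : T) : R := weight (fun e => omega e t) F.
have mW F : measurable_fun setT (W F).
  rewrite /W /weight; apply: measurable_sum => e; exact: measurable_funPT.
pose A F := [set t : T | is_mst n (fun e => omega e t) F].
have mA F : measurable (A F).
  have [sF|nsF] := pselect (spanning_tree n F); last first.
    rewrite (_ : A F = set0) //.
    by apply/seteqP; split => t // [].
  rewrite (_ : A F = \bigcap_(F' in [set F' | spanning_tree n F'])
                       [set t | W F t <= W F' t]); last first.
    apply/seteqP; split => t; first by move=> [_ h] F' /h.
    by move=> h; split => // F' /h.
  rewrite -[X in measurable X]setCK; apply: measurableC.
  rewrite setC_bigcap bigcup_mkcond.
  apply: countable_bigcupT_measurable => [|F']; first exact: countableP.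
  case: ifP => // _; apply: measurableC.
  by rewrite -[X in measurable X]setTI; exact: measurable_fun_le.
have EM t F : A F t -> mst_weight omega n t = W F t.
  move=> AFt; rewrite /mst_weight /=.
  set w := fun e => omega e t.
  have [sX hX] : is_mst n w (mst n w).
    by have := @xgetPex _ fset0 [set F | is_mst n w F]; apply; exists F.
  by case: AFt => sF hF; apply/eqP; rewrite eq_le hX // hF.
have E0 t : ~ (\bigcup_F A F) t -> mst_weight omega n t = 0.
  move=> nA; rewrite /mst_weight /= /mst xgetPN => [|F AF].
    by rewrite /weight big_nil.
  by apply: nA; exists F.
move=> _ Y mY; rewrite setTI.
rewrite (_ : _ @^-1` Y = (\bigcup_F (A F `&` W F @^-1` Y)) `|`
    (~` (\bigcup_F A F) `&` (cst 0 @^-1` Y))); last first.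
  apply/seteqP; split => t /=.
    have [[F _ AF]|nA] := pselect ((\bigcup_F A F) t).
      by rewrite (EM _ _ AF) => YW; left; exists F.
    by rewrite (E0 _ nA); right.
  move=> [[F _ [AF]] /=|[nA]]; first by rewrite (EM _ _ AF).
  by rewrite (E0 _ nA).
apply: measurableU.
  apply: countable_bigcupT_measurable => [|F]; first exact: countableP.
  apply: measurableI => //.
  by rewrite -[X in measurable X]setTI; exact: mW.
apply: measurableI.
  apply: measurableC; apply: countable_bigcupT_measurable => [|F //].
  exact: countableP.
by rewrite -[X in measurable X]setTI; exact: measurable_cst.
Qed.

HB.instance Definition _ (d : nat) (omega : edge d -> {RV P >-> R}) (n : nat) :=
  isMeasurableFun.Build _ _ _ _ (mst_weight omega n)
    (@measurable_mst_weight d omega n).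

Definition standardize (X : T -> R) (t : T) : R :=
  (X t - fine 'E_P[X]) / Num.sqrt (fine 'V_P[X]).

Lemma measurable_standardize (X : {RV P >-> R}) :
  measurable_fun setT (standardize X).
Proof.
apply: measurable_realfun.measurable_funM; last exact: measurable_cst.
by apply: measurable_realfun.measurable_funB; [exact: measurable_funPT|exact: measurable_cst].
Qed.

HB.instance Definition _ (X : {RV P >-> R}) :=
  isMeasurableFun.Build _ _ _ _ (standardize X) (@measurable_standardize X).

(** ** Independence and convergence in law *)

Definition mutually_independent (I : choiceType) (X : I -> {RV P >-> R}) :
    Prop :=
  forall (J : {fset I}) (B : I -> set R),
    (forall i, measurable (B i)) ->
    P (\bigcap_(i in [set` J]) X i @^-1` B i) =
    (\prod_(i <- J) P (X i @^-1` B i))%E.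

Definition iid (I : choiceType) (X : I -> {RV P >-> R})
    (mu : probability (measurableTypeR R) R) : Prop :=
  mutually_independent X /\
  forall i (B : set R), measurable B -> distribution P (X i) B = mu B.

Definition cvg_in_law (X : nat -> {RV P >-> R})
    (mu : probability (measurableTypeR R) R) : Prop :=
  forall g : R -> R, continuous g -> [bounded g x | x in setT] ->
    'E_P[g \o X n]%E @[n --> \oo] --> (\int[mu]_x (g x)%:E)%E.

End RandomWeights.

Arguments mutually_independent {R dT T} P {I} X.
Arguments iid {R dT T} P {I} X mu.
Arguments cvg_in_law {R dT T} P X mu.

(* Main.v *)
Require Import Defs.
From HB Require Import structures.
From mathcomp Require Import all_boot all_order all_algebra finmap.
From mathcomp Require Import all_classical all_reals all_analysis.
From mathcomp Require Import measurable_realfun lra zify.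

(** With the other weights fixed, the weight of the minimal spanning tree depends on a
single weight [w e] through [Num.min (w e) alpha], where [alpha] is the minimax weight of the
paths joining the endpoints of [e] without using [e].  Since [alpha] decreases when the box
grows, its mean over boxes centred at [e] converges, so [alpha] is well approximated in [L^1]
by a quantity depending only on the weights near [e].  Thus the effect of each weight is
essentially local, with no appeal to percolation theory.

Stein's method now applies.  Writing [M_n - mu_n] as a sum of martingale differences [D_e] gives
[E (G'(W) - W G(W))] in terms of the fluctuation of [T := \sum_e (M_n - E_e M_n) D_e], whose mean
is the variance [sigma_n^2]; by locality [T] is close to a sum of weakly dependent terms and is
concentrated at the scale of the number of edges.  The variance is at least of this order, as
[alpha] is bounded below by the weights of the edges sharing an endpoint with [e].

The weights are first rounded to finitely many values, which makes all expectations over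
boxes finite sums; the rounding error is sent to zero for each fixed [n]. *)

Set Implicit Arguments.
Unset Strict Implicit.
Unset Printing Implicit Defensive.

Import Order.TTheory GRing.Theory Num.Theory.
Import numFieldNormedType.Exports.

Local Open Scope classical_set_scope.
Local Open Scope ring_scope.

(** * Stein's method on finite product spaces *)

(** The argument is soft. For a box not centred at the edge, this mean is squeezed between those of
    a centred box inside it and a centred box around it, and both depend on the edge only through
    its direction. Edges near the boundary escape the squeeze, but they form a vanishing fraction.

    The obstacle is the order of choices: the radius of locality is fixed before [n], the rounding
    only after [n], so one radius must serve all fine roundings. It does, because [alpha] is a
    minimum of maxima of weights: rounding moves it by at most the mesh whatever the box, and a
    single reference rounding can decide the radius.

    [alpha] is capped at an upper bound [b] of the weights, which does not affect
    [Num.min (w e) alpha]. For [d = 1] no second path exists and [alpha] equals the cap, so every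
    dimension is treated alike. *)

Section ProductAverage.
Variables (R : realType) (I : choiceType) (V : finType) (p : V -> R).
Hypotheses (p_ge0 : forall v, 0 <= p v) (p_sum1 : \sum_v p v = 1).

Implicit Types (F G : (I -> V) -> R) (a : I -> V) (i j : I) (s t : seq I).

Definition upd a i v : I -> V := fun j => if j == i then v else a j.

(** Averages remain functions of the whole configuration: conditional expectations become iterated
    one-coordinate averages, and the index type may be infinite without any measure on the
    product. *)
Definition avg i F a := \sum_v p v * F (upd a i v).

(* The expectation over the coordinates in [s], independent with law [p]; the others are frozen. *)
Definition avgs s F := foldr avg F s.

Definition indep i F := forall a v, F (upd a i v) = F a.

Lemma upd_id a i u v : upd (upd a i u) i v = upd a i v.
Proof. by apply/funext => j; rewrite /upd; case: eqP. Qed.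

Lemma upd_comm a i j u v : i != j -> upd (upd a i u) j v = upd (upd a j v) i u.
Proof.
move=> ij; apply/funext => k; rewrite /upd.
by case: (eqVneq k j) => // ->; rewrite eq_sym (negbTE ij).
Qed.

Lemma upd_same a i : upd a i (a i) = a.
Proof. by apply/funext => j; rewrite /upd; case: eqP => [->|]. Qed.

Lemma avg_indep i F : indep i F -> avg i F = F.
Proof.
move=> h; apply/funext => a; rewrite /avg.
under eq_bigr => v _ do rewrite h.
by rewrite -mulr_suml p_sum1 mul1r.
Qed.

Lemma indep_avg i F : indep i (avg i F).
Proof. by move=> a v; apply: eq_bigr => u _; rewrite upd_id. Qed.

Lemma indep_avg_other i j F : indep j F -> indep j (avg i F).
Proof.
move=> h a v; case: (eqVneq i j) => [->|ij]; first exact: indep_avg.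
by apply: eq_bigr => u _; rewrite -upd_comm // h.
Qed.

Lemma indep_avgs_other s j F : indep j F -> indep j (avgs s F).
Proof. by move=> h; elim: s => //= i s IH; exact: indep_avg_other. Qed.

Lemma indep_avgs s j F : j \in s -> indep j (avgs s F).
Proof.
elim: s => //= i s IH; rewrite inE => /orP[/eqP->|/IH]; first exact: indep_avg.
exact: indep_avg_other.
Qed.

Lemma indep_comb i F G (op : R -> R -> R) : indep i F -> indep i G ->
  indep i (fun a => op (F a) (G a)).
Proof. by move=> hF hG a v; rewrite hF hG. Qed.

Lemma avgC i j F : avg i (avg j F) = avg j (avg i F).
Proof.
case: (eqVneq i j) => [->//|ij]; apply/funext => a; rewrite /avg.
under eq_bigr => u _ do rewrite mulr_sumr.
rewrite exchange_big; apply: eq_bigr => u _; rewrite mulr_sumr.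
by apply: eq_bigr => v _; rewrite upd_comm // mulrCA.
Qed.

Lemma avg_avgsC i s F : avg i (avgs s F) = avgs s (avg i F).
Proof. by elim: s => //= j s IH; rewrite avgC IH. Qed.

Lemma avgs_rem i s F : i \in s -> avgs s F = avg i (avgs (rem i s) F).
Proof.
elim: s => //= j s IH; rewrite inE eq_sym.
by case: (eqVneq j i) => [->//|_] /= /IH ->; rewrite avgC.
Qed.

Lemma avgs_avg i s F : i \in s -> avgs s (avg i F) = avgs s F.
Proof.
by move=> si; rewrite -avg_avgsC avg_indep //; exact: indep_avgs.
Qed.

Lemma avgs_indep s F : (forall i, i \in s -> indep i F) -> avgs s F = F.
Proof.
elim: s => //= i s IH h; rewrite IH; last first.
  by move=> j js; apply: h; rewrite inE js orbT.
by rewrite avg_indep //; apply: h; rewrite inE eqxx.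
Qed.

Lemma avgs_avgs_sub s t F : {subset t <= s} -> avgs s (avgs t F) = avgs s F.
Proof.
elim: t => //= i t IH h; rewrite avgs_avg; last by apply: h; rewrite inE eqxx.
by apply: IH => j jt; apply: h; rewrite inE jt orbT.
Qed.

(** Averaging over [s] beforehand is invisible to [avgs t], and afterwards no coordinate of [t]
    matters. This is what compares means taken in boxes of different sizes. *)
Lemma avgs_sub s t F : {subset s <= t} ->
  (forall i, i \in t -> i \notin s -> indep i F) -> avgs t F = avgs s F.
Proof.
move=> st h; rewrite -(avgs_avgs_sub F st) avgs_indep // => i ti.
case: (boolP (i \in s)) => [|is_]; first exact: indep_avgs.
by apply: indep_avgs_other; exact: h.
Qed.

Lemma avgD i F G : avg i (fun a => F a + G a) = fun a => avg i F a + avg i G a.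
Proof.
by apply/funext => a; rewrite /avg -big_split; apply: eq_bigr => v _; rewrite /= mulrDr.
Qed.

Lemma avgZ i c F : avg i (fun a => c * F a) = fun a => c * avg i F a.
Proof.
by apply/funext => a; rewrite /avg mulr_sumr; apply: eq_bigr => v _; rewrite mulrCA.
Qed.

Lemma avgM i F G : indep i F -> avg i (fun a => F a * G a) = fun a => F a * avg i G a.
Proof.
move=> h; apply/funext => a; rewrite /avg mulr_sumr; apply: eq_bigr => v _.
by rewrite h mulrCA.
Qed.

Lemma avgs_cst s (c : R) : avgs s (fun=> c) = fun=> c.
Proof. exact: avgs_indep. Qed.

Lemma avgsD s F G : avgs s (fun a => F a + G a) = fun a => avgs s F a + avgs s G a.
Proof. by elim: s => //= i s ->; rewrite avgD. Qed.

Lemma avgsZ s c F : avgs s (fun a => c * F a) = fun a => c * avgs s F a.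
Proof. by elim: s => //= i s ->; rewrite avgZ. Qed.

Lemma avgsN s F : avgs s (fun a => - F a) = fun a => - avgs s F a.
Proof.
rewrite (_ : (fun a => - F a) = fun a => (-1) * F a).
  by rewrite avgsZ; apply/funext => a; rewrite mulN1r.
by apply/funext => a; rewrite mulN1r.
Qed.

Lemma avgsB s F G : avgs s (fun a => F a - G a) = fun a => avgs s F a - avgs s G a.
Proof. by rewrite avgsD avgsN. Qed.

Lemma avgs_sum (J : Type) (r : seq J) s (F : J -> (I -> V) -> R) :
  avgs s (fun a => \sum_(j <- r) F j a) = fun a => \sum_(j <- r) avgs s (F j) a.
Proof.
elim: r => [|j r IH].
  rewrite (_ : (fun a => _) = fun=> 0); last first.
    by apply/funext => a; rewrite big_nil.
  by rewrite avgs_cst; apply/funext => a; rewrite big_nil.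
rewrite (_ : (fun a => _) = fun a => F j a + \sum_(k <- r) F k a); last first.
  by apply/funext => a; rewrite big_cons.
by rewrite avgsD IH; apply/funext => a; rewrite big_cons.
Qed.

Lemma avgsM s F G : (forall i, i \in s -> indep i F) ->
  avgs s (fun a => F a * G a) = fun a => F a * avgs s G a.
Proof.
elim: s => //= i s IH h; rewrite IH; last first.
  by move=> j js; apply: h; rewrite inE js orbT.
by rewrite avgM //; apply: h; rewrite inE eqxx.
Qed.

Lemma avgs_prod s F G : (forall i, i \in s -> indep i F \/ indep i G) ->
  avgs s (fun a => F a * G a) = fun a => avgs s F a * avgs s G a.
Proof.
elim: s => //= i s IH h; rewrite IH; last first.
  by move=> j js; apply: h; rewrite inE js orbT.
have [hF|hG] : indep i F \/ indep i G by apply: h; rewrite inE eqxx.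
  have hF' : indep i (avgs s F) by exact: indep_avgs_other.
  by rewrite avgM // (avg_indep hF').
have hG' : indep i (avgs s G) by exact: indep_avgs_other.
rewrite (_ : (fun a => _) = fun a => avgs s G a * avgs s F a); last first.
  by apply/funext => a; rewrite mulrC.
by rewrite avgM // (avg_indep hG'); apply/funext => a; rewrite mulrC.
Qed.

Lemma avg_le i F G : (forall a, F a <= G a) -> forall a, avg i F a <= avg i G a.
Proof. by move=> h a; apply: ler_sum => v _; exact: ler_wpM2l. Qed.

Lemma avgs_le s F G : (forall a, F a <= G a) -> forall a, avgs s F a <= avgs s G a.
Proof. by move=> h; elim: s => //= i s IH; exact: avg_le. Qed.

Lemma avgs_ge0 s F : (forall a, 0 <= F a) -> forall a, 0 <= avgs s F a.
Proof. by move=> h a; have := avgs_le s h a; rewrite avgs_cst. Qed.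

Lemma avgs_bound s F c : (forall a, `|F a| <= c) -> forall a, `|avgs s F a| <= c.
Proof.
move=> h a; rewrite ler_norml; apply/andP; split.
  have := @avgs_le s (fun=> - c) F _ a; rewrite avgs_cst; apply => b.
  by have := h b; rewrite ler_norml => /andP[].
have := @avgs_le s F (fun=> c) _ a; rewrite avgs_cst; apply => b.
by have := h b; rewrite ler_norml => /andP[].
Qed.

Lemma ler_norm_avgs s F a : `|avgs s F a| <= avgs s (fun a => `|F a|) a.
Proof.
rewrite ler_norml; apply/andP; split; last by apply: avgs_le => b; exact: ler_norm.
have := @avgs_le s (fun a => - `|F a|) F _ a; rewrite avgsN; apply => b.
by rewrite lerNl ler_normr lexx orbT.
Qed.

Lemma avgs_sqr s F a : (avgs s F a) ^+ 2 <= avgs s (fun a => F a ^+ 2) a.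
Proof.
have := @avgs_ge0 s (fun b => (F b - avgs s F a) ^+ 2) (fun b => sqr_ge0 _) a.
(* [c] is a number, fixed while [b] varies; expanding the square bounds its square by the average of
   [F ^+ 2]. *)
set c := avgs s F a.
rewrite (_ : (fun b => _) = fun b => F b ^+ 2 + ((- (2 * c)) * F b + c ^+ 2)); last first.
  by apply/funext => b; lra.
rewrite avgsD avgsD avgsZ avgs_cst -/c; nra.
Qed.

Lemma avgs_abs s F a : avgs s (fun a => `|F a|) a <=
  Num.sqrt (avgs s (fun a => F a ^+ 2) a).
Proof.
have h : (avgs s (fun a => `|F a|) a) ^+ 2 <= avgs s (fun a => F a ^+ 2) a.
  apply: le_trans (avgs_sqr _ _ _) _.
  by apply: avgs_le => b; rewrite -normrX ger0_norm ?sqr_ge0.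
rewrite -[leLHS]ger0_norm; last by apply: avgs_ge0.
by rewrite -sqrtr_sqr ler_wsqrtr.
Qed.

Lemma avgB i F G : avg i (fun a => F a - G a) = fun a => avg i F a - avg i G a.
Proof. exact: (avgsB [:: i]). Qed.

(** * Martingale differences and Stein's identity *)

Definition delta i F a := F a - avg i F a.

(** Averaging over the coordinates that follow [i] in [s] is conditioning on [i] and those before
    it. Thus [avgs (after s i) (delta i F)] is the martingale difference [D_e] of the overview. *)
Definition after s i := drop (index i s).+1 s.

Lemma after_sub s i : {subset after s i <= s}.
Proof. by move=> j /mem_drop. Qed.

Lemma deltaE i F a : delta i F a = \sum_v p v * (F a - F (upd a i v)).
Proof.
rewrite /delta /avg -[X in X - _]mul1r -p_sum1 mulr_suml -sumrB.
by apply: eq_bigr => v _; rewrite mulrBr.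
Qed.

Lemma norm_deltaE i F G (c : R) a :
  (forall v, `|F a - F (upd a i v) - (G a - G (upd a i v))| <= c) ->
  `|delta i F a - delta i G a| <= c.
Proof.
move=> h; rewrite !deltaE -sumrB; apply: le_trans (ler_norm_sum _ _ _) _.
rewrite -[leRHS]mul1r -p_sum1 mulr_suml; apply: ler_sum => v _.
by rewrite -mulrBr normrM ger0_norm // ler_wpM2l.
Qed.

Lemma norm_delta i F (c : R) a :
  (forall v, `|F a - F (upd a i v)| <= c) -> `|delta i F a| <= c.
Proof.
move=> h; rewrite !deltaE; apply: le_trans (ler_norm_sum _ _ _) _.
rewrite -[leRHS]mul1r -p_sum1 mulr_suml; apply: ler_sum => v _.
by rewrite normrM ger0_norm // ler_wpM2l.
Qed.

(** Telescoping over the suffixes of [s]: averaging out one more coordinate [i] changes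
    [avgs (after s i) F] by the average of [delta i F]. *)
Lemma martingale_decomposition s F a : uniq s ->
  F a - avgs s F a = \sum_(i <- s) avgs (after s i) (delta i F) a.
Proof.
elim: s => [|i s IH] /=; first by rewrite big_nil subrr.
move=> /andP[is_ us]; rewrite big_cons /after /= eqxx drop0.
rewrite (eq_big_seq (fun j => avgs (after s j) (delta j F) a)); last first.
  move=> j js /=; case: eqP => [ij|//].
  by move: is_; rewrite ij js.
rewrite -IH // (_ : delta i F = fun a => F a - avg i F a) // avgsB -avg_avgsC.
by rewrite [in LHS]/=; lra.
Qed.

(** The martingale difference at [i] has zero average over coordinate [i], so subtracting from [G]
    the function [avg i G], which ignores that coordinate, does not change the mean of their
    product. *)
Lemma covariance_decomposition s F G : uniq s ->
  avgs s (fun a => (F a - avgs s F a) * G a) =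
  fun a => \sum_(i <- s) avgs s (fun a => avgs (after s i) (delta i F) a * delta i G a) a.
Proof.
move=> us; rewrite -avgs_sum.
rewrite (_ : (fun a => (F a - _) * _) = fun a =>
   \sum_(i <- s) avgs (after s i) (delta i F) a * G a); last first.
  by apply/funext => a; rewrite martingale_decomposition // mulr_suml.
rewrite !avgs_sum; apply/funext => a; apply: eq_big_seq => i is_.
set D := avgs (after s i) _.
have D0 : avg i D = fun=> 0.
  rewrite /D avg_avgsC (_ : delta i F = fun a => F a - avg i F a) //.
  rewrite avgB (avg_indep (indep_avg _ _)).
  by rewrite (_ : (fun _ => _) = fun=> 0) ?avgs_cst//; apply/funext => ?; rewrite subrr.
rewrite (_ : (fun a => D a * G a) =
    fun a => D a * delta i G a + avg i G a * D a); last first.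
  by apply/funext => b; rewrite /delta; lra.
rewrite avgsD -(avgs_avg (fun a => avg i G a * D a) is_) (avgM _ (indep_avg _ _)) D0.
rewrite (_ : (fun a => avg i G a * 0) = fun=> 0); first by rewrite avgs_cst addr0.
by apply/funext => b; rewrite mulr0.
Qed.

Definition avgs_variance s F := avgs s (fun a => (F a - avgs s F a) ^+ 2).

(** Only one factor is a martingale difference, the other is the raw increment: this sum appears
    when [covariance_decomposition] is applied to a function of [F] that is then linearised in each
    coordinate. *)
Definition steinT s F a := \sum_(i <- s) delta i F a * avgs (after s i) (delta i F) a.

Lemma delta_center s i F : i \in s ->
  delta i (fun a => F a - avgs s F a) = delta i F.
Proof.
move=> is_; apply/funext => a; rewrite !deltaE; apply: eq_bigr => v _.
have h : indep i (avgs s F) by exact: indep_avgs.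
by rewrite h; lra.
Qed.

Lemma avgs_varianceE s F : uniq s -> avgs_variance s F = avgs s (steinT s F).
Proof.
move=> us; rewrite /avgs_variance.
rewrite (_ : (fun a => _) =
  fun a => (F a - avgs s F a) * (F a - avgs s F a)); last first.
  by apply/funext => a; rewrite expr2.
rewrite covariance_decomposition // /steinT avgs_sum.
apply/funext => a; apply: eq_big_seq => i is_.
rewrite (delta_center F is_); congr (avgs s _ a).
by apply/funext => b; rewrite mulrC.
Qed.

Lemma stein_bound s F (G G' : R -> R) (b s0 eta L : R) a : uniq s ->
  0 <= b -> 0 < s0 -> 0 <= eta ->
  (forall i a v, i \in s -> `|F a - F (upd a i v)| <= b) ->
  (forall w w', `|w - w'| <= b / s0 ->
     `|G w - G w' - G' w * (w - w')| <= eta * `|w - w'|) ->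
  (forall w, `|G' w| <= L) ->
  let W a := (F a - avgs s F a) / s0 in
  `|avgs s (fun a => G' (W a) - W a * G (W a)) a| <=
  L * (`|1 - avgs_variance s F a / s0 ^+ 2| +
       avgs s (fun a => `|steinT s F a - avgs s (steinT s F) a|) a / s0 ^+ 2)
  + (size s)%:R * b ^+ 2 * eta / s0 ^+ 2.
Proof.
move=> us b0 s00 eta0 hF hG hL /=; pose W a := (F a - avgs s F a) / s0.
rewrite -[fun a => _ - _]/(fun a => G' (W a) - W a * G (W a)).
have L0 : 0 <= L by apply: le_trans (hL 0); exact: normr_ge0.
have hdF i c : i \in s -> `|delta i F c| <= b by move=> is_; apply: norm_delta => v; exact: hF.
have hD i c : i \in s -> `|avgs (after s i) (delta i F) c| <= b.
  by move=> is_; apply: avgs_bound => c'; exact: hdF.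
(* [Y] is the main term; [Z] collects the linearisation errors. *)
pose Y a := G' (W a) * (1 - steinT s F a / s0 ^+ 2).
pose Z a := \sum_(i <- s) avgs (after s i) (delta i F) a *
   (delta i (G \o W) a - G' (W a) * (delta i F a / s0)) / s0.
have E1 : avgs s (fun a => G' (W a) - W a * G (W a)) a = avgs s Y a - avgs s Z a.
  have -> : avgs s (fun a => G' (W a) - W a * G (W a)) a =
     avgs s (fun a => G' (W a)) a - avgs s (fun a => W a * G (W a)) a by rewrite avgsB.
  have -> : avgs s (fun a => W a * G (W a)) =
     avgs s (fun a => \sum_(i <- s) avgs (after s i) (delta i F) a * delta i (G \o W) a / s0).
    rewrite (_ : (fun a => W a * _) = fun a => s0^-1 * ((F a - avgs s F a) * (G \o W) a)); last first.
      by apply/funext => c; rewrite /W /=; lra.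
    rewrite avgsZ covariance_decomposition // avgs_sum.
    apply/funext => c; rewrite mulr_sumr; apply: eq_bigr => i _.
    rewrite -[LHS](congr1 (fun f => f c) (avgsZ s s0^-1 _)).
    by congr (avgs s _ c); apply/funext => c'; rewrite mulrC.
  rewrite -[RHS](congr1 (fun f => f a) (avgsB s Y Z)).
  rewrite -[LHS](congr1 (fun f => f a) (avgsB s _ _)).
  congr (avgs s _ a); apply/funext => c; rewrite /Y /Z /steinT.
  rewrite mulrBr mulr1 -addrA; congr (_ + _).
  rewrite mulr_suml mulr_sumr -[RHS]opprD; congr (- _).
  rewrite -big_split; apply: eq_bigr => i _ /=.
  rewrite -exprVn expr2; set x := s0^-1; lra.
rewrite E1; apply: le_trans (ler_normB _ _) _; apply: lerD.
  apply: le_trans (ler_norm_avgs _ _ _) _.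
  have -> : L * (`|1 - avgs_variance s F a / s0 ^+ 2| +
       avgs s (fun a => `|steinT s F a - avgs s (steinT s F) a|) a / s0 ^+ 2) =
    avgs s (fun c => L * (`|1 - avgs_variance s F c / s0 ^+ 2| +
       `|steinT s F c - avgs s (steinT s F) c| / s0 ^+ 2)) a.
    rewrite avgsZ avgsD; congr (_ * (_ + _)).
      rewrite avgs_indep // => i is_ c v.
      have h : indep i (avgs_variance s F) by exact: indep_avgs.
      by rewrite h.
    rewrite mulrC -[LHS](congr1 (fun f => f a) (avgsZ s _ _)).
    by congr (avgs s _ a); apply/funext => c; rewrite mulrC.
  apply: avgs_le => c; rewrite /Y normrM; apply: ler_pM => //.
  rewrite avgs_varianceE //.
  have -> : 1 - steinT s F c / s0 ^+ 2 = (1 - avgs s (steinT s F) c / s0 ^+ 2) -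
    (steinT s F c - avgs s (steinT s F) c) / s0 ^+ 2 by lra.
  apply: le_trans (ler_normB _ _) _; rewrite lerD2l normrM ler_wpM2l //.
  by rewrite ger0_norm // invr_ge0 sqr_ge0.
clear E1; have s0V : 0 <= s0^-1 by rewrite invr_ge0 ltW.
apply: avgs_bound => {}a; rewrite /Z.
apply: le_trans (ler_norm_sum _ _ _) _.
have -> : (size s)%:R * b ^+ 2 * eta / s0 ^+ 2 = \sum_(i <- s) (b * (eta * (b / s0)) / s0).
  rewrite big_const_seq count_predT iter_addr_0 -mulr_natl -exprVn !expr2.
  by set x := s0^-1; lra.
rewrite [leLHS]big_seq [leRHS]big_seq; apply: ler_sum => i is_.
rewrite normrM [X in _ * X]ger0_norm //.
rewrite ler_wpM2r // // normrM; apply: ler_pM => //; first exact: hD.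
have -> : G' (W a) * (delta i F a / s0) = delta i (fun c => G' (W a) * W c) a.
  rewrite -(delta_center F is_) !deltaE mulr_suml mulr_sumr.
  by apply: eq_bigr => v _; rewrite /W; lra.
apply: norm_deltaE => v /=.
have Wb : `|W a - W (upd a i v)| <= b / s0.
  rewrite /W; have h : indep i (avgs s F) by exact: indep_avgs.
  have -> : (F a - avgs s F a) / s0 - (F (upd a i v) - avgs s F (upd a i v)) / s0 =
    (F a - F (upd a i v)) / s0 by rewrite h; lra.
  rewrite normrM.
  rewrite [X in _ * X]ger0_norm //.
  by rewrite ler_wpM2r // // hF.
rewrite -mulrBr; apply: le_trans (hG _ _ Wb) _; exact: ler_wpM2l.
Qed.

Lemma avgs_norm_avgs s t F a : {subset t <= s} ->
  avgs s (fun a => `|avgs t F a|) a <= avgs s (fun a => `|F a|) a.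
Proof.
move=> ts; rewrite -[in leRHS](avgs_avgs_sub _ ts).
by apply: avgs_le => b; exact: ler_norm_avgs.
Qed.

(* [steinT] is compared with the sum of the [ut i * avgs (after s i) (ut i)], whose variance only
   has contributions from pairs [near i j]. *)
Lemma locality_bound s F (ut : I -> (I -> V) -> R) (near : rel I) (D : nat) (b eps : R) a :
  uniq s -> 0 <= b ->
  (forall i a v, i \in s -> `|F a - F (upd a i v)| <= b) ->
  (forall i a, i \in s -> `|ut i a| <= b) ->
  (forall i, i \in s -> (count (near i) s <= D)%N) ->
  (forall i j, i \in s -> j \in s -> ~~ near i j ->
     forall k, k \in s -> indep k (ut i) \/ indep k (ut j)) ->
  \sum_(i <- s) avgs s (fun a => `|delta i F a - ut i a|) a <= eps ->
  avgs s (fun a => `|steinT s F a - avgs s (steinT s F) a|) a <=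
  4 * b * eps + Num.sqrt ((size s * D)%:R * (2 * b ^+ 2) ^+ 2).
Proof.
move=> us b0 hF hut hD hind heps.
pose tau i a := ut i a * avgs (after s i) (ut i) a.
pose Tt a := \sum_(i <- s) tau i a.
have hdF i c : i \in s -> `|delta i F c| <= b by move=> is_; apply: norm_delta => v; exact: hF.
have htau i c : i \in s -> `|tau i c| <= b ^+ 2.
  move=> is_; rewrite normrM expr2; apply: ler_pM => //; first exact: hut.
  by apply: avgs_bound => c'; exact: hut.
have E1 : avgs s (fun a => `|steinT s F a - Tt a|) a <= 2 * b * eps.
  apply: le_trans (_ : avgs s (fun a => \sum_(i <- s)
     (b * `|delta i F a - ut i a| + b * `|avgs (after s i) (fun a => delta i F a - ut i a) a|)) a <= _).
    apply: avgs_le => c; rewrite /steinT /Tt -sumrB.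
    apply: le_trans (ler_norm_sum _ _ _) _.
    rewrite [leLHS]big_seq [leRHS]big_seq; apply: ler_sum => i is_.
    rewrite avgsB /tau.
    set u := delta i F c; set v := ut i c; set U := avgs _ _ c; set U' := avgs _ _ c.
    have -> : u * U - v * U' = (u - v) * U + (U - U') * v by lra.
    apply: le_trans (ler_normD _ _) _; rewrite !normrM; apply: lerD; rewrite mulrC.
      by apply: ler_wpM2r => //; apply: avgs_bound => c'; exact: hdF.
    by apply: ler_wpM2r => //; exact: hut.
  rewrite avgs_sum; apply: le_trans (_ : 2 * b *
     \sum_(i <- s) avgs s (fun a => `|delta i F a - ut i a|) a <= _); last first.
    by apply: ler_wpM2l => //; apply: mulr_ge0.
  rewrite mulr_sumr; apply: ler_sum => i _.
  set X := fun a => delta i F a - ut i a.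
  have -> : avgs s (fun a => b * `|X a| + b * `|avgs (after s i) X a|) a =
    b * avgs s (fun a => `|X a|) a + b * avgs s (fun a => `|avgs (after s i) X a|) a.
    rewrite [LHS](congr1 (fun f => f a) (avgsD s _ _)).
    by congr (_ + _); exact: (congr1 (fun f => f a) (avgsZ s b _)).
  rewrite -mulrA mulrDl mul1r lerD2l ler_wpM2l //.
  exact: (avgs_norm_avgs _ _ (@after_sub s i)).
have E2 : avgs s (fun a => `|Tt a - avgs s Tt a|) a <= Num.sqrt ((size s * D)%:R * (2 * b ^+ 2) ^+ 2).
  apply: le_trans (avgs_abs _ _ _) _; apply: ler_wsqrtr.
  pose ct i a := tau i a - avgs s (tau i) a.
  have hct i c : i \in s -> `|ct i c| <= 2 * b ^+ 2.
    move=> is_; apply: le_trans (ler_normB _ _) _; rewrite mulrDl mul1r; apply: lerD.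
      exact: htau.
    by apply: avgs_bound => c'; exact: htau.
  rewrite (_ : (fun a => _ ^+ 2) = fun a => \sum_(i <- s) \sum_(j <- s) ct i a * ct j a); last first.
    apply/funext => c; rewrite expr2 /Tt avgs_sum -sumrB mulr_suml.
    by apply: eq_bigr => i _; rewrite mulr_sumr.
  rewrite avgs_sum.
  rewrite natrM -mulrA.
  have -> : (size s)%:R * (D%:R * (2 * b ^+ 2) ^+ 2) = \sum_(i <- s) (D%:R * (2 * b ^+ 2) ^+ 2).
    by rewrite big_const_seq count_predT iter_addr_0 mulr_natl.
  rewrite [leLHS]big_seq [leRHS]big_seq; apply: ler_sum => i is_.
  rewrite avgs_sum; apply: le_trans (_ : \sum_(j <- s) (near i j)%:R * (2 * b ^+ 2) ^+ 2 <= _).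
    rewrite [leLHS]big_seq [leRHS]big_seq; apply: ler_sum => j js.
    case: (boolP (near i j)) => [_|nij].
      rewrite mul1r; apply: le_trans (ler_norm _) _; apply: avgs_bound => c.
      by rewrite normrM expr2; apply: ler_pM => //; exact: hct.
    rewrite mul0r avgs_prod; last first.
      move=> k ks; have [h|h] := hind i j is_ js nij k ks; [left|right].
        apply: (indep_comb (fun x y => x - y)); last exact: indep_avgs.
        by apply: (indep_comb *%R) => //; exact: indep_avgs_other.
      apply: (indep_comb (fun x y => x - y)); last exact: indep_avgs.
      by apply: (indep_comb *%R) => //; exact: indep_avgs_other.
    by rewrite /ct avgsB avgs_avgs_sub // subrr mul0r.
  rewrite -mulr_suml; apply: ler_wpM2r; first exact: sqr_ge0.
  by rewrite -natr_sum ler_nat; have := hD i is_; rewrite -sum1_count [in X in (X <= _)%N]big_mkcond.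
(* The last summand is the change of centring from [avgs s (steinT s F)] to [avgs s Tt]. It costs
   [2 * b * eps] once more, whence the factor 4. *)
apply: le_trans (_ : avgs s (fun a => `|steinT s F a - Tt a| + `|Tt a - avgs s Tt a| +
   `|avgs s (fun a => steinT s F a - Tt a) a|) a <= _).
  apply: avgs_le => c; rewrite avgsB.
  have -> : steinT s F c - avgs s (steinT s F) c = (steinT s F c - Tt c) + (Tt c - avgs s Tt c) -
    (avgs s (steinT s F) c - avgs s Tt c) by lra.
  by apply: le_trans (ler_normB _ _) _; rewrite lerD2r ler_normD.
have E3 := @avgs_norm_avgs s s (fun a => steinT s F a - Tt a) a (fun _ => id).
rewrite 2!avgsD; lra.
Qed.

(** [avgs (rem i s) (delta i F)] is the first-order Hoeffding component of [F] at [i]. The [i]-th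
    term of the variance is the second moment of a martingale difference, and averaging this
    difference over the remaining coordinates can only decrease that moment. *)
Lemma variance_lower_bound s F (c : R) a : uniq s ->
  (forall i, i \in s -> c <= avgs s (fun a => avgs (rem i s) (delta i F) a ^+ 2) a) ->
  (size s)%:R * c <= avgs_variance s F a.
Proof.
move=> us h; rewrite avgs_varianceE // /steinT avgs_sum.
have -> : (size s)%:R * c = \sum_(i <- s) c.
  by rewrite big_const_seq count_predT iter_addr_0 mulr_natl.
rewrite [leLHS]big_seq [leRHS]big_seq; apply: ler_sum => i is_.
apply: le_trans (h i is_) _.
set D := avgs (after s i) (delta i F).
have aft_rem : {subset after s i <= rem i s}.
  move=> j; rewrite /after remE => js; rewrite mem_cat; apply/orP; right.
  by [].
have -> : avgs s (fun a => delta i F a * D a) = avgs s (fun a => D a ^+ 2).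
  rewrite -(avgs_avgs_sub _ (@after_sub s i)).
  rewrite (_ : (fun a => delta i F a * D a) = fun a => D a * delta i F a); last first.
    by apply/funext => b; rewrite mulrC.
  by rewrite avgsM // => j js; exact: indep_avgs.
have rs : {subset rem i s <= s} by move=> j; exact: mem_rem.
rewrite -[in leRHS](avgs_avgs_sub _ rs); apply: avgs_le => b.
by rewrite -(avgs_avgs_sub _ aft_rem); exact: avgs_sqr.
Qed.

(* If [A]-values and [B]-values of [g] are [gam] apart, one of the two classes stays at distance
   [gam / 2] from [c]. *)
Lemma spread_bound (g : V -> R) (A B : pred V) (c gam pi : R) :
  0 <= pi -> 0 <= gam -> (forall u v, A u -> B v -> gam <= g v - g u) ->
  pi <= \sum_(v | A v) p v -> pi <= \sum_(v | B v) p v ->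
  pi * (gam ^+ 2 / 4) <= \sum_v p v * (g v - c) ^+ 2.
Proof.
move=> pi0 g0 h hA hB.
pose q v := p v * (g v - c) ^+ 2.
have q0 v : 0 <= q v by rewrite mulr_ge0 // sqr_ge0.
have key (E : pred V) : pi <= \sum_(v | E v) p v ->
    (forall v, E v -> gam ^+ 2 / 4 <= (g v - c) ^+ 2) ->
    pi * (gam ^+ 2 / 4) <= \sum_v q v.
  move=> hp hE; apply: le_trans (_ : (\sum_(v | E v) p v) * (gam ^+ 2 / 4) <= _).
    by apply: ler_wpM2r => //; rewrite divr_ge0 // sqr_ge0.
  rewrite mulr_suml [leRHS](bigID E) /= -[leLHS]addr0.
  apply: lerD; last exact: sumr_ge0.
  by apply: ler_sum => v Ev; rewrite ler_wpM2l // hE.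
case: (boolP [forall v, A v ==> (g v <= c - gam / 2)]) => [/forallP hc|].
  apply: (key A hA) => v Av; have /implyP /(_ Av) := hc v; nra.
rewrite negb_forall => /existsP[u]; rewrite negb_imply -ltNge => /andP[Au hu].
by apply: (key B hB) => v Bv; have := h u v Au Bv; nra.
Qed.

Lemma avgs_upd s i v F a : i \notin s ->
  avgs s F (upd a i v) = avgs s (fun a => F (upd a i v)) a.
Proof.
elim: s a => //= j s IH a; rewrite inE negb_or => /andP[ij is_].
by apply: eq_bigr => w _; rewrite upd_comm // IH.
Qed.

(** With the other coordinates averaged out, [F] becomes a function of the value at [i]; the right
    side is its variance, and [spread_bound] applies with [c] its mean. *)
Lemma influence_lower_bound s F i (A B : pred V) (gam pi : R) a :
  uniq s -> i \in s -> 0 <= pi -> 0 <= gam ->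
  (forall a u v, A u -> B v ->
     gam <= avgs (rem i s) (fun a => F (upd a i v) - F (upd a i u)) a) ->
  pi <= \sum_(v | A v) p v -> pi <= \sum_(v | B v) p v ->
  pi * (gam ^+ 2 / 4) <= avgs s (fun a => avgs (rem i s) (delta i F) a ^+ 2) a.
Proof.
move=> us is_ pi0 g0 h hA hB; rewrite (avgs_rem _ is_) avg_avgsC.
rewrite -[leLHS](congr1 (fun f => f a) (avgs_cst (rem i s) _)); apply: avgs_le => b.
have ir : i \notin rem i s by rewrite mem_rem_uniq // inE eqxx.
rewrite (_ : delta i F = fun a => F a - avg i F a) // avgsB -avg_avgsC.
rewrite [leRHS](_ : _ = \sum_v p v * (avgs (rem i s) F (upd b i v) -
   avg i (avgs (rem i s) F) b) ^+ 2); last first.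
  by apply: eq_bigr => v _; rewrite (indep_avg _ _).
apply: (spread_bound _ pi0 g0 _ hA hB) => u v Au Bv.
rewrite !avgs_upd //; have := h b u v Au Bv.
by rewrite (congr1 (fun f => f b) (avgsB (rem i s) _ _)).
Qed.

(** Stronger than [indep] at every coordinate outside [S]: over an infinite index type, a function
    may ignore each single change and still not be determined by the coordinates in [S]. *)
Definition dep (S : pred I) F :=
  forall a a', (forall i, S i -> a i = a' i) -> F a = F a'.

Lemma dep_avgs s (S : pred I) F : dep (fun i => (i \in s) || S i) F -> dep S (avgs s F).
Proof.
elim: s S => [|i s IH] S //= h a a' aa'; apply: eq_bigr => v _; congr (_ * _).
apply: (IH (fun j => (j == i) || S j)) => [b b' bb'|j]; last first.
  by rewrite /upd; case: eqP => //= _; exact: aa'.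
by apply: h => j hj; apply: bb'; move: hj; rewrite inE; case: (j == i); case: (j \in s).
Qed.

Lemma avgs_dep_const s F a a' : dep (mem s) F -> avgs s F a = avgs s F a'.
Proof.
move=> h; apply: (@dep_avgs s pred0) => // b b' bb'; apply: h => i is_.
by apply: bb'; rewrite orbF.
Qed.

Lemma avgs_relabel (tau : I -> I) s F : injective tau ->
  avgs (map tau s) (fun a => F (a \o tau)) = fun a => avgs s F (a \o tau).
Proof.
move=> ti; elim: s => //= i s ->; apply/funext => a; apply: eq_bigr => v _.
congr (_ * avgs s F _); apply/funext => j.
by rewrite /upd /= (inj_eq ti).
Qed.

Lemma avgs_prod_iid s t (phi : V -> R) a : uniq t -> {subset t <= s} ->
  avgs s (fun a => \prod_(j <- t) phi (a j)) a = (\sum_v p v * phi v) ^+ size t.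
Proof.
elim: t => [|j t IH] /=.
  move=> _ _; rewrite (_ : (fun a => _) = fun=> 1) ?avgs_cst //.
  by apply/funext => b; rewrite big_nil.
move=> /andP[jt ut] ts.
rewrite (_ : (fun a => _) = fun a => phi (a j) * \prod_(j <- t) phi (a j)); last first.
  by apply/funext => b; rewrite big_cons.
have indt k : k \notin t -> indep k (fun a : I -> V => \prod_(j <- t) phi (a j)).
  move=> kt b v; apply: eq_big_seq => l lt; rewrite /upd; case: eqP => // lk.
  by move: kt; rewrite -lk lt.
have ind1 k : k != j -> indep k (fun a : I -> V => phi (a j)).
  by move=> kj b v; rewrite /upd eq_sym (negbTE kj).
rewrite avgs_prod; last first.
  move=> k ks; case: (eqVneq k j) => [->|kj]; [right|left].
    exact: indt.
  exact: ind1.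
rewrite IH //; last by move=> k kt; apply: ts; rewrite inE kt orbT.
rewrite exprS; congr (_ * _).
rewrite (avgs_sub (s := [:: j])) /=.
- by apply: eq_bigr => v _; rewrite /upd eqxx.
- by move=> k; rewrite inE => /eqP ->; apply: ts; rewrite inE eqxx.
- by move=> k _; rewrite inE; exact: ind1.
Qed.

End ProductAverage.

(** * Minimax weights and minimal connecting sets *)

Section Graph.
Variables (X E : choiceType) (ends : E -> {fset X}).
Implicit Types (Q : E -> Prop) (F S : {fset E}) (x y z u v : X) (e g : E).

(** Edges are restricted by a predicate, so that sublevel conditions such as [w e <= t] can be used
    directly; repeated vertices are harmless. *)
Inductive conn Q x : X -> Prop :=
| conn_refl : conn Q x x
| conn_step y e z : conn Q x y -> Q e -> ends e = [fset y; z]%fset -> conn Q x z.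

Lemma conn_edge Q e x y : Q e -> ends e = [fset x; y]%fset -> conn Q x y.
Proof. by move=> Qe; apply: conn_step Qe; exact: conn_refl. Qed.

Lemma conn_trans Q y x z : conn Q x y -> conn Q y z -> conn Q x z.
Proof. by move=> xy; elim=> // u e v _ xu Qe ee; exact: conn_step xu Qe ee. Qed.

Lemma conn_sym Q x y : conn Q x y -> conn Q y x.
Proof.
elim=> [|u e v _ ux Qe ee]; first exact: conn_refl.
by apply: conn_trans ux; apply: (conn_edge Qe); rewrite fsetUC.
Qed.

(** The common core of the exchange arguments below: a removed edge only has to be bypassed by a
    connection in the new set. *)
Lemma conn_reroute Q Q' x y :
  (forall e u v, Q e -> ends e = [fset u; v]%fset -> conn Q' u v) ->
  conn Q x y -> conn Q' x y.
Proof.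
move=> h; elim=> [|u e v _ xu Qe ee]; first exact: conn_refl.
by apply: conn_trans xu _; exact: h Qe ee.
Qed.

Lemma conn_sub Q Q' x y : (forall e, Q e -> Q' e) -> conn Q x y -> conn Q' x y.
Proof. by move=> h; apply: conn_reroute => e u v /h; exact: conn_edge. Qed.

Lemma conn_crossing Q (C : X -> Prop) x y : conn Q x y -> C x -> ~ C y ->
  exists u v e, [/\ Q e, ends e = [fset u; v]%fset, C u & ~ C v].
Proof.
move=> xy Cx; elim: xy => // u e v _ IH Qe ee nCv.
by have [Cu|/IH//] := pselect (C u); exists u, v, e.
Qed.

Lemma fset2_eq (x y u v : X) : [fset x; y]%fset = [fset u; v]%fset ->
  (x = u /\ y = v) \/ (x = v /\ y = u).
Proof.
move=> h.
have : x \in [fset u; v]%fset by rewrite -h !inE eqxx.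
have : y \in [fset u; v]%fset by rewrite -h !inE eqxx orbT.
have : u \in [fset x; y]%fset by rewrite h !inE eqxx.
have : v \in [fset x; y]%fset by rewrite h !inE eqxx orbT.
rewrite !inE => hv hu hy /orP[/eqP xu|/eqP xv]; subst x.
  case/orP: hv => /eqP vE; last by left.
  by left; split => //; case/orP: hy => /eqP ->.
case/orP: hu => /eqP uE; last by right.
by right; split => //; case/orP: hy => /eqP ->.
Qed.

(** Induction on the path: crossing [g] a second time, backwards, returns to an end already reached
    without [g], so at most one crossing has to be kept. *)
Lemma conn_split Q g u v x y : ends g = [fset u; v]%fset ->
  conn Q x y ->
  let Q' := fun e => Q e /\ e <> g in
  [\/ conn Q' x y, conn Q' x u /\ conn Q' v y | conn Q' x v /\ conn Q' u y].
Proof.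
move=> gg xy Q'; elim: xy => [|a e b _ IH Qe ee].
  by apply: Or31; exact: conn_refl.
have [eg|eg] := pselect (e = g); last first.
  have s : conn Q' a b by apply: (@conn_edge _ e).
  case: IH => [h|[h1 h2]|[h1 h2]]; [apply: Or31|apply: Or32|apply: Or33].
  - exact: conn_trans h s.
  - by split => //; exact: conn_trans h2 s.
  - by split => //; exact: conn_trans h2 s.
move: IH; have [[-> ->]|[-> ->]] : (a = u /\ b = v) \/ (a = v /\ b = u).
    by apply: fset2_eq; rewrite -gg -ee eg.
  move=> IH; case: IH => [h|[h1 h2]|[h1 h2]].
  - by apply: Or32; split => //; exact: conn_refl.
  - by apply: Or32; split => //; exact: conn_refl.
  - by apply: Or31.
move=> IH; case: IH => [h|[h1 h2]|[h1 h2]].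
- by apply: Or33; split => //; exact: conn_refl.
- by apply: Or31.
- by apply: Or33; split => //; exact: conn_refl.
Qed.

Lemma fset_minimal (P : {fset E} -> Prop) F : P F ->
  exists F1, [/\ (F1 `<=` F)%fset, P F1 & forall g, g \in F1 -> ~ P (F1 `\ g)%fset].
Proof.
move=> PF.
pose Q n := `[< exists2 F1, (F1 `<=` F)%fset /\ P F1 & #|` F1| = n >].
have exQ : exists n, Q n.
  by exists #|` F|; apply/asboolP; exists F => //; split => //; exact: fsubset_refl.
case: (ex_minnP exQ) => _ /asboolP[F1 [F1F PF1] <-] Fmin.
exists F1; split => // g gF1 cg.
have /Fmin : Q #|` (F1 `\ g)%fset|.
  apply/asboolP; exists (F1 `\ g)%fset => //; split => //.
  by apply: fsubset_trans F1F; exact: fsubD1set.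
by rewrite [X in (X <= _)%N](cardfsD1 g) gF1 add1n ltnn.
Qed.

Variable R : realType.
Implicit Types (w : E -> R).

Lemma bigmin_attained (J : eqType) (r : seq J) (P : pred J) (f : J -> R) (c : R) :
  \big[Num.min/c]_(i <- r | P i) f i = c \/
  exists i, [/\ i \in r, P i & \big[Num.min/c]_(i <- r | P i) f i = f i].
Proof.
elim: r => [|i r IH]; first by left; rewrite big_nil.
rewrite big_cons; case: ifP => Pi; last first.
  by case: IH => [->|[j [jr Pj ->]]]; [left|right; exists j; rewrite inE jr orbT].
case: (leP (f i) (\big[Num.min/c]_(i <- r | P i) f i)) => _.
  by right; exists i; rewrite inE eqxx.
by case: IH => [->|[j [jr Pj ->]]]; [left|right; exists j; rewrite inE jr orbT].
Qed.

(* The minimax weight of the paths from [x] to [y] in [S], capped at [b]. *)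
Definition bottleneck S x y (b : R) w : R :=
  \big[Num.min/b]_(F <- fpowerset S | `[< conn (fun e => e \in F) x y >])
     \big[Num.max/0]_(e <- F) w e.

Lemma bottleneck_le_cap S x y b w : bottleneck S x y b w <= b.
Proof. exact: bigmin_le_id. Qed.

Lemma bottleneck_ge0 S x y b w : 0 <= b -> 0 <= bottleneck S x y b w.
Proof.
by move=> b0; apply: le_bigmin => // F _; exact: bigmax_ge_id.
Qed.

Lemma bottleneck_le S x y b w t : 0 <= t ->
  conn (fun e => e \in S /\ w e <= t) x y -> bottleneck S x y b w <= t.
Proof.
move=> t0 xy; pose F := [fset e in S | w e <= t]%fset.
apply: (bigmin_inf_seq _ F) => //.
- by rewrite fpowersetE; apply/fsubsetP => e; rewrite !inE => /andP[].
- by apply/asboolP; apply: conn_sub xy => e [eS et]; rewrite !inE eS.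
- rewrite big_seq; apply: bigmax_le => // e.
  by rewrite !inE => /andP[].
Qed.

Lemma bottleneck_conn S x y b w : bottleneck S x y b w < b ->
  conn (fun e => e \in S /\ w e <= bottleneck S x y b w) x y.
Proof.
rewrite /bottleneck.
have [->|[F [FS /asboolP cF ->]]] := bigmin_attained (fpowerset S)
   (fun F => `[< conn (fun e => e \in F) x y >]) (fun F => \big[Num.max/0]_(e <- F) w e) b.
  by rewrite ltxx.
move=> _; apply: conn_sub cF => e eF; split.
  by move: FS; rewrite fpowersetE => /fsubsetP; exact.
exact: le_bigmax_seq.
Qed.

Lemma bottleneck_mono S S' x y b w : 0 <= b -> {subset S <= S'} ->
  bottleneck S' x y b w <= bottleneck S x y b w.
Proof.
move=> b0 SS'; case: (ltP (bottleneck S x y b w) b) => [h|h].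
  apply: bottleneck_le; first exact: bottleneck_ge0.
  by apply: conn_sub (bottleneck_conn h) => e [/SS'].
exact: le_trans (bottleneck_le_cap _ _ _ _ _) h.
Qed.

Lemma bottleneck_lipschitz S x y b w w' eps : 0 <= b -> 0 <= eps ->
  {in S, forall e, w' e <= w e + eps} ->
  bottleneck S x y b w' <= bottleneck S x y b w + eps.
Proof.
move=> b0 e0 ww'; case: (ltP (bottleneck S x y b w) b) => [h|h].
  apply: bottleneck_le; first by apply: addr_ge0 => //; exact: bottleneck_ge0.
  apply: conn_sub (bottleneck_conn h) => e [eS we]; split => //.
  by apply: le_trans (ww' e eS) _; rewrite lerD2r.
apply: le_trans (bottleneck_le_cap _ _ _ _ _) _.
by apply: le_trans h _; rewrite lerDl.
Qed.

Lemma bottleneck_dep S x y b w w' : 0 <= b -> {in S, w =1 w'} ->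
  bottleneck S x y b w = bottleneck S x y b w'.
Proof.
move=> b0 ww'; apply/eqP; rewrite eq_le; apply/andP; split.
  rewrite -[leRHS]addr0; apply: bottleneck_lipschitz => // e eS.
  by rewrite ww' ?addr0.
rewrite -[leRHS]addr0; apply: bottleneck_lipschitz => // e eS.
by rewrite ww' ?addr0.
Qed.

(** Any connection to [y] leaves [x] through an edge at [x], which already weighs [t]; if there is
    no connection below the cap, [t <= b] suffices. *)
Lemma bottleneck_star S x y b w t : 0 <= b -> x <> y -> t <= b ->
  (forall e, e \in S -> x \in ends e -> t <= w e) ->
  t <= bottleneck S x y b w.
Proof.
move=> b0 xy tb h; rewrite leNgt; apply/negP => lt.
have := bottleneck_conn (lt_le_trans lt tb).
move=> /(@conn_crossing _ (eq x)) /(_ erefl xy) [u [v [e [[eS we] ee ux nvx]]]].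
have := h e eS; rewrite ee -ux !inE eqxx => /(_ isT) /le_trans /(_ we).
by rewrite leNgt lt.
Qed.

(** A graph morphism carries connections to connections. Applied to a translation and to its
    inverse, it gives translation invariance. *)
Lemma bottleneck_map S S' (tE : E -> E) (tX : X -> X) x y b w : 0 <= b ->
  {in S, forall e, tE e \in S'} ->
  (forall e u v, ends e = [fset u; v]%fset -> ends (tE e) = [fset tX u; tX v]%fset) ->
  bottleneck S' (tX x) (tX y) b w <= bottleneck S x y b (w \o tE).
Proof.
move=> b0 tS tends; case: (ltP (bottleneck S x y b (w \o tE)) b) => [h|h].
  apply: bottleneck_le; first exact: bottleneck_ge0.
  have := bottleneck_conn h; move: (bottleneck S x y b _) => t.
  elim=> [|u e v _ IH [eS we] ee]; first exact: conn_refl.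
  by apply: (@conn_step _ _ _ (tE e) _ IH); [split; [exact: tS|]|exact: tends].
exact: le_trans (bottleneck_le_cap _ _ _ _ _) h.
Qed.

(** * Exchange of edges in connecting sets *)

Section Connector.
Variable Vt : {pred X}.

(** Acyclicity is dropped, which makes sets easy to modify by exchanging edges. For nonnegative
    weights the least weight is still that of a minimal spanning tree, see [mst_connector]. *)
Definition connector F := {in Vt &, forall x y, conn (fun e => e \in F) x y}.

(** The default of the minimum is the weight of [S], itself a candidate as soon as [S] connects; the
    minimum is then attained. *)
Definition connector_weight S w : R :=
  \big[Num.min/(\sum_(e <- S) w e)%R]_(F <- fpowerset S | `[< connector F >]) \sum_(e <- F) w e.

Lemma connector_weight_le S F w : (F `<=` S)%fset -> connector F ->
  connector_weight S w <= \sum_(e <- F) w e.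
Proof.
move=> FS cF; apply: (bigmin_inf_seq _ F) => //; first by rewrite fpowersetE.
exact/asboolP.
Qed.

Lemma connector_weight_attained S w : connector S ->
  exists F, [/\ (F `<=` S)%fset, connector F & connector_weight S w = \sum_(e <- F) w e].
Proof.
move=> cS; rewrite /connector_weight.
have [->|[F [FS /asboolP cF ->]]] := bigmin_attained (fpowerset S)
   (fun F => `[< connector F >]) (fun F => \sum_(e <- F) w e) (\sum_(e <- S) w e).
  by exists S.
by exists F; split => //; rewrite -fpowersetE.
Qed.

(* Trading [e] for a heaviest edge on the path of the connector joining the endpoints of [e]. *)
Lemma exchange_in S F e x y b w : 0 <= b -> {in S, forall e, 0 <= w e} ->
  (F `<=` S)%fset -> connector F -> e \notin F ->
  x <> y -> ends e = [fset x; y]%fset -> x \in Vt -> y \in Vt ->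
  exists g, [/\ g \in F, bottleneck (S `\ e)%fset x y b w <= w g &
     connector (e |` (F `\ g))%fset].
Proof.
move=> b0 w0 FS cF eF xy ee xV yV.
have [F1 [F1F cF1 F1min]] :=
  fset_minimal (P := fun F => conn (fun e => e \in F) x y) (cF x y xV yV).
have F1S : {subset F1 <= (S `\ e)%fset}.
  move=> g /(fsubsetP F1F) gF; rewrite !inE (fsubsetP FS) // andbT.
  by apply: contraNneq eF => <-.
have [g0 g0F1] : exists g, g \in F1.
  by have [u [v [g [gF1 _ _ _]]]] := conn_crossing cF1 (erefl x) (fun h => xy h); exists g.
set al := bottleneck _ _ _ _ _.
have [g gF1 alg] : exists2 g, g \in F1 & al <= w g.
  (* Maxima start from 0, so the contradiction below needs [al] positive; otherwise any edge of [F1]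
     will do. *)
  have [al0|al0] := leP al 0.
    exists g0 => //; apply: le_trans al0 _; apply: w0; apply: (fsubsetP FS).
    exact: (fsubsetP F1F).
  apply: contrapT => nex.
  have : al <= \big[Num.max/0]_(e <- F1) w e.
    apply: (bigmin_inf_seq _ F1) => //; last exact/asboolP.
    by rewrite fpowersetE; apply/fsubsetP.
  rewrite leNgt => /negP; apply; rewrite big_seq; apply: bigmax_lt => // g gF1.
  by rewrite ltNge; apply/negP => h; apply: nex; exists g.
exists g; split => //; first exact: (fsubsetP F1F).
have [u [v gg]] : exists u v, ends g = [fset u; v]%fset.
  apply: contrapT => nuv; apply: (F1min _ gF1); apply: conn_reroute cF1 => h u v hF1 hh.
  apply: (@conn_edge _ h) => //; rewrite !inE hF1 andbT.
  by apply/eqP => hg; apply: nuv; exists u, v; rewrite -hg.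
have H k : k \in F1 /\ k <> g -> k \in (e |` (F `\ g))%fset.
  by move=> [kF1 /eqP kg]; rewrite !inE kg (fsubsetP F1F) // orbT.
have ce : conn (fun k => k \in (e |` (F `\ g))%fset) x y.
  by apply: (@conn_edge _ e) => //; rewrite !inE eqxx.
(* By minimality of [F1], the edge [g] cannot be avoided between [x] and [y]; hence its ends are
   joined by going the other way round, through [e]. *)
have guv : conn (fun k => k \in (e |` (F `\ g))%fset) u v.
  have [h|[h1 h2]|[h1 h2]] := conn_split gg cF1.
  - exfalso; apply: (F1min _ gF1); apply: conn_sub h => k [kF1 /eqP kg].
    by rewrite !inE kF1 kg.
  - have h1' := conn_sub H h1; have h2' := conn_sub H h2.
    apply: conn_trans (conn_sym h1') _; apply: conn_trans ce _; exact: conn_sym.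
  - have h1' := conn_sub H h1; have h2' := conn_sub H h2.
    apply: conn_trans h2' _; apply: conn_trans (conn_sym ce) _; exact: h1'.
move=> a c aV cV; apply: conn_reroute (cF a c aV cV) => h s t hF hh.
have [hg|/eqP hg] := pselect (h = g); last first.
  by apply: (@conn_edge _ h) => //; rewrite !inE hg hF orbT.
have [[-> ->]|[-> ->]] : (s = u /\ t = v) \/ (s = v /\ t = u).
    by apply: fset2_eq; rewrite -hh hg.
  exact: guv.
exact: conn_sym.
Qed.

(** If removing [e] separates [x] from [y], a connection realising the bottleneck must leave the
    component of [x]. The edge by which it leaves reaches the component of [y], so it can replace
    [e]. *)
Lemma exchange_out S F e x y b w : 0 <= b ->
  (F `<=` S)%fset -> connector F -> e \in F ->
  ends e = [fset x; y]%fset -> x \in Vt -> y \in Vt ->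
  (forall g, g \in S -> exists u v, [/\ ends g = [fset u; v]%fset, u \in Vt & v \in Vt]) ->
  bottleneck (S `\ e)%fset x y b w < b ->
  connector (F `\ e)%fset \/
  exists g, [/\ g \in (S `\ e)%fset, w g <= bottleneck (S `\ e)%fset x y b w &
     connector (g |` (F `\ e))%fset].
Proof.
move=> b0 FS cF eF ee xV yV hV lt; have cb := bottleneck_conn lt.
set al := bottleneck _ _ _ _ _ in lt cb *.
have rer F' : (F `\ e `<=` F')%fset -> conn (fun k => k \in F') x y -> connector F'.
  move=> FF' cxy a c aV cV; apply: conn_reroute (cF a c aV cV) => h s t hF hh.
  have [he|/eqP he] := pselect (h = e); last first.
    by apply: (@conn_edge _ h) => //; apply: (fsubsetP FF'); rewrite !inE he hF.
  have [[-> ->]|[-> ->]] : (s = x /\ t = y) \/ (s = y /\ t = x).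
      by apply: fset2_eq; rewrite -hh he.
    exact: cxy.
  exact: conn_sym.
have [cxy|ncxy] := pselect (conn (fun k => k \in (F `\ e)%fset) x y).
  by left; apply: rer => //; exact: fsubset_refl.
right; have [u [v [g [[gS wg] gg xu nxv]]]] := conn_crossing cb (conn_refl _ x) ncxy.
exists g; split => //; apply: rer; first exact: fsubsetU1.
have sub k : k \in (F `\ e)%fset -> k \in (g |` (F `\ e))%fset.
  by move=> kF; rewrite inE kF orbT.
have vV : v \in Vt.
  have [u' [v' [gg' uV vV]]] := hV g (fsubsetP (fsubD1set _ _) _ gS).
  by have [[_ ->]|[_ ->]] := fset2_eq (etrans (esym gg) gg').
have vy : conn (fun k => k \in (F `\ e)%fset) v y.
  have H k : k \in F /\ k <> e -> k \in (F `\ e)%fset.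
    by move=> [kF /eqP ke]; rewrite !inE ke.
  have [h|[h1 h2]|[h1 h2]] := conn_split ee (cF v y vV yV).
  - exact: conn_sub h.
  - by exfalso; apply: nxv; apply: conn_sym; exact: conn_sub h1.
  - exact: conn_sub h1.
apply: conn_trans (conn_sub sub xu) _; apply: conn_trans (conn_sub sub vy).
by apply: (@conn_edge _ g) => //; rewrite !inE eqxx.
Qed.

(** An optimal connector for [w'] is turned into a candidate for [w]. If it lacks [e], [exchange_in]
    may bring [e] in; if it contains [e], [exchange_out] may remove it. Whichever of [w e] and the
    bottleneck is smaller decides whether to do so. *)
Lemma connector_weight_le_diff S e x y b w w' : 0 <= b ->
  connector S -> e \in S ->
  x <> y -> ends e = [fset x; y]%fset -> x \in Vt -> y \in Vt ->
  (forall g, g \in S -> exists u v, [/\ ends g = [fset u; v]%fset, u \in Vt & v \in Vt]) ->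
  {in S, forall g, 0 <= w g <= b} -> {in S, forall g, 0 <= w' g <= b} ->
  {in (S `\ e)%fset, w =1 w'} ->
  connector_weight S w - Num.min (w e) (bottleneck (S `\ e)%fset x y b w) <=
  connector_weight S w' - Num.min (w' e) (bottleneck (S `\ e)%fset x y b w').
Proof.
move=> b0 cS eS xy ee xV yV hV w0 w0' ww'.
rewrite -(bottleneck_dep x y b0 ww'); set al := bottleneck _ _ _ _ _.
have al0 : 0 <= al by exact: bottleneck_ge0.
have [F [FS cF ->]] := connector_weight_attained w' cS.
have sumE F' : (F' `<=` S)%fset -> e \notin F' -> \sum_(k <- F') w' k = \sum_(k <- F') w k.
  move=> F'S eF'; apply: eq_big_seq => k kF'; rewrite ww' // !inE (fsubsetP F'S) // andbT.
  by apply: contraNneq eF' => <-.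
have D1 F' k (ww : E -> R) : k \in F' -> \sum_(j <- F') ww j = ww k + \sum_(j <- (F' `\ k)%fset) ww j.
  by move=> kF'; rewrite (big_fsetD1 k).
have U1 F' k (ww : E -> R) : k \notin F' -> \sum_(j <- (k |` F')%fset) ww j = ww k + \sum_(j <- F') ww j.
  by move=> kF'; rewrite big_fsetU1.
have FeS : (F `\ e `<=` S)%fset by apply: fsubset_trans FS; exact: fsubD1set.
have eFe : e \notin (F `\ e)%fset by rewrite !inE eqxx.
case: (boolP (e \in F)) => eF; last first.
  have [|g [gF alg cg]] := exchange_in b0 _ FS cF eF xy ee xV yV (w := w).
    by move=> k /w0 /andP[].
  have gS : g \in S by exact: (fsubsetP FS).
  have gF' : (e |` (F `\ g) `<=` S)%fset.
    rewrite fsubUset fsub1set eS /=; apply: fsubset_trans FS; exact: fsubD1set.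
  have h1 := connector_weight_le w gF' cg.
  have h2 := connector_weight_le w FS cF.
  rewrite U1 in h1; last by rewrite !inE negb_and eF orbT.
  rewrite (D1 _ _ _ gF) in h2; rewrite sumE // (D1 _ _ _ gF).
  have : Num.min (w' e) al <= al by rewrite ge_min lexx orbT.
  by case: (leP (w e) al) => _; move: alg h1 h2; rewrite -/al; lra.
rewrite (D1 _ _ _ eF) sumE //.
have h1 := connector_weight_le w FS cF; rewrite (D1 _ _ _ eF) in h1.
have h3 : Num.min (w' e) al <= w' e by rewrite ge_min lexx.
suff h2 : al < w e -> connector_weight S w <= \sum_(j <- (F `\ e)%fset) w j + al.
  by case: (leP (w e) al) => [?|/h2]; lra.
(* As [w e] is at most the cap, the bottleneck lies below the cap and comes from an actual
   connection. *)
move=> alw; have alb : al < b by apply: lt_le_trans alw _; have /andP[] := w0 e eS.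
have [cFe|[g [gS wg cg]]] := exchange_out b0 FS cF eF ee xV yV hV alb.
  by have := connector_weight_le w FeS cFe; lra.
have gS' : (g |` (F `\ e) `<=` S)%fset.
  by rewrite fsubUset fsub1set FeS andbT; exact: (fsubsetP (fsubD1set _ _) _ gS).
have := connector_weight_le w gS' cg.
case: (boolP (g \in (F `\ e)%fset)) => gF.
  rewrite (_ : (g |` (F `\ e))%fset = (F `\ e)%fset); first by lra.
  by apply/fsetUidPr; rewrite fsub1set.
by rewrite U1 //; move: wg; rewrite -/al; lra.
Qed.

(** The one-sided bound is used in both directions; the bottleneck does not read the weight of [e],
    so it is the same for [w] and [w']. *)
Lemma connector_weight_diff S e x y b w w' : 0 <= b ->
  connector S -> e \in S ->
  x <> y -> ends e = [fset x; y]%fset -> x \in Vt -> y \in Vt ->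
  (forall g, g \in S -> exists u v, [/\ ends g = [fset u; v]%fset, u \in Vt & v \in Vt]) ->
  {in S, forall g, 0 <= w g <= b} -> {in S, forall g, 0 <= w' g <= b} ->
  {in (S `\ e)%fset, w =1 w'} ->
  connector_weight S w - connector_weight S w' =
  Num.min (w e) (bottleneck (S `\ e)%fset x y b w) -
  Num.min (w' e) (bottleneck (S `\ e)%fset x y b w).
Proof.
move=> b0 cS eS xy ee xV yV hV w0 w0' ww'.
have h1 := connector_weight_le_diff b0 cS eS xy ee xV yV hV w0 w0' ww'.
have ww'' : {in (S `\ e)%fset, w' =1 w} by move=> k /ww' ->.
have h2 := connector_weight_le_diff b0 cS eS xy ee xV yV hV w0' w0 ww''.
move: h1 h2; rewrite -(bottleneck_dep x y b0 ww'); lra.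
Qed.

Lemma connector_weight_lipschitz S w w' eps : connector S -> 0 <= eps ->
  {in S, forall g, `|w g - w' g| <= eps} ->
  `|connector_weight S w - connector_weight S w'| <= #|` S|%:R * eps.
Proof.
move=> cS e0.
have h w1 w2 : {in S, forall g, `|w1 g - w2 g| <= eps} ->
    connector_weight S w1 <= connector_weight S w2 + #|` S|%:R * eps.
  move=> h; have [F [FS cF ->]] := connector_weight_attained w2 cS.
  apply: le_trans (connector_weight_le w1 FS cF) _.
  rewrite -lerBlDl -sumrB; apply: le_trans (_ : \sum_(e <- F) eps <= _).
    rewrite big_seq [leRHS]big_seq; apply: ler_sum => e eF.
    by apply: le_trans (ler_norm _) _; apply: h; exact: (fsubsetP FS).
  rewrite big_const_seq count_predT iter_addr_0 mulr_natl.
  by apply: ler_wpMn2l => //; exact: fsubset_leq_card.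
move=> ww'; have h1 := h _ _ ww'.
have ww'' : {in S, forall g, `|w' g - w g| <= eps} by move=> g /ww'; rewrite distrC.
have h2 := h _ _ ww''.
by rewrite ler_norml; lra.
Qed.

Lemma connector_weight_dep S w w' : connector S -> {in S, w =1 w'} ->
  connector_weight S w = connector_weight S w'.
Proof.
move=> cS ww'; apply/eqP; rewrite -subr_eq0 -normr_le0.
have := @connector_weight_lipschitz S w w' 0 cS (lexx _).
rewrite mulr0; apply=> g gS.
by rewrite ww' // subrr normr0.
Qed.

End Connector.
End Graph.

(** * The lattice *)

Section Lattice.
Variable d : nat.
Implicit Types (x y z : lattice d) (e : edge d) (i : 'I_d).

Definition unit_vector i : lattice d := [ffun j => (j == i)%:Z].

Lemma is_edgeP (e : {fset lattice d}) :
  reflect (exists x y, e = [fset x; y]%fset /\ neighbours x y) (is_edge e).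
Proof.
apply: (iffP existsP) => [[x /existsP[y /andP[/eqP eE n]]]|[x [y [eE n]]]].
  by exists (val x), (val y).
have xe : x \in e by rewrite eE !inE eqxx.
have ye : y \in e by rewrite eE !inE eqxx orbT.
by exists [` xe]%fset; apply/existsP; exists [` ye]%fset; rewrite /= eE eqxx.
Qed.

Lemma neighbours_unit x i : neighbours x (x + unit_vector i).
Proof.
rewrite /neighbours (bigD1 i) //= big1 => [|j ji].
  by rewrite !ffunE eqxx opprD addNKr sqrrN expr1n addr0.
by rewrite !ffunE (negbTE ji) addr0 subrr expr0n.
Qed.

Lemma neighboursN x y : neighbours x y -> x <> y.
Proof.
move=> h xy; move: h; rewrite xy /neighbours big1 // => i _.
by rewrite subrr expr0n.
Qed.

Lemma neighboursP x y : neighbours x y ->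
  exists i, y = x + unit_vector i \/ x = y + unit_vector i.
Proof.
move=> /eqP h.
have [i xyi] : exists i, x i != y i.
  apply/existsP; rewrite -negb_forall; apply/negP => /forallP xy.
  by move: h; rewrite big1 // => i _; rewrite (eqP (xy i)) subrr expr0n.
move: h; rewrite (bigD1 i) //=; set r := \sum_(j < d | _) _ => h.
have r0 : 0 <= r by apply: sumr_ge0 => j _; exact: sqr_ge0.
have s1 : 1 <= (x i - y i) ^+ 2.
  have : 0 < (x i - y i) ^+ 2 by rewrite exprn_even_gt0 //= subr_eq0.
  by [].
have r00 : r = 0 by apply: le_anti; rewrite r0 andbT; move: h s1; set t := _ ^+ 2; move: t r0 => t; move: r => r; lia.
have /eqP t1 : (x i - y i) ^+ 2 = 1 by rewrite -[RHS]h r00 addr0.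
move/eqP: r00; rewrite psumr_eq0 => [|j _]; last exact: sqr_ge0.
move=> /allP r0'.
have xyj j : j != i -> x j = y j.
  move=> ji; have := r0' j (mem_index_enum _); rewrite ji /= sqrf_eq0 subr_eq0.
  by move/eqP.
move: t1; rewrite sqrf_eq1 => /orP[/eqP xy|/eqP xy]; exists i; [right|left]; apply/ffunP => j; rewrite !ffunE.
  by case: (eqVneq j i) => [->|/xyj ->]; rewrite /= ?addr0 //; move: xy; lia.
by case: (eqVneq j i) => [->|/xyj ->]; rewrite /= ?addr0 //; move: xy; lia.
Qed.

Definition mk_edge x i : edge d :=
  exist _ [fset x; (x + unit_vector i)%R]%fset
    (introT (is_edgeP _) (ex_intro _ x (ex_intro _ (x + unit_vector i)
       (conj erefl (neighbours_unit x i))))).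

Lemma edge_mk e : exists p : lattice d * 'I_d, e = mk_edge p.1 p.2.
Proof.
case: e => e ee; have /is_edgeP[x [y [eE /neighboursP [i [yE|xE]]]]] := ee.
  by exists (x, i); apply: val_inj; rewrite /= -yE.
by exists (y, i); apply: val_inj; rewrite /= -xE fsetUC.
Qed.

(** Every edge is oriented along a positive coordinate direction. The representation is unique by
    [base_mk], so the choice made here is canonical. *)
Definition base e : lattice d * 'I_d := projT1 (cid (edge_mk e)).

Lemma baseE e : e = mk_edge (base e).1 (base e).2.
Proof. exact: projT2 (cid (edge_mk e)). Qed.

Definition tl e := (base e).1.
Definition hd e := (base e).1 + unit_vector (base e).2.

Lemma endsE e : val e = [fset tl e; hd e]%fset.
Proof. by rewrite {1}(baseE e). Qed.

Lemma tl_hd e : tl e <> hd e.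
Proof. by apply: neighboursN; exact: neighbours_unit. Qed.

Lemma translate_subproof z e : is_edge [fset (x + z)%R | x in val e]%fset.
Proof.
apply/is_edgeP; have /is_edgeP[x [y [-> n]]] := valP e.
exists (x + z), (y + z); split.
  apply/fsetP => u; rewrite !inE; apply/imfsetP/orP => /=.
    by move=> [v]; rewrite !inE => /orP[]/eqP-> ->; [left|right].
  move=> [/eqP->|/eqP->]; [exists x|exists y] => //.
    by rewrite !inE eqxx.
  by rewrite !inE eqxx orbT.
move: n; rewrite /neighbours; congr (_ == _); apply: eq_bigr => i _.
by rewrite !ffunE opprD addrACA subrr addr0.
Qed.

Definition translate z e : edge d :=
  exist (fun f => is_edge f) _ (translate_subproof z e).

Lemma translateE z e u v : val e = [fset u; v]%fset ->
  val (translate z e) = [fset (u + z)%R; (v + z)%R]%fset.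
Proof.
move=> eE; rewrite /= eE; apply/fsetP => a; rewrite !inE; apply/imfsetP/orP => /=.
  by move=> [b]; rewrite !inE => /orP[]/eqP-> ->; [left|right].
move=> [/eqP->|/eqP->]; [exists u|exists v] => //.
  by rewrite !inE eqxx.
by rewrite !inE eqxx orbT.
Qed.

Lemma translateK z : cancel (translate z) (translate (- z)).
Proof.
move=> e; apply: val_inj; rewrite (translateE _ (translateE z (endsE e))).
by rewrite !addrK -endsE.
Qed.

Lemma translateNK z : cancel (translate (- z)) (translate z).
Proof. by move=> e; rewrite -{1}[z]opprK translateK. Qed.

Lemma translate_mk z x i : translate z (mk_edge x i) = mk_edge (x + z) i.
Proof. by apply: val_inj; rewrite (translateE z (erefl (val (mk_edge x i)))) /= addrAC. Qed.

(** * Boxes and their edges as finite sets *)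

Definition cube_point n (f : {ffun 'I_d -> 'I_(2 * n).+1}) : lattice d :=
  [ffun i => (f i)%:Z - n%:Z].

Definition cube (n : nat) : {fset lattice d} :=
  [fset cube_point f | f in enum {ffun 'I_d -> 'I_(2 * n).+1}]%fset.

Lemma cubeP n x : reflect (forall i, `|x i| <= n%:Z) (x \in cube n).
Proof.
rewrite /cube; apply: (iffP (imfsetP _ _ _ _)) => [[f _ ->] i|h].
  rewrite !ffunE ler_norml; have := ltn_ord (f i); move: (nat_of_ord _) => k; lia.
exists [ffun i => inord `|(x i + n%:Z)%R|%N]; first by rewrite /= mem_enum.
apply/ffunP => i; rewrite !ffunE; have := h i; rewrite ler_norml => hi.
by rewrite inordK; move: hi; move: (x i) => k; lia.
Qed.

Lemma mem_cube n x : (x \in cube n) = (x \in box d n).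
Proof. by apply/cubeP/forallP. Qed.

Lemma card_cube n : #|` cube n| = ((2 * n).+1 ^ d)%N.
Proof.
rewrite card_imfset /=; last first.
  move=> f g /ffunP fg; apply/ffunP => i; apply: val_inj.
  by have := fg i; rewrite !ffunE /=; lia.
by rewrite undup_id ?enum_uniq // -cardE card_ffun !card_ord.
Qed.

Definition cube_edges n : {fset edge d} :=
  [fset e in [seq mk_edge x i | x <- cube n, i <- enum 'I_d] | val e `<=` cube n]%fset.

Lemma mem_cube_edges n e : (e \in cube_edges n) = (val e `<=` cube n)%fset.
Proof.
rewrite !inE /= andbC; case: (boolP (val e `<=` cube n)%fset) => //= h.
apply/allpairsP; exists (base e); rewrite mem_enum; split=> //; last exact: baseE.
by apply: (fsubsetP h); rewrite endsE !inE eqxx.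
Qed.

Lemma cube_edgesP n e :
  (e \in cube_edges n) = (tl e \in cube n) && (hd e \in cube n).
Proof. by rewrite mem_cube_edges endsE fsubUset !fsub1set. Qed.

Lemma box_edgesE n : box_edges d n = [set` cube_edges n].
Proof.
apply/seteqP; split => e /=; rewrite /box_edges /= mem_cube_edges.
  by move=> h; apply/fsubsetP => x /h; rewrite mem_cube.
by move=> /fsubsetP h x /h; rewrite mem_cube.
Qed.

Definition shifted_edges z n : {fset edge d} := (translate z @` cube_edges n)%fset.

Lemma mem_shifted z n e : (e \in shifted_edges z n) = (translate (- z) e \in cube_edges n).
Proof.
apply/imfsetP/idP => [[f fn ->]|h]; first by rewrite translateK.
by exists (translate (- z) e) => //; rewrite translateNK.
Qed.

Lemma shiftedP z n e : (e \in shifted_edges z n) =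
  (tl e - z \in cube n) && (hd e - z \in cube n).
Proof.
by rewrite mem_shifted mem_cube_edges (translateE _ (endsE e)) fsubUset !fsub1set.
Qed.

Lemma unit_vector_inj x i y j : x = y + unit_vector j -> y = x + unit_vector i -> False.
Proof.
move=> xy yx; have := congr1 (fun f : lattice d => f i) yx; rewrite xy !ffunE eqxx.
by case: (i == j) => /=; lia.
Qed.

Lemma mk_edge_inj x i y j : mk_edge x i = mk_edge y j -> (x, i) = (y, j).
Proof.
move=> /(congr1 val) /= /fset2_eq [[<- /addrI ij]|[xy yx]]; last first.
  by exfalso; exact: unit_vector_inj xy (esym yx).
congr (_, _); have := congr1 (fun f : lattice d => f i) ij; rewrite !ffunE eqxx.
by case: eqP.
Qed.

Lemma base_mk x i : base (mk_edge x i) = (x, i).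
Proof. by apply: esym; rewrite [RHS]surjective_pairing; apply: mk_edge_inj; exact: baseE. Qed.

Lemma base_inj : injective base.
Proof. by move=> e f ef; rewrite (baseE e) ef -baseE. Qed.

Lemma tl_mk x i : tl (mk_edge x i) = x.
Proof. by rewrite /tl base_mk. Qed.

Lemma hd_mk x i : hd (mk_edge x i) = x + unit_vector i.
Proof. by rewrite /hd base_mk. Qed.

Lemma cubeN n x : x \in cube n -> - x \in cube n.
Proof. by move=> /cubeP h; apply/cubeP => i; rewrite !ffunE normrN. Qed.

Lemma cubeD n m x y : x \in cube n -> y \in cube m -> x + y \in cube (n + m).
Proof.
move=> /cubeP hx /cubeP hy; apply/cubeP => i; rewrite !ffunE PoszD.
by apply: le_trans (ler_normD _ _) _; exact: lerD.
Qed.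

Lemma cubeS n m : (n <= m)%N -> {subset cube n <= cube m}.
Proof.
move=> nm x /cubeP h; apply/cubeP => i; apply: le_trans (h i) _; by rewrite lez_nat.
Qed.

Lemma cube0 n : 0 \in cube n.
Proof. by apply/cubeP => i; rewrite ffunE normr0. Qed.

Lemma unit_vector_cube i : unit_vector i \in cube 1.
Proof. by apply/cubeP => j; rewrite ffunE; case: (j == i). Qed.

Notation conn := (@conn (lattice d) (edge d) (fun e => val e)).
Notation connector := (@connector (lattice d) (edge d) (fun e => val e)).

(** Induction on the sum of the absolute coordinates: moving a nonzero coordinate one step towards 0
    never leaves the cube. *)
Lemma conn_cube n x : x \in cube n -> conn (fun e => e \in cube_edges n) x 0.
Proof.
elim: {x}_.+1 {-2}x (ltnSn (\sum_i `|x i|%N)) => // m IH x; rewrite ltnS => xm xn.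
have [x0|[i xi]] : x = 0 \/ exists i, x i != 0.
- have [/forallP h|] := boolP [forall i, x i == 0].
    by left; apply/ffunP => i; rewrite ffunE; exact/eqP.
  by rewrite negb_forall => /existsP; right.
- by rewrite x0; exact: conn_refl.
have step y : (forall j, j != i -> y j = x j) -> (`|y i| < `|x i|)%N ->
   (y = x + unit_vector i \/ x = y + unit_vector i) ->
   conn (fun e => e \in cube_edges n) x 0.
  move=> yj yi xy.
  have yn : y \in cube n.
    apply/cubeP => j; have /cubeP/(_ j) := xn.
    by case: (eqVneq j i) => [->|/yj ->//]; move: yi; lia.
  have lt : (\sum_i `|y i| < m)%N.
    apply: leq_trans xm; rewrite (bigD1 i) //= [X in (_ < X)%N](bigD1 i) //= -addSn.
    apply: leq_add => //; apply: leq_sum => j ji; by rewrite yj.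
  apply: conn_trans (IH y lt yn).
  case: xy => xy.
    apply: (@conn_edge _ _ _ _ (mk_edge x i)); last by rewrite /= xy.
    by rewrite cube_edgesP tl_mk hd_mk -xy xn.
  apply: (@conn_edge _ _ _ _ (mk_edge y i)); last by rewrite /= xy fsetUC.
  by rewrite cube_edgesP tl_mk hd_mk -xy yn.
have [xi0|xi0] := ltP 0 (x i).
  apply: (step (x - unit_vector i)); last by right; rewrite subrK.
    by move=> j ji; rewrite !ffunE (negbTE ji) subr0.
  by rewrite !ffunE eqxx; move: xi0; move: (x i) => k; lia.
apply: (step (x + unit_vector i)); last by left.
  by move=> j ji; rewrite !ffunE (negbTE ji) addr0.
by rewrite !ffunE eqxx; move: xi0 xi; move: (x i) => k; lia.
Qed.

Lemma cube_connector n : connector (box d n) (cube_edges n).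
Proof.
move=> x y; rewrite -!mem_cube => xn yn.
exact: conn_trans (conn_cube xn) (conn_sym (conn_cube yn)).
Qed.

(** * Minimal spanning trees as minimal connecting sets *)

Lemma path_conn (F : {fset edge d}) x p :
  path (linked F) x p -> conn (fun e => e \in F) x (last x p).
Proof.
elim: p x => [|y p IH] x /=; first by move=> _; exact: conn_refl.
move=> /andP[/hasP[e eF /eqP ee] /IH]; apply: conn_trans.
by apply: (@conn_edge _ _ _ _ e).
Qed.

Lemma conn_path (F : {fset edge d}) x y : conn (fun e => e \in F) x y ->
  exists2 p, path (linked F) x p & last x p = y.
Proof.
elim=> [|u e v _ [p px pu] eF ee]; first by exists [::].
exists (rcons p v); last by rewrite last_rcons.
by rewrite rcons_path px pu; apply/hasP; exists e => //; apply/eqP.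
Qed.

Lemma path_conn_avoid (F : {fset edge d}) g x y u p : val g = [fset x; y]%fset ->
  path (linked F) u p -> y \notin u :: p -> conn (fun e => e \in (F `\ g)%fset) u (last u p).
Proof.
move=> gg; elim: p u => [|v p IH] u /=; first by move=> _ _; exact: conn_refl.
move=> /andP[/hasP[e eF /eqP ee] vp]; rewrite inE negb_or => /andP[yu yvp].
apply: conn_trans (IH v vp yvp); apply: (@conn_edge _ _ _ _ e) => //.
rewrite !inE eF andbT; apply/eqP => eg.
have : y \in [fset u; v]%fset by rewrite -ee eg gg !inE eqxx orbT.
by rewrite !inE (negbTE yu); move: yvp; rewrite inE negb_or => /andP[/negbTE->].
Qed.

(** The rest of a cycle of length at least three joins the ends of its first edge, which could then
    be removed, against minimality. *)
Lemma minimal_connector_tree n (F : {fset edge d}) :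
  (F `<=` cube_edges n)%fset -> connector (box d n) F ->
  (forall g, g \in F -> ~ connector (box d n) (F `\ g)%fset) -> spanning_tree n F.
Proof.
move=> FS cF Fmin; split.
- by rewrite box_edgesE => e /=; apply: (fsubsetP FS).
- by move=> x y xn yn; apply: conn_path; exact: cF.
move=> [|x [|y [|z r]]] //= /andP[/=/andP[xy cyc]] /andP[xn /andP[yn _]]; exfalso.
have [g gF /eqP gg] := hasP xy.
have cg : conn (fun e => e \in (F `\ g)%fset) y x.
  move: cyc => /andP[/hasP[e eF /eqP ee] zx].
  apply: (@conn_trans _ _ _ _ z).
    apply: (@conn_edge _ _ _ _ e) => //; rewrite !inE eF andbT; apply/eqP => eg.
    have : x \in [fset y; z]%fset by rewrite -ee eg gg !inE eqxx.
    by move: xn; rewrite !inE !negb_or => /and3P[/negbTE-> /negbTE->].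
  have := path_conn_avoid gg zx; rewrite last_rcons; apply.
  rewrite -rcons_cons mem_rcons inE negb_or yn andbT eq_sym.
  by move: xn; rewrite !inE !negb_or => /and3P[].
apply: (Fmin _ gF) => a c aV cV; apply: conn_reroute (cF a c aV cV) => h s t hF hh.
have [hg|/eqP hg] := pselect (h = g); last first.
  by apply: (@conn_edge _ _ _ _ h) => //; rewrite !inE hg hF.
have [[-> ->]|[-> ->]] : (s = x /\ t = y) \/ (s = y /\ t = x).
    by apply: fset2_eq; rewrite -hh hg.
  exact: conn_sym.
exact: cg.
Qed.

(** Trees are connectors, which gives one inequality. Conversely an optimal connector contains a
    minimal one, which is a tree and, the weights being nonnegative, no heavier. This tree also
    shows that a minimal spanning tree exists, so [mst] is a genuine one. *)
Lemma mst_connector (R : realType) n (w : edge d -> R) :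
  {in cube_edges n, forall e, 0 <= w e} ->
  weight w (mst n w) = connector_weight (fun e : edge d => val e) (box d n) (cube_edges n) w.
Proof.
move=> w0.
have tree_le F : spanning_tree n F ->
    connector_weight (fun e : edge d => val e) (box d n) (cube_edges n) w <= weight w F.
  move=> [FS cF _]; apply: connector_weight_le.
    by apply/fsubsetP => e eF; have := FS e eF; rewrite box_edgesE.
  by move=> x y xn yn; have [p /path_conn + <-] := cF x y xn yn.
have [F [FS cF FE]] := connector_weight_attained w (@cube_connector n).
have [F1 [F1F cF1 F1min]] := fset_minimal (P := connector (box d n)) cF.
have F1S := fsubset_trans F1F FS.
have tF1 := minimal_connector_tree F1S cF1 F1min.
have wF1 : weight w F1 <= \sum_(e <- F) w e.
  rewrite (big_fsetID _ (mem F1)) /= (_ : [fset x in F | x \in F1]%fset = F1); last first.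
    by apply/fsetP => e; rewrite !inE andbC; case: (boolP (e \in F1)) => // /(fsubsetP F1F).
  rewrite lerDl big_seq; apply: sumr_ge0 => e; rewrite !inE => /andP[eF _].
  by apply: w0; exact: (fsubsetP FS).
have mF1 : is_mst n w F1.
  by split => // F' tF'; apply: le_trans wF1 _; rewrite -FE; exact: tree_le.
have [tM hM] : is_mst n w (mst n w).
  by have := @xgetPex _ fset0 [set F | is_mst n w F]; apply; exists F1.
apply/eqP; rewrite eq_le tree_le // andbT FE.
by apply: le_trans wF1; exact: hM.
Qed.

(** Each point starts an edge in one fixed coordinate direction; that edge may leave [cube n], hence
    [n.+1]. *)
Lemma card_cube_edges n : (0 < d)%N -> (#|` cube n| <= #|` cube_edges n.+1|)%N.
Proof.
move=> d0; pose f x := mk_edge x (Ordinal d0).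
have finj : injective f by move=> x y /mk_edge_inj [].
have -> : #|` cube n| = #|` (f @` cube n)%fset| by rewrite [RHS]card_imfset.
apply: fsubset_leq_card; apply/fsubsetP => e /imfsetP[x /= xn ->].
rewrite cube_edgesP tl_mk hd_mk (cubeS (leqnSn n) xn) /= -addn1.
exact: cubeD (unit_vector_cube _).
Qed.

Lemma size_base_le (s : seq (edge d)) (A : {fset lattice d}) : uniq s ->
  {in s, forall e, tl e \in A} -> (size s <= #|` A| * d)%N.
Proof.
move=> us sA; rewrite -(size_map base).
have -> : (#|` A| * d)%N = size [seq (x, i) | x <- A, i <- enum 'I_d].
  by rewrite size_allpairs size_enum_ord.
apply: uniq_leq_size; first by rewrite map_inj_uniq //; exact: base_inj.
move=> p /mapP[e es ->]; apply/allpairsP; exists (base e).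
by rewrite mem_enum; split => //; [exact: sA|exact: surjective_pairing].
Qed.

(** Boxes of radius [k] about the tails of two edges can share an edge only if the tails differ by
    at most [k + k] in each coordinate. *)
Definition near_edges k : rel (edge d) := fun e f => tl f - tl e \in cube (k + k).

Lemma count_near_edges k e (s : seq (edge d)) : uniq s ->
  (count (near_edges k e) s <= #|` cube (k + k)| * d)%N.
Proof.
move=> us; rewrite -size_filter.
have inj : injective (fun x => x + tl e) by exact: addIr.
have -> : #|` cube (k + k)| = #|` ((fun x => x + tl e)%R @` cube (k + k))%fset| by rewrite [RHS]card_imfset.
apply: size_base_le; first exact: filter_uniq.
move=> f; rewrite mem_filter => /andP[fe _]; apply/imfsetP.
by exists (tl f - tl e) => //=; rewrite subrK.
Qed.

Lemma near_edgesP k e f g : g \in shifted_edges (tl e) k -> g \in shifted_edges (tl f) k ->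
  near_edges k e f.
Proof.
rewrite !shiftedP => /andP[he _] /andP[hf _]; rewrite /near_edges.
have -> : tl f - tl e = (tl g - tl e) + - (tl g - tl f).
  by rewrite opprB [RHS]addrC addrA subrK.
by apply: cubeD => //; exact: cubeN.
Qed.

Lemma count_boundary n k : (k <= n)%N ->
  (count (fun e => tl e \notin cube (n - k)) (cube_edges n) <=
   (#|` cube n| - #|` cube (n - k)|) * d)%N.
Proof.
move=> kn; rewrite -size_filter.
have sub : (cube (n - k) `<=` cube n)%fset by apply/fsubsetP; apply: cubeS; exact: leq_subr.
rewrite -[X in (_ <= X * _)%N](cardfsDS sub).
apply: size_base_le; first by rewrite filter_uniq // fset_uniq.
by move=> e; rewrite mem_filter cube_edgesP => /andP[h1 /andP[h2 _]]; rewrite in_fsetD h1 h2.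
Qed.

Lemma shifted_sub n k e : (k <= n)%N -> tl e \in cube (n - k) ->
  {subset shifted_edges (tl e) k <= cube_edges n}.
Proof.
move=> kn en f; rewrite shiftedP cube_edgesP => /andP[h1 h2].
rewrite -(subnK kn) -[tl f](subrK (tl e)) -[hd f](subrK (tl e)) ![_ + tl e]addrC.
by apply/andP; split; exact: cubeD.
Qed.

Lemma sub_shifted n e : e \in cube_edges n ->
  {subset cube_edges n <= shifted_edges (tl e) (n + n)}.
Proof.
rewrite cube_edgesP => /andP[en _] f; rewrite shiftedP cube_edgesP => /andP[h1 h2].
by apply/andP; split; apply: cubeD => //; exact: cubeN.
Qed.

(** A box of radius 0 contains no edge; this is why the locality estimates use the radius [k.+1]. *)
Lemma mem_self_shifted k e : e \in shifted_edges (tl e) k.+1.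
Proof.
rewrite shiftedP subrr cube0 /hd addrC addKr.
by apply: cubeS (unit_vector_cube _).
Qed.

Lemma card_star n e :
  (#|` [fset f in cube_edges n `\ e | tl e \in val f]%fset| <= 2 * d)%N.
Proof.
have -> : (2 * d)%N = size ([seq mk_edge (tl e) i | i <- enum 'I_d] ++
    [seq mk_edge (tl e - unit_vector i) i | i <- enum 'I_d]).
  by rewrite size_cat !size_map -enumT size_enum_ord mul2n addnn.
apply: uniq_leq_size => [|f]; first exact: fset_uniq.
rewrite !inE endsE !inE mem_cat => /andP[_ /orP[/eqP ef|/eqP ef]]; apply/orP; [left|right].
  by apply/mapP; exists (base f).2; rewrite ?mem_enum // ef -baseE.
apply/mapP; exists (base f).2; rewrite ?mem_enum //.
by rewrite ef /hd addrK -baseE.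
Qed.

Variable R : realType.

(* The critical weight of [e]: replacing [w e] by [s] changes the weight of the
   minimal spanning tree by [Num.min s alpha - Num.min (w e) alpha]. *)
Definition alpha (b : R) (S : {fset edge d}) e (w : edge d -> R) : R :=
  bottleneck (fun f : edge d => val f) (S `\ e)%fset (tl e) (hd e) b w.

Lemma alpha_mono b (S S' : {fset edge d}) e w : 0 <= b -> {subset S <= S'} ->
  alpha b S' e w <= alpha b S e w.
Proof.
move=> b0 SS'; apply: bottleneck_mono => // g; rewrite !in_fsetD1 => /andP[-> /=]; exact: SS'.
Qed.

Lemma alpha_dep b (S : {fset edge d}) e w w' : 0 <= b ->
  (forall g, g \in S -> g != e -> w g = w' g) -> alpha b S e w = alpha b S e w'.
Proof.
by move=> b0 h; apply: bottleneck_dep => // g; rewrite !in_fsetD1 => /andP[ge gS]; exact: h.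
Qed.

(** Translations are graph isomorphisms, so [bottleneck_map] for [translate z] and for its inverse
    gives the two inequalities. *)
Lemma alpha_translate b k e w : 0 <= b ->
  alpha b (shifted_edges (tl e) k) e w =
  alpha b (cube_edges k) (mk_edge 0 (base e).2) (w \o translate (tl e)).
Proof.
move=> b0; set z := tl e; set e0 := mk_edge 0 _.
have te0 : translate z e0 = e by rewrite translate_mk add0r -baseE.
have te : translate (- z) e = e0 by rewrite -te0 translateK.
have tE z' f u v : val f = [fset u; v]%fset ->
  val (translate z' f) = [fset (u + z')%R; (v + z')%R]%fset := @translateE z' f u v.
apply/eqP; rewrite eq_le; apply/andP; split.
  have := @bottleneck_map _ _ (fun f : edge d => val f) R (cube_edges k `\ e0)%fset
    (shifted_edges z k `\ e)%fset (translate z) (fun x => x + z) (tl e0) (hd e0) b w b0 _ (@tE z).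
  rewrite /alpha (_ : tl e0 + z = tl e); last by rewrite tl_mk add0r.
  rewrite (_ : hd e0 + z = hd e); last by rewrite hd_mk add0r addrC.
  apply=> f; rewrite !in_fsetD1 mem_shifted translateK => /andP[fe ->]; rewrite andbT.
  by apply: contraNneq fe => fe; apply/eqP; rewrite -te -fe translateK.
have := @bottleneck_map _ _ (fun f : edge d => val f) R (shifted_edges z k `\ e)%fset
    (cube_edges k `\ e0)%fset (translate (- z)) (fun x => x + (- z)) (tl e) (hd e) b
    (w \o translate z) b0 _ (@tE (- z)).
rewrite /alpha (_ : tl e - z = tl e0); last by rewrite tl_mk subrr.
rewrite (_ : hd e - z = hd e0); last by rewrite hd_mk /hd addrC addKr add0r.
rewrite (_ : (w \o translate z) \o translate (- z) = w); last first.
  by apply/funext => f /=; rewrite translateNK.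
apply=> f; rewrite !in_fsetD1 mem_shifted => /andP[fe ->]; rewrite andbT.
by apply: contraNneq fe => fe; apply/eqP; rewrite -te0 -fe translateNK.
Qed.

End Lattice.

(** * Locality and variance of the tree weight *)

Section TreeAverage.
Variables (d : nat) (R : realType) (V : finType) (p x : V -> R) (b : R).
Hypotheses (p_ge0 : forall v, 0 <= p v) (p_sum1 : \sum_v p v = 1).
Hypotheses (x_bound : forall v, 0 <= x v <= b) (b_ge0 : 0 <= b).
Implicit Types (e g : edge d) (a : edge d -> V) (i : 'I_d).

Let E n := enum_fset (cube_edges d n).

Definition tree n a : R :=
  connector_weight (fun e : edge d => val e) (box d n) (cube_edges d n) (x \o a).

Definition crit (S : {fset edge d}) e a : R := alpha b S e (x \o a).

(** When [S] is the whole box, this has the same increments in the coordinate [e] as the tree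
    weight, by [tree_diff]; for a smaller [S] it is the local substitute. *)
Definition cut S e a : R := Num.min (x (a e)) (crit S e a).

Lemma crit_ge0 S e a : 0 <= crit S e a.
Proof. exact: bottleneck_ge0. Qed.

Lemma crit_le S e a : crit S e a <= b.
Proof. exact: bottleneck_le_cap. Qed.

Lemma crit_mono S S' e a : {subset S <= S'} -> crit S' e a <= crit S e a.
Proof. exact: alpha_mono. Qed.

Lemma crit_self S e : indep e (crit S e).
Proof.
move=> a v; apply: alpha_dep => // g _ ge; rewrite /= /upd.
by rewrite (negbTE ge).
Qed.

Lemma crit_out S e g : g \notin S -> indep g (crit S e).
Proof.
move=> gS a v; apply: alpha_dep => // h hS _; rewrite /= /upd.
by case: eqP => // hg; rewrite hg (negbTE gS) in hS.
Qed.

Lemma tree_dep n : dep (mem (E n)) (tree n).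
Proof.
move=> a a' aa'; apply: connector_weight_dep; first exact: cube_connector.
by move=> e eE; rewrite /= aa'.
Qed.

Lemma tree_diff n e a v : e \in cube_edges d n ->
  tree n a - tree n (upd a e v) =
  Num.min (x (a e)) (crit (cube_edges d n) e a) - Num.min (x v) (crit (cube_edges d n) e a).
Proof.
move=> en; have := en; rewrite cube_edgesP !mem_cube => /andP[tn hn].
rewrite /tree (@connector_weight_diff _ _ _ _ _ (cube_edges d n) e (tl e) (hd e) b) //.
- by rewrite /= /upd eqxx.
- exact: cube_connector.
- exact: tl_hd.
- exact: endsE.
- move=> g; rewrite cube_edgesP !mem_cube => /andP[gt gh].
  by exists (tl g), (hd g); split => //; exact: endsE.
- by move=> g _; exact: x_bound.
- by move=> g _; exact: x_bound.
- by move=> g; rewrite in_fsetD1 => /andP[/negbTE ge _]; rewrite /= /upd ge.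
Qed.

Lemma min_bound (u c : R) v : 0 <= c -> 0 <= Num.min (x v) c <= b.
Proof.
move=> c0; have /andP[v0 vb] := x_bound v.
by rewrite le_min v0 c0 /= ge_min vb.
Qed.

Lemma dist_min_bound (c : R) u v : 0 <= c -> `|Num.min (x u) c - Num.min (x v) c| <= b.
Proof.
move=> c0; have /andP[u0 ub] := min_bound 0 u c0; have /andP[v0 vb] := min_bound 0 v c0.
by rewrite ler_norml; lra.
Qed.

Lemma tree_osc n e a v : e \in E n -> `|tree n a - tree n (upd a e v)| <= b.
Proof. by move=> en; rewrite tree_diff //; apply: dist_min_bound; exact: crit_ge0. Qed.

(** Near the boundary the box of radius [k] about [tl e] may stick out of [cube d n], and the two
    critical weights need not be comparable; the local term is then set to 0. *)
Definition local_delta k n e a : R :=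
  if tl e \in cube d (n - k) then delta p e (cut (shifted_edges (tl e) k) e) a else 0.

Lemma cut_upd S e a v : cut S e (upd a e v) = Num.min (x v) (crit S e a).
Proof. by rewrite /cut crit_self /upd eqxx. Qed.

Lemma local_delta_bound k n e a : `|local_delta k n e a| <= b.
Proof.
rewrite /local_delta; case: ifP => _; last by rewrite normr0.
apply: norm_delta => // v; rewrite cut_upd; apply: dist_min_bound; exact: crit_ge0.
Qed.

Lemma local_delta_out k n e g : g \notin shifted_edges (tl e) k.+1 ->
  indep g (local_delta k.+1 n e).
Proof.
move=> gS; rewrite /local_delta => a v; case: ifP => // _.
have ge : e != g.
  by apply: contraNneq gS => <-; exact: mem_self_shifted.
have ic : indep g (cut (shifted_edges (tl e) k.+1) e).
  move=> {}a {}v; rewrite /cut crit_out //; congr Num.min.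
  by rewrite /upd (negbTE ge).
rewrite /delta ic; congr (_ - _).
by have := indep_avg_other p e ic; apply.
Qed.

(* The mean critical weight of an edge in direction [i]; by translation invariance it
   does not depend on the position of the edge. *)
Definition mean_crit k i a : R := avgs p (E k) (crit (cube_edges d k) (mk_edge 0 i)) a.

Lemma avgs_crit_shifted k e a :
  avgs p (enum_fset (shifted_edges (tl e) k)) (crit (shifted_edges (tl e) k) e) a =
  mean_crit k (base e).2 a.
Proof.
set z := tl e.
have -> : crit (shifted_edges z k) e =
    fun a => crit (cube_edges d k) (mk_edge 0 (base e).2) (a \o translate z).
  by apply/funext => c; rewrite /crit alpha_translate.
have mem_map f : (f \in map (translate z) (E k)) = (f \in shifted_edges z k).
  rewrite mem_shifted; apply/mapP/idP => [[g gk ->]|h]; first by rewrite translateK.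
  by exists (translate (- z) f) => //; rewrite translateNK.
rewrite (@avgs_sub _ _ _ _ p_sum1 (map (translate z) (E k))).
- rewrite avgs_relabel; last exact: can_inj (translateK z).
  apply: avgs_dep_const => c c' cc'; apply: alpha_dep => // g gk _ /=.
  by rewrite cc'.
- by move=> f; rewrite mem_map.
- by move=> f fs; rewrite mem_map fs.
Qed.

Lemma min_diff (u c c' : R) : c <= c' -> 0 <= Num.min u c' - Num.min u c <= c' - c.
Proof. by move=> cc'; case: (leP u c'); case: (leP u c); lra. Qed.

(* The critical weight of [e] in the box of radius [n] lies between those in the boxes of radii [k]
   and [n + n] centred at the tail of [e]. *)
Lemma local_delta_error k n e a : (k <= n)%N -> e \in E n -> tl e \in cube d (n - k) ->
  avgs p (E n) (fun a => `|delta p e (tree n) a - local_delta k n e a|) a <=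
  2 * (mean_crit k (base e).2 a - mean_crit (n + n) (base e).2 a).
Proof.
move=> kn en ek.
have kE := shifted_sub kn ek; have En := sub_shifted en.
pose ck := crit (shifted_edges (tl e) k) e.
pose cn := crit (cube_edges d n) e.
pose cN := crit (shifted_edges (tl e) (n + n)) e.
have h c : `|delta p e (tree n) c - local_delta k n e c| <= 2 * (ck c - cn c).
  rewrite /local_delta ek; apply: norm_deltaE => // v.
  rewrite tree_diff // cut_upd /cut -/(ck c) -/(cn c).
  have cc : cn c <= ck c by exact: crit_mono.
  have := min_diff (x (c e)) cc; have := min_diff (x v) cc.
  by rewrite ler_norml; lra.
apply: le_trans (avgs_le p_ge0 (E n) h a) _.
rewrite avgsZ avgsB; apply: ler_wpM2l => //.
rewrite -!avgs_crit_shifted -/ck -/cN; apply: lerB.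
  rewrite (@avgs_sub _ _ _ _ p_sum1 (enum_fset (shifted_edges (tl e) k)) (E n)) //.
  by move=> g _; exact: crit_out.
rewrite -(@avgs_sub _ _ _ _ p_sum1 (E n) (enum_fset (shifted_edges (tl e) (n + n)))) //.
  by apply: avgs_le => // c; exact: crit_mono.
by move=> g _; exact: crit_out.
Qed.

Lemma mean_crit_mono k i a : mean_crit k.+1 i a <= mean_crit k i a.
Proof.
have sub : {subset cube_edges d k <= cube_edges d k.+1}.
  by move=> g; rewrite !cube_edgesP => /andP[h1 h2]; rewrite !(cubeS (leqnSn k)).
rewrite /mean_crit -(@avgs_sub _ _ _ _ p_sum1 (E k) (E k.+1)) //.
  by apply: avgs_le => // c; exact: crit_mono.
by move=> g _; exact: crit_out.
Qed.

Lemma mean_crit_ge0 k i a : 0 <= mean_crit k i a.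
Proof. by apply: avgs_ge0 => // c; exact: crit_ge0. Qed.

Lemma mean_crit_homo k m i a : (k <= m)%N -> mean_crit m i a <= mean_crit k i a.
Proof.
move=> /subnK <-; elim: (m - k)%N => // l IH; rewrite addSn.
exact: le_trans (mean_crit_mono _ _ _) IH.
Qed.

(** Interior edges are handled by [local_delta_error], the sum over directions bounding the gap in
    each single one. An edge near the boundary costs at most [b], and such edges are counted. *)
Lemma total_local_error k n a : (k <= n)%N ->
  \sum_(e <- E n) avgs p (E n) (fun a => `|delta p e (tree n) a - local_delta k n e a|) a <=
  (size (E n))%:R * (2 * \sum_i (mean_crit k i a - mean_crit (n + n) i a)) +
  ((#|` cube d n| - #|` cube d (n - k)|) * d)%:R * b.
Proof.
move=> kn.
set H := \sum_i _.
have Hi i : mean_crit k i a - mean_crit (n + n) i a <= H.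
  rewrite /H (bigD1 i) //= lerDl; apply: sumr_ge0 => j _.
  by rewrite subr_ge0 mean_crit_homo // (leq_trans kn) // leq_addr.
have H0 : 0 <= H.
  apply: sumr_ge0 => j _.
  by rewrite subr_ge0 mean_crit_homo // (leq_trans kn) // leq_addr.
apply: le_trans (_ : \sum_(e <- E n) (2 * H + (tl e \notin cube d (n - k))%:R * b) <= _).
  rewrite [leLHS]big_seq [leRHS]big_seq; apply: ler_sum => e en.
  case: (boolP (tl e \in cube d (n - k))) => [h|h].
    rewrite mul0r addr0; apply: le_trans (local_delta_error a kn en h) _.
    by apply: ler_wpM2l.
  rewrite mul1r; apply: le_trans (ler_norm _) _.
  apply: le_trans (_ : b <= _); last by rewrite lerDr mulr_ge0.
  apply: avgs_bound => // c; rewrite normr_id /local_delta (negbTE h) subr0.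
  by apply: norm_delta => // v; exact: tree_osc.
rewrite big_split /=; apply: lerD.
  by rewrite big_const_seq count_predT iter_addr_0 [leRHS]mulr_natl.
rewrite -mulr_suml ler_wpM2r // -natr_sum ler_nat.
have := @count_boundary d n k kn; rewrite -sum1_count big_mkcond.
apply: leq_trans; apply: leq_sum => e _.
by case: (_ \notin _).
Qed.

(** An edge lying in the boxes about two given edges makes these near each other. For edges that are
    not near, each coordinate is therefore missing from one of the boxes, as [locality_bound]
    requires. *)
Lemma tree_stein_bound k n (G G' : R -> R) (s0 eta L : R) a :
  (k < n)%N -> 0 < s0 -> 0 <= eta ->
  (forall w w', `|w - w'| <= b / s0 ->
     `|G w - G w' - G' w * (w - w')| <= eta * `|w - w'|) ->
  (forall w, `|G' w| <= L) ->
  let W a := (tree n a - avgs p (E n) (tree n) a) / s0 in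
  `|avgs p (E n) (fun a => G' (W a) - W a * G (W a)) a| <=
  L * (`|1 - avgs_variance p (E n) (tree n) a / s0 ^+ 2| +
       (4 * b * ((size (E n))%:R * (2 * \sum_i (mean_crit k.+1 i a - mean_crit (n + n) i a)) +
          ((#|` cube d n| - #|` cube d (n - k.+1)|) * d)%:R * b) +
        Num.sqrt ((size (E n) * (#|` cube d (k.+1 + k.+1)| * d))%:R * (2 * b ^+ 2) ^+ 2))
       / s0 ^+ 2)
  + (size (E n))%:R * b ^+ 2 * eta / s0 ^+ 2.
Proof.
move=> kn s00 eta0 hG hL /=.
have L0 : 0 <= L by apply: le_trans (hL 0); exact: normr_ge0.
have uE : uniq (E n) by exact: fset_uniq.
have osc e c v : e \in E n -> `|tree n c - tree n (upd c e v)| <= b by exact: tree_osc.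
apply: le_trans (stein_bound p_ge0 p_sum1 a uE b_ge0 s00 eta0 osc hG hL) _.
rewrite lerD2r ler_wpM2l // lerD2l ler_wpM2r //; first by rewrite invr_ge0 sqr_ge0.
apply: (locality_bound p_ge0 p_sum1 (near := near_edges k.+1) (ut := local_delta k.+1 n) uE b_ge0 osc).
- by move=> e c _; exact: local_delta_bound.
- by move=> e _; exact: count_near_edges.
- move=> e f _ _ nef g _.
  have [h|h] := boolP (g \in shifted_edges (tl e) k.+1); [right|left]; apply: local_delta_out => //.
  by apply: contra nef; exact: near_edgesP.
- exact: total_local_error.
Qed.

(** If the other edges at [tl e] all weigh at least [x2], raising the weight of [e] from below [x1]
    to above [x2] raises the tree weight by at least [x2 - x1]. There are at most [2 * d] such
    edges, so this happens with probability at least [pi ^+ (2 * d)]. *)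
Lemma tree_variance_lower n (x1 x2 pi : R) a : x1 < x2 -> x2 <= b -> 0 <= pi <= 1 ->
  pi <= \sum_(v | x v <= x1) p v -> pi <= \sum_(v | x2 <= x v) p v ->
  (size (E n))%:R * (pi * (((x2 - x1) * pi ^+ (2 * d)) ^+ 2 / 4)) <= avgs_variance p (E n) (tree n) a.
Proof.
move=> x12 x2b /andP[pi0 pi1] hA hB; apply: variance_lower_bound => // [|e en]; first exact: fset_uniq.
apply: (influence_lower_bound p_ge0 p_sum1 (A := fun v => x v <= x1) (B := fun v => x2 <= x v)) => //.
- exact: fset_uniq.
- by rewrite mulr_ge0 ?exprn_ge0 // subr_ge0 ltW.
move=> c u v xu xv.
(* Where all edges of [star] weigh at least [x2], so does the critical weight of [e]. *)
pose star := [fset f in cube_edges d n `\ e | tl e \in val f]%fset.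
have mem_star g : (g \in star) = [&& g != e, g \in cube_edges d n & tl e \in val g].
  by rewrite !inE -!andbA.
pose ind (c : edge d -> V) : R := \prod_(g <- enum_fset star) ((x2 <= x (c g))%R)%:R.
apply: le_trans (_ : (x2 - x1) * avgs p (rem e (E n)) ind c <= _).
  apply: ler_wpM2l; first by rewrite subr_ge0 ltW.
  rewrite /ind (@avgs_prod_iid _ _ _ p p_sum1 _ _ (fun v => ((x2 <= x v)%R)%:R)); first last.
  - move=> g; rewrite mem_star => /and3P[ge gn _].
    by rewrite mem_rem_uniq ?fset_uniq // inE ge.
  - exact: fset_uniq.
  apply: le_trans (_ : pi ^+ size (enum_fset star) <= _).
    by apply: ler_wiXn2l => //; exact: card_star.
  apply: lerXn2r; rewrite ?nnegrE //.
    by apply: sumr_ge0 => w _; rewrite mulr_ge0.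
  apply: le_trans hB _; rewrite big_mkcond; apply: ler_sum => w _.
  by case: ifP; rewrite ?mulr1 ?mulr0.
rewrite -[leLHS](congr1 (fun f => f c) (avgsZ p _ _ _)).
apply: avgs_le => // {}c.
have E1 w : tree n c - tree n (upd c e w) =
  Num.min (x (c e)) (crit (cube_edges d n) e c) - Num.min (x w) (crit (cube_edges d n) e c).
  exact: tree_diff.
set al := crit _ _ _ in E1.
have -> : tree n (upd c e v) - tree n (upd c e u) = Num.min (x v) al - Num.min (x u) al.
  have := E1 u; have := E1 v; lra.
have uv : x u <= x v by apply: le_trans xu _; apply: le_trans xv; exact: ltW.
have mono : 0 <= Num.min (x v) al - Num.min (x u) al.
  by case: (leP (x v) al); case: (leP (x u) al); lra.
have [h|] := boolP (all (fun g => x2 <= x (c g)) (enum_fset star)); last first.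
  rewrite -has_predC => /hasP[g gs /= /negbTE gx].
  by rewrite /ind (big_rem g) //= gx mul0r mulr0.
have -> : ind c = 1.
  by rewrite /ind big_seq big1 // => g /(allP h) ->.
have al2 : x2 <= al.
  apply: bottleneck_star => //; first exact: tl_hd.
  by move=> g gn ge; apply: (allP h); rewrite mem_star; move: gn; rewrite in_fsetD1 => /andP[-> ->].
by rewrite mulr1; case: (leP (x v) al); case: (leP (x u) al); lra.
Qed.

End TreeAverage.

(** * Stein's equation *)

Section SteinEquation.
Variable R : realType.
Implicit Types (f g h : R -> R) (x y : R).
Notation leb := (@lebesgue_measure R).
Notation phi := (normal_pdf (0 : R) 1).

Lemma heine_cantor f (K eps : R) : continuous f -> 0 < eps ->
  exists2 delta, 0 < delta &
    forall x y, `|x| <= K -> `|x - y| <= delta -> `|f x - f y| <= eps.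
Proof.
move=> cf e0.
have /compact_near_coveringP/near_covering_withinP cK : compact `[- K, K] by exact: segment_compact.
pose P (delta x : R) := forall y, `|x - y| <= delta -> `|f x - f y| <= eps.
have : \forall delta \near (0 : R)^'+, `[- K, K] `<=` P delta.
  apply: cK => x xK.
  have e20 : 0 < eps / 2 by rewrite divr_gt0.
  have /cvgrPdist_lt/(_ _ e20) [r /= r0 hr] := cf x.
  exists (ball x (r / 2), [set delta | delta <= r / 2]) => /=.
    split; first by apply: nbhsx_ballx; rewrite divr_gt0.
    by apply: nbhs_right_le; rewrite divr_gt0.
  move=> [x' delta] /= [xx' dr] x'K y xy.
  have h1 : `|f x - f x'| < eps / 2.
    by apply: hr; rewrite /ball /= in xx' *; apply: lt_le_trans xx' _; lra.
  have h2 : `|f x - f y| < eps / 2.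
    apply: hr; rewrite /ball /= in xx' *.
    rewrite -(subrKA x'); apply: le_lt_trans (ler_normD _ _) _; lra.
  rewrite -(subrKA (f x)); apply: le_trans (ler_normD _ _) _.
  by rewrite [X in X + _]distrC; lra.
move=> near_d.
have [delta [d0 hd]] : exists delta, 0 < delta /\ `[- K, K] `<=` P delta.
  near (0 : R)^'+ => delta; exists delta; split; near: delta => //.
  exact: nbhs_right_gt.
exists delta => // x y xK xy; apply: (hd x) => //.
by rewrite /= in_itv /=; move: xK; rewrite ler_norml.
Unshelve. all: by end_near. Qed.

(** Beyond [K] the function is at most [eps / 2], which settles the case of two far points; if one
    point is within [K], [heine_cantor] applies, as it leaves the other point free. *)
Lemma vanishing_uniformly_continuous f (A eps : R) : continuous f -> 0 < eps ->
  (forall x, 1 <= `|x| -> `|f x| * `|x| <= A) ->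
  exists2 delta, 0 < delta & forall x y, `|x - y| <= delta -> `|f x - f y| <= eps.
Proof.
move=> cf e0 fA.
pose K := Num.max 1 (2 * A / eps).
have [delta d0 hd] := heine_cantor K cf e0.
have small x : K < `|x| -> `|f x| <= eps / 2.
  rewrite /K gt_max => /andP[x1 xA].
  have x0 : 0 < `|x| by apply: lt_trans x1.
  rewrite -(ler_pM2r x0); apply: le_trans (fA x (ltW x1)) _.
  move: xA; rewrite ltr_pdivrMr //; lra.
exists delta => // x y xy.
have [xK|xK] := leP `|x| K; first exact: hd.
have [yK|yK] := leP `|y| K; first by rewrite distrC; apply: hd => //; rewrite distrC.
apply: le_trans (ler_normB _ _) _.
by have := small x xK; have := small y yK; lra.
Qed.

Lemma measurable_continuous h : continuous h -> measurable_fun [set: R] h.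
Proof. exact: continuous_measurable_fun. Qed.

Lemma integrable_bounded_phi h (B m : R) (D : set R) : measurable D ->
  continuous h -> (forall x, `|h x| <= B) ->
  leb.-integrable D (fun x => (h x * normal_pdf m 1 x)%:E).
Proof.
move=> mD ch hB; apply: (integrableS measurableT) => //.
apply: (@le_integrable _ _ _ leb _ measurableT _ (fun x => (B * normal_pdf m 1 x)%:E)) => //.
- apply/measurable_EFinP; apply: measurable_funM; first exact: measurable_continuous.
  exact: measurable_normal_pdf.
- move=> x _ /=; rewrite lee_fin !normrM; apply: ler_wpM2r => //.
  by apply: le_trans (hB x) _; exact: ler_norm.
- under eq_fun do rewrite EFinM; apply: integrableZl => //; exact: integrable_normal_pdf.
Qed.

(** The normal law is given by its values on sets; its integrals become Lebesgue integrals once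
    [phi] is identified almost everywhere with the Radon-Nikodym derivative. *)
Lemma integral_normal_prob h (B : R) : continuous h -> (forall x, `|h x| <= B) ->
  (\int[normal_prob 0 1]_x (h x)%:E = \int[leb]_x (h x * phi x)%:E)%E.
Proof.
move=> ch hB.
pose nu : {finite_measure set (measurableTypeR R) -> \bar R} := normal_prob (0 : R) 1.
have dom : nu `<< leb by exact: normal_prob_dominates.
have mh := measurable_continuous ch.
have ih : nu.-integrable setT (EFin \o h).
  apply: measurable_bounded_integrable => //.
    by rewrite /nu /= (@probability_setT _ _ _ (normal_prob 0 1)) ltry.
  exists B; split; first exact: num_real.
  by move=> x Bx y _; apply: le_trans (hB y) _; exact: ltW.
rewrite -[LHS](Radon_Nikodym_change_of_variables dom measurableT ih).
have ae_phi : ae_eq leb setT (Radon_Nikodym (charge_of_finite_measure nu) leb) (EFin \o phi).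
  apply: integral_ae_eq => //.
  - exact: Radon_Nikodym_integrable.
  - by apply/measurable_EFinP; exact: measurable_normal_pdf.
  - by move=> A _ mA; rewrite -Radon_Nikodym_integral.
apply: ae_eq_integral => //.
- apply: emeasurable_funM; first exact/measurable_EFinP.
  by apply: measurable_int; exact: Radon_Nikodym_integrable.
- apply/measurable_EFinP; apply: measurable_funM => //; exact: measurable_normal_pdf.
- by apply: filterS ae_phi => x /(_ Logic.I) /= -> _; rewrite EFinM.
Qed.

(** Write [t = w + (t - w)]: the cross term in [t ^+ 2] is nonnegative, so the Gaussian factor at
    [t] is at most the product of those at [w] and at [t - w]. Integrating in [t] bounds a tail by a
    constant times [phi w]. *)
Lemma tail_bound (w t : R) : 0 <= w * (t - w) ->
  phi t <= phi w * (normal_pdf w 1 t / normal_peak 1).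
Proof.
move=> wt.
have n10 : (1 : R) != 0 by exact: oner_neq0.
have pk : normal_peak (1 : R) != 0 by rewrite gt_eqF // normal_peak_gt0.
rewrite !normal_pdfE // -mulrA ler_wpM2l ?normal_peak_ge0 //.
rewrite [normal_peak 1 * _]mulrC mulfK // /normal_fun -expRD ler_expR -mulrDl.
rewrite ler_wpM2r ?invr_ge0 ?expr1n //; nra.
Qed.

Lemma is_derive_expR_half_sqr x :
  is_derive x 1 (fun y : R => expR (y ^+ 2 / 2)) (x * expR (x ^+ 2 / 2)).
Proof.
have h : is_derive x 1 (fun y : R => y ^+ 2 / 2) x.
  rewrite (_ : (fun y => _) = (fun y : R => 2^-1 *: (y ^+ 2))); last first.
    by apply/funext => y; rewrite mulrC.
  apply: is_derive_eq; change (2^-1 * (x * 1 + x * 1) = x); lra.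
rewrite mulrC.
exact: (@is_derive1_comp _ expR (fun y : R => y ^+ 2 / 2) x _ _ (is_derive_expR _) h).
Qed.

Lemma normal_pdf_expR x : phi x * expR (x ^+ 2 / 2) = normal_peak 1.
Proof.
rewrite normal_pdfE ?oner_neq0 // /normal_fun -mulrA -expRD subr0 expr1n.
by rewrite mulNr addNr expR0 mulr1.
Qed.

(* For [w <= 0] bound the integral over the left tail, for [w >= 0] the one over the right
   tail: the two tails carry opposite integrals. *)
Lemma stein_solution h (B : R) : continuous h -> (forall x, `|h x| <= B) ->
  let c := (\int[leb]_x (h x * phi x))%R in
  exists g, exists C, (forall x, `|g x| <= C) /\
    forall x, is_derive x 1 g (h x - c + x * g x).
Proof.
move=> ch hB /=; set c := (\int[leb]_x _)%R.
have B0 : 0 <= B by apply: le_trans (hB 0).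
have n10 : (1 : R) != 0 by exact: oner_neq0.
have pk0 : 0 < normal_peak (1 : R) by rewrite normal_peak_gt0.
pose u x := h x - c.
have cu : continuous u by move=> x; apply: cvgB; [exact: ch|exact: cvg_cst].
have uB x : `|u x| <= B + `|c| by apply: le_trans (ler_normB _ _) _; rewrite lerD2r.
have iu (D : set R) : measurable D -> leb.-integrable D (EFin \o (fun x => u x * phi x)).
  by move=> mD; exact: integrable_bounded_phi mD cu uB.
pose F x := (\int[leb]_(t in [set` `]-oo, x]]) (u t * phi t))%R.
have iphi : leb.-integrable setT (EFin \o phi) by exact: integrable_normal_pdf.
have iu0 : (\int[leb]_x (u x * phi x))%R = 0.
  have -> : (\int[leb]_x (u x * phi x))%R = (\int[leb]_x (h x * phi x - c * phi x))%R.
    by apply: eq_Rintegral => t _; rewrite /u mulrBl.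
  rewrite RintegralB //; last 2 first.
  - exact: integrable_bounded_phi ch hB.
  - by apply: (integrable_bounded_phi 0 measurableT (h := fun=> c)) => //; exact: cst_continuous.
  rewrite RintegralZl // /Rintegral integral_normal_pdf /= mulr1.
  by rewrite -/(Rintegral _ _ _) subrr.
have Fr x : F x = - (\int[leb]_(t in [set` `]x, +oo[]) (u t * phi t))%R.
  apply/eqP; rewrite -subr_eq0 opprK -Rintegral_setU //.
  - by rewrite -setCitvl setUv iu0.
  - by apply: iu; rewrite -setCitvl setUv.
  - by rewrite -setCitvl disj_set2E setICr.
have tail x (D : set R) : measurable D -> (forall t, D t -> 0 <= x * (t - x)) ->
    `|(\int[leb]_(t in D) (u t * phi t))%R| <= (B + `|c|) / normal_peak 1 * phi x.
  move=> mD Dx; apply: le_trans.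
    by apply: le_normr_Rintegral => //; exact: iu.
  pose k := (B + `|c|) / normal_peak 1 * phi x.
  have k0 : 0 <= k.
    by rewrite mulr_ge0 ?normal_pdf_ge0 // divr_ge0 ?addr_ge0 // ltW.
  have ipdf : leb.-integrable D (EFin \o normal_pdf x 1).
    by apply: (integrableS measurableT) => //; exact: integrable_normal_pdf.
  apply: le_trans (_ : (\int[leb]_(t in D) (k * normal_pdf x 1 t))%R <= _).
    apply: le_Rintegral => //.
    - exact: (integrable_norm (iu D mD)).
    - have := @integrableZl _ _ _ leb D mD k _ ipdf.
      by apply: eq_integrable => // t _ /=; rewrite EFinM.
    - move=> t Dt; rewrite normrM (ger0_norm (normal_pdf_ge0 _ _ _)).
      apply: le_trans (ler_wpM2r (normal_pdf_ge0 _ _ _) (uB t)) _.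
      rewrite /k -mulrA -mulrA; apply: ler_wpM2l; first by rewrite addr_ge0.
      rewrite mulrCA [_^-1 * _]mulrC; exact: tail_bound (Dx t Dt).
  rewrite RintegralZl // -[leRHS]mulr1; apply: ler_wpM2l => //.
  have := @probability_le1 _ _ _ (normal_prob x 1) D mD.
  rewrite /normal_prob /= => h1; rewrite -lee_fin fineK //.
  exact: integrable_fin_num.
have Fb x : `|F x| <= (B + `|c|) / normal_peak 1 * phi x.
  have [x0|x0] := leP x 0.
    apply: tail => // t; rewrite /= in_itv /= => tx; nra.
  rewrite Fr normrN; apply: tail => // t; rewrite /= in_itv /= andbT => tx; nra.
(* The solution is [F / phi], written as a product since [phi x * expR (x ^+ 2 / 2)] is constant. *)
exists (fun x => F x * (expR (x ^+ 2 / 2) / normal_peak 1)), ((B + `|c|) / normal_peak 1).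
have E0 x : 0 <= expR (x ^+ 2 / 2) / normal_peak 1 by rewrite divr_ge0 ?expR_ge0 // ltW.
have phiE x : phi x * (expR (x ^+ 2 / 2) / normal_peak 1) = 1.
  by rewrite mulrA normal_pdf_expR divff // gt_eqF.
split=> [x|x].
  rewrite normrM [X in _ * X]ger0_norm //; apply: le_trans (ler_wpM2r (E0 x) (Fb x)) _.
  by rewrite -[leLHS]mulrA phiE mulr1.
have [dF F'] : derivable F x 1 /\ derive1 F x = u x * phi x.
  apply: (@continuous_FTC1 _ (fun x => u x * phi x) -oo%O x (x + 1)) => //.
  - by rewrite ltrDl.
  - by refine (iu _ _); exact: measurable_itv.
  - exact: ltNyr.
  - apply: cvgM; first exact: cu.
    exact: continuous_normal_pdf.
have hF : is_derive x 1 F (u x * phi x) by apply: DeriveDef => //; rewrite -derive1E.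
have hE : is_derive x 1 (fun x => expR (x ^+ 2 / 2) / normal_peak 1)
    (x * expR (x ^+ 2 / 2) / normal_peak 1).
  rewrite (_ : (fun x => _) = (normal_peak 1)^-1 \*: (fun x => expR (x ^+ 2 / 2))); last first.
    by apply/funext => y; rewrite /= mulrC.
  have := is_derive_expR_half_sqr x => hh.
  apply: is_derive_eq; change ((normal_peak 1)^-1 * (x * expR (x ^+ 2 / 2)) = x * expR (x ^+ 2 / 2) / normal_peak 1).
  by rewrite mulrC.
apply: (is_derive_eq (is_deriveM hF hE)).
rewrite /= -/(u x).
change (F x * (x * expR (x ^+ 2 / 2) / normal_peak 1) +
  expR (x ^+ 2 / 2) / normal_peak 1 * (u x * phi x) =
  u x + x * (F x * (expR (x ^+ 2 / 2) / normal_peak 1))).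
have := phiE x; set E := _ / _; move=> h1.
rewrite (_ : E * (u x * phi x) = u x); last by rewrite mulrCA [E * _]mulrC h1 mulr1.
rewrite /E; lra.
Qed.

Lemma is_derive_continuous f x (df : R) : is_derive x 1 f df -> {for x, continuous f}.
Proof. by move=> h; apply: differentiable_continuous; apply/derivable1_diffP. Qed.

Lemma is_derive_linearization (G G' : R -> R) (eta delta : R) : (forall x, is_derive x 1 G (G' x)) ->
  (forall x y, `|x - y| <= delta -> `|G' x - G' y| <= eta) ->
  forall x y, `|x - y| <= delta -> `|G x - G y - G' x * (x - y)| <= eta * `|x - y|.
Proof.
move=> dG uG'.
have mvt x y : x <= y -> exists2 z, z \in `[x, y]%R & G y - G x = G' z * (y - x).
  move=> xy; apply: (@MVT_segment _ G G' x y xy).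
  by apply: continuous_subspaceT => z; exact: is_derive_continuous (dG z).
move=> x y xy.
have [z [zx zE]] : exists z, `|x - z| <= delta /\ G x - G y = G' z * (x - y).
  have [yx|yx] := leP y x.
    have [z] := mvt y x yx; rewrite in_itv /= => /andP[yz zx] E; exists z; split => //.
    by move: xy; rewrite !ger0_norm ?subr_ge0 //; lra.
  have [z] := mvt x y (ltW yx); rewrite in_itv /= => /andP[xz zy] E; exists z; split.
    by move: xy; rewrite !ler0_norm ?subr_le0 ?(ltW yx) //; lra.
  by move: E; lra.
rewrite zE -mulrBl normrM ler_wpM2r // distrC; exact: uG'.
Qed.

(* Multiplying the solution [g] of Stein's equation by the cutoff [1 / (1 + (x / K) ^+ 2)] makes [G']
   and [k] decay, hence uniformly continuous even though [h] is only bounded and continuous; the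
   resulting error is quadratic, and [W] has unit variance. *)
Lemma stein_test h (B eps : R) : continuous h -> (forall x, `|h x| <= B) -> 0 < eps ->
  let c := (\int[leb]_x (h x * phi x))%R in
  exists G : R -> R, exists G' : R -> R, exists L : R,
  [/\ forall x, `|G' x| <= L,
    forall eta, 0 < eta -> exists2 delta, 0 < delta &
      forall x y, `|x - y| <= delta -> `|G x - G y - G' x * (x - y)| <= eta * `|x - y| &
    let k x := G' x - x * G x in
    [/\ continuous k, forall x, `|k x| <= L,
      forall eta, 0 < eta -> exists2 delta, 0 < delta &
        forall x y, `|x - y| <= delta -> `|k x - k y| <= eta &
      forall x, `|h x - c - k x| <= eps * (1 + x ^+ 2)]].
Proof.
move=> ch hB e0 /=; set c := (\int[leb]_x _)%R.
have B0 : 0 <= B by apply: le_trans (hB 0).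
have [g [C [gC dg]]] := stein_solution ch hB; rewrite -/c in dg.
have C0 : 0 <= C by apply: le_trans (gC 0).
pose B' := B + `|c|.
have B'0 : 0 <= B' by rewrite addr_ge0.
have uB x : `|h x - c| <= B' by apply: le_trans (ler_normB _ _) _; rewrite lerD2r.
(* Chosen so that [B' + C <= eps * K]: differentiating the cutoff then costs at most [eps], and
   cutting off [h - c] at most [eps * x ^+ 2]. *)
pose K := 1 + (B' + C) / eps.
have K1 : 1 <= K by rewrite lerDl divr_ge0 ?addr_ge0 // ltW.
have K0 : 0 < K by apply: lt_le_trans K1.
have KE : (B' + C) <= eps * K.
  rewrite /K mulrDr mulr1 [eps * _]mulrC divfK ?gt_eqF //; lra.
pose q := (K ^+ 2)^-1.
have q0 : 0 < q by rewrite invr_gt0 exprn_gt0.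
have qK : q * K ^+ 2 = 1 by rewrite mulVf // gt_eqF // exprn_gt0.
pose D (x : R) := 1 + q * x ^+ 2.
have D1 x : 1 <= D x by rewrite lerDl mulr_ge0 ?sqr_ge0 // ltW.
have D0 x : 0 < D x by apply: lt_le_trans (D1 x).
pose chi x := (D x)^-1.
have chi0 x : 0 <= chi x by rewrite invr_ge0 ltW.
have chiD x : D x * chi x = 1 by rewrite divff // gt_eqF.
have chi1 x : chi x <= 1 by rewrite invf_le1.
have xchi x : `|x| * chi x <= K / 2.
  rewrite ler_pdivrMr //.
  have : 0 <= (K - `|x|) ^+ 2 by exact: sqr_ge0.
  have xx : x ^+ 2 = `|x| ^+ 2 by rewrite real_normK ?num_real.
  move=> h1; rewrite -(ler_pM2r K0); rewrite /D xx; move: h1 qK; set z := `|x|; nra.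
have x2chi x : `|x| ^+ 2 * chi x <= K ^+ 2.
  rewrite ler_pdivrMr // /D mulrDr mulr1 mulrA [K ^+ 2 * q]mulrC qK mul1r.
  by rewrite real_normK ?num_real // lerDr sqr_ge0.
pose dchi x := - (q * (2 * x)) * chi x ^+ 2.
have dchiE x : is_derive x 1 chi (dchi x).
  have dD : is_derive x 1 D (q * (2 * x)).
    rewrite (_ : D = (fun y : R => 1 + q *: (y ^+ 2))) //.
    apply: is_derive_eq; change ((0 + 1) * (q * (x * 1 + x * 1)) = q * (2 * x)); lra.
  apply: (is_derive_eq (is_deriveV (lt0r_neq0 (D0 x)) dD)).
  change (- (D x) ^- 2 * (q * (2 * x)) = dchi x).
  by rewrite /dchi /chi exprVn mulNr mulNr mulrC.
have dchib x : `|dchi x| <= chi x / K.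
  have -> : `|dchi x| = q * (2 * `|x|) * chi x ^+ 2.
    rewrite /dchi normrM normrN normrX !normrM (gtr0_norm q0) (ger0_norm (chi0 x)).
    by rewrite (@ger0_norm _ 2).
  have := xchi x; have := chi0 x; set z := `|x|; set w := chi x => w0 h1.
  rewrite ler_pdivlMr //.
  have : q * K * (2 * (z * w)) <= 1.
    have qK0 : 0 <= q * K by rewrite mulr_ge0 // ltW.
    have : q * K * (z * w) <= q * K * (K / 2) by rewrite ler_wpM2l.
    move: qK; rewrite expr2; lra.
  by move=> h2; have := ler_wpM2r w0 h2; rewrite expr2; lra.
pose G (x : R) := g x * chi x.
pose G' x := (h x - c + x * g x) * chi x + g x * dchi x.
have dG x : is_derive x 1 G (G' x).
  apply: (is_derive_eq (is_deriveM (dg x) (dchiE x))).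
  change (g x * dchi x + chi x * (h x - c + x * g x) = G' x); rewrite /G'; lra.
have cg x : {for x, continuous g} by exact: is_derive_continuous (dg x).
have cchi x : {for x, continuous chi} by exact: is_derive_continuous (dchiE x).
have cdchi : continuous dchi.
  move=> x; apply: cvgM.
    by apply: cvgN; apply: cvgM; [exact: cvg_cst|apply: cvgM; [exact: cvg_cst|exact: cvg_id]].
  rewrite (_ : (fun x => chi x ^+ 2) = (fun x => chi x * chi x)); last by apply/funext => y; rewrite expr2.
  by rewrite expr2; apply: cvgM; exact: cchi.
pose k x := G' x - x * G x.
(* The terms [x * g x * chi x], which carry the factor [x], cancel. *)
have kE x : k x = (h x - c) * chi x + g x * dchi x by rewrite /k /G' /G; lra.
have cu : continuous (fun x => h x - c) by move=> x; apply: cvgB; [exact: ch|exact: cvg_cst].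
have ck : continuous k.
  rewrite (_ : k = fun x => (h x - c) * chi x + g x * dchi x); last by apply/funext.
  move=> x; apply: cvgD; first by apply: cvgM; [exact: cu|exact: cchi].
  by apply: cvgM; [exact: cg|exact: cdchi].
have cG' : continuous G'.
  move=> x; apply: cvgD; apply: cvgM => //; [|exact: cchi|exact: cg|exact: cdchi].
  by apply: cvgD; [exact: cu|apply: cvgM; [exact: cvg_id|exact: cg]].
have gd x : `|g x * dchi x| <= C * (chi x / K) by rewrite normrM ler_pM.
have uc x : `|(h x - c) * chi x| <= B' * chi x.
  by rewrite normrM (ger0_norm (chi0 x)) ler_wpM2r.
have kb x : `|k x| <= (B' + C) * chi x.
  rewrite kE; apply: le_trans (ler_normD _ _) _; rewrite [leRHS]mulrDl; apply: lerD; first exact: uc.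
  apply: le_trans (gd x) _; rewrite ler_wpM2l // ler_piMr // invf_le1 //.
have G'b x : `|G' x| <= (B' + C) * chi x + C * (`|x| * chi x).
  have -> : G' x = k x + x * G x by rewrite /k; lra.
  apply: le_trans (ler_normD _ _) _; apply: lerD; first exact: kb.
  rewrite /G !normrM (ger0_norm (chi0 x)) mulrCA ler_wpM2r ?mulr_ge0 //.
exists G, G', (B' + C + C * (K / 2)); split.
- move=> x; apply: le_trans (G'b x) _; apply: lerD.
    by rewrite ler_piMr // addr_ge0.
  by rewrite ler_wpM2l.
- move=> eta eta0.
  have [delta d0 hd] : exists2 delta, 0 < delta & forall x y, `|x - y| <= delta -> `|G' x - G' y| <= eta.
    apply: (vanishing_uniformly_continuous (A := (B' + C) * (K / 2) + C * K ^+ 2) cG' eta0).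
    move=> x _; apply: le_trans (ler_wpM2r (normr_ge0 x) (G'b x)) _.
    rewrite [leLHS]mulrDl; apply: lerD.
      by rewrite -mulrA ler_wpM2l ?addr_ge0 // mulrC.
    rewrite -mulrA ler_wpM2l // -mulrA [chi x * _]mulrC mulrA -expr2; exact: x2chi.
  by exists delta => //; exact: is_derive_linearization dG hd.
split => //.
- move=> x; apply: le_trans (kb x) _; apply: le_trans (_ : B' + C <= _).
    by rewrite ler_piMr // addr_ge0.
  by rewrite lerDl mulr_ge0 // divr_ge0 // ltW.
- move=> eta eta0.
  apply: (vanishing_uniformly_continuous (A := (B' + C) * (K / 2)) ck eta0).
  move=> x _; apply: le_trans (ler_wpM2r (normr_ge0 x) (kb x)) _.
  by rewrite -mulrA ler_wpM2l ?addr_ge0 // mulrC.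
move=> x.
rewrite -/(k x) kE.
have -> : h x - c - ((h x - c) * chi x + g x * dchi x) = (h x - c) * (1 - chi x) - g x * dchi x by lra.
apply: le_trans (ler_normB _ _) _.
have c1 : 0 <= 1 - chi x by rewrite subr_ge0.
have h1 : `|(h x - c) * (1 - chi x)| <= B' * (q * x ^+ 2).
  rewrite normrM (ger0_norm c1); apply: ler_pM => //.
  have := chiD x; have := chi1 x; have : 0 <= q * x ^+ 2 by rewrite mulr_ge0 ?sqr_ge0 // ltW.
  rewrite /D; nra.
have h2 := gd x.
have h3 : C * (chi x / K) <= eps.
  rewrite mulrA ler_pdivrMr //; apply: le_trans (_ : C <= _); first by rewrite ler_piMr.
  by apply: le_trans KE; rewrite lerDr.
have h4 : B' * (q * x ^+ 2) <= eps * x ^+ 2.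
  rewrite mulrA ler_wpM2r ?sqr_ge0 // /q ler_pdivrMr ?exprn_gt0 //.
  have : eps * K <= eps * K ^+ 2.
    by rewrite ler_pM2l // expr2 -[leLHS]mul1r ler_wpM2r // ltW.
  move: KE; lra.
by lra.
Qed.

End SteinEquation.

(** * Rounding the weights *)

Section Discretization.
Variables (R : realType) (dT : measure_display) (T : measurableType dT).
Variables (P : probability T R) (I : choiceType) (omega : I -> {RV P >-> R}).
Variables (mu : probability (measurableTypeR R) R).
Hypothesis omega_iid : iid P omega mu.
Variables (V : finType) (q : R -> V).
Hypothesis q_measurable : forall v, measurable (q @^-1` [set v]).
Implicit Types (F : (I -> V) -> R) (s : seq I) (J : {fset I}) (B : I -> set R).

Definition mass v : R := fine (mu (q @^-1` [set v])).

Definition disc (t : T) : I -> V := fun i => q (omega i t).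

Lemma massE v : (mass v)%:E = mu (q @^-1` [set v]).
Proof. by rewrite /mass fineK //; apply: fin_num_measure; exact: q_measurable. Qed.

Lemma mass_ge0 v : 0 <= mass v.
Proof. by apply: fine_ge0; exact: measure_ge0. Qed.

Lemma mass_sum (D : pred V) : (\sum_(v | D v) mass v)%:E = mu [set r | D (q r)].
Proof.
rewrite -sumEFin (eq_bigr (fun v => mu (q @^-1` [set v]))); last by move=> v _; exact: massE.
rewrite -big_filter fsbig_seq; last exact/filter_uniq/index_enum_uniq.
rewrite -measure_fin_bigcup //; last 2 first.
- by move=> u v _ _ [r [/= <- <-]].
- by move=> v _; exact: q_measurable.
congr (mu _); apply/seteqP; split => r /=.
  by move=> [v /=]; rewrite mem_filter => /andP[Dv _] ->.
by move=> Dr; exists (q r) => //=; rewrite mem_filter Dr mem_index_enum.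
Qed.

Lemma measurable_pred (D : pred V) : measurable [set r | D (q r)].
Proof.
rewrite (_ : [set r | _] = \big[setU/set0]_(v | D v) (q @^-1` [set v])).
  by apply: bigsetU_measurable => v _; exact: q_measurable.
apply/seteqP; split => r /=.
  by move=> Dr; rewrite (bigD1 (q r)) //=; left.
by apply: (big_ind (fun A : set R => A r -> D (q r))) => [//|A B hA hB [/hA|/hB]//|v Dv /= ->].
Qed.

Lemma mass_sum1 : \sum_v mass v = 1.
Proof.
apply: EFin_inj; rewrite mass_sum (_ : [set r | _] = setT) ?probability_setT //.
by apply/seteqP; split.
Qed.

Definition cylinder J B := \bigcap_(i in [set` J]) omega i @^-1` B i.

Lemma measurable_preimage i (A : set R) : measurable A -> measurable (omega i @^-1` A).
Proof. by move=> mA; rewrite -[X in measurable X]setTI; exact: (measurable_funPT (omega i)). Qed.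

Lemma measurable_cylinder J B : (forall i, measurable (B i)) -> measurable (cylinder J B).
Proof.
move=> mB; apply: fin_bigcap_measurable; first exact: finite_fset.
by move=> i _; exact: measurable_preimage.
Qed.

Lemma dep_upd s e u F : e \notin s -> dep (mem (e :: s)) F ->
  dep (mem s) (fun a => F (upd a e u)).
Proof.
move=> es dF a a' aa'; apply: dF => i; rewrite /upd /= inE.
by case: eqP => //= _ /aa'.
Qed.

Lemma upd_disc e u t : q (omega e t) = u -> upd (disc t) e u = disc t.
Proof. by move=> <-; exact: upd_same. Qed.

(** Splitting according to the value at one coordinate removes that coordinate, so arbitrary
    functions of finitely many rounded weights are reached by induction. *)
Lemma measurable_disc s F : uniq s -> dep (mem s) F ->
  measurable_fun setT (fun t => F (disc t)).
Proof.
elim: s F => [|e s IH] F /=.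
  move=> _ dF; rewrite (_ : (fun t => _) = cst (F (fun=> q 0))); first exact: measurable_cst.
  by apply/funext => t; exact: dF.
move=> /andP[es us] dF.
rewrite (_ : (fun t => _) = fun t => \sum_(u : V)
   (\1_(omega e @^-1` (q @^-1` [set u])) t * F (upd (disc t) e u))); last first.
  apply/funext => t; rewrite (bigD1 (q (omega e t))) //= big1 => [|u ut].
    by rewrite addr0 indicE mem_set //= mul1r upd_disc.
  rewrite indicE memNset ?mul0r //= => h.
  by rewrite h eqxx in ut.
apply: measurable_sum => u; apply: measurable_funM.
  by apply: measurable_indic; exact: measurable_preimage.
by apply: (IH (fun a => F (upd a e u))) => //; exact: dep_upd.
Qed.

Lemma cylinder_cut J B e u : e \notin J ->
  cylinder (e |` J)%fset (fun i => if i == e then q @^-1` [set u] else B i) =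
  cylinder J B `&` omega e @^-1` (q @^-1` [set u]).
Proof.
move=> eJ; apply/seteqP; split => [t h|t [hJ he] i /=].
  split; last by have := h e; rewrite /= eqxx; apply; rewrite !inE eqxx.
  move=> i /= iJ; have := h i; rewrite /= inE iJ orbT => /(_ isT).
  by case: eqP => // ie; move: eJ; rewrite -ie iJ.
by rewrite !inE; case: eqP => [->//|_] /= iJ; exact: hJ.
Qed.

Lemma probability_cylinder_cut J B e u : e \notin J -> (forall i, measurable (B i)) ->
  P (cylinder J B `&` omega e @^-1` (q @^-1` [set u])) = (P (cylinder J B) * (mass u)%:E)%E.
Proof.
move=> eJ mB; rewrite -cylinder_cut // /cylinder.
have [indep ident] := omega_iid.
rewrite !indep //; last by move=> i; case: eqP => // _; exact: q_measurable.
rewrite big_fsetU1 //= eqxx muleC massE -(ident e) //; congr (_ * _)%E.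
by apply: eq_big_seq => i iJ; case: eqP => // ie; move: eJ; rewrite -ie iJ.
Qed.

(** Cylinders make the induction on [s] work: fixing the rounded weight of [e] to be [u] gives a
    cylinder with one more constraint, and independence makes this constraint a factor [mass u]. *)
Lemma integral_disc_cylinder s F J B a : uniq s -> dep (mem s) F ->
  (forall i, measurable (B i)) -> (forall i, i \in s -> i \notin J) ->
  (\int[P]_(t in cylinder J B) (F (disc t))%:E = P (cylinder J B) * (avgs mass s F a)%:E)%E.
Proof.
elim: s F J B a => [|e s IH] F J B a /=.
  move=> _ dF mB _.
  under eq_integral => t _ do rewrite (dF (disc t) a) //.
  rewrite integral_cst; last exact: measurable_cylinder.
  by rewrite muleC.
move=> /andP[es us] dF mB sJ.
have eJ : e \notin J by apply: sJ; rewrite inE eqxx.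
pose C u := cylinder J B `&` omega e @^-1` (q @^-1` [set u]).
have mC u : measurable (C u).
  by apply: measurableI; [exact: measurable_cylinder|exact: measurable_preimage].
have cyl : cylinder J B = \big[setU/set0]_(u <- enum V) C u.
  rewrite -bigcup_seq; apply/seteqP; split => [t ht|t [u _ [//]]].
  by exists (q (omega e t)) => //=; rewrite mem_enum.
rewrite [in LHS]cyl integral_bigsetU_EFin //; last 3 first.
- exact: enum_uniq.
- by move=> u v _ _ [t [[_ /= <-] [_ /= <-]]].
- apply/measurable_EFinP; apply: measurable_funTS; apply: (@measurable_disc (e :: s)) => //=.
  by rewrite es.
have step u : (\int[P]_(t in C u) (F (disc t))%:E =
    P (cylinder J B) * (mass u * avgs mass s F (upd a e u))%:E)%E.
  have -> : (\int[P]_(t in C u) (F (disc t))%:E =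
      \int[P]_(t in C u) (F (upd (disc t) e u))%:E)%E.
    by apply: eq_integral => t; rewrite inE => -[_ /= tu]; rewrite upd_disc.
  rewrite /C -cylinder_cut //.
  rewrite (IH (fun a => F (upd a e u)) _ _ a) //.
  - rewrite cylinder_cut // probability_cylinder_cut // EFinM muleA.
    by rewrite avgs_upd.
  - exact: dep_upd.
  - by move=> i; case: eqP => // _; exact: q_measurable.
  - move=> i is_; rewrite !inE negb_or sJ ?inE ?is_ ?orbT // andbT.
    by apply: contraNneq es => <-.
under eq_bigr do rewrite step.
rewrite -(@fineK _ (P (cylinder J B))); last by rewrite fin_num_measure //; exact: measurable_cylinder.
under eq_bigr do rewrite -EFinM.
by rewrite sumEFin -EFinM -mulr_sumr big_enum.
Qed.

Lemma integral_disc s F a : uniq s -> dep (mem s) F ->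
  (\int[P]_t (F (disc t))%:E = (avgs mass s F a)%:E)%E.
Proof.
move=> us dF; have c0 : cylinder fset0 (fun=> setT) = setT.
  by apply/seteqP; split => // t _ i.
by rewrite -c0 (integral_disc_cylinder a us dF) // c0 probability_setT mul1e.
Qed.

End Discretization.

(** * Rounding down to a grid of the interval from 0 to [b] *)

Section Quantizer.
Variables (R : realType) (b : R) (m : nat).
Hypothesis b_gt0 : 0 < b.
Implicit Types r : R.

Definition clip r : R := Num.min (Num.max r 0) b.

Definition mesh : R := b / m.+1%:R.

(** The largest index [m.+1] is taken exactly when [clip r = b], hence the type ['I_m.+2]. *)
Definition quant r : 'I_m.+2 := inord (Num.truncn (clip r / mesh)).

Definition level (v : 'I_m.+2) : R := v%:R * mesh.

Lemma clip_bound r : 0 <= clip r <= b.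
Proof. by rewrite /clip le_min le_max lexx orbT (ltW b_gt0) ge_min lexx orbT. Qed.

Lemma clip_id r : 0 <= r <= b -> clip r = r.
Proof. by move=> /andP[r0 rb]; rewrite /clip max_l // min_l. Qed.

Lemma clip_homo : {homo clip : r s / r <= s}.
Proof.
move=> r s rs; rewrite /clip le_min !ge_min lexx orbT andbT; apply/orP; left.
by rewrite ge_max !le_max rs lexx orbT.
Qed.

Lemma mesh_gt0 : 0 < mesh.
Proof. by rewrite divr_gt0. Qed.

Lemma level_bound v : 0 <= level v <= b.
Proof.
have m0 := ltW mesh_gt0; rewrite /level mulr_ge0 //= /mesh mulrA ler_pdivrMr //.
by rewrite mulrC ler_pM2l // ler_nat -ltnS.
Qed.

Lemma quantE r : quant r = Num.truncn (clip r / mesh) :> nat.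
Proof.
rewrite inordK // ltnS; have /andP[c0 cb] := clip_bound r.
rewrite truncn_le_nat ltr_pdivrMr ?mesh_gt0 // /mesh mulrA ltr_pdivlMr //.
by apply: le_lt_trans (_ : b * m.+1%:R < _); rewrite ?ler_pM2r // mulrC ltr_pM2r // ltr_nat.
Qed.

Lemma level_quant r : level (quant r) <= clip r < level (quant r) + mesh.
Proof.
have /andP[c0 cb] := clip_bound r; have m0 := mesh_gt0.
rewrite /level quantE -[X in _ + X]mul1r -mulrDl natr1.
rewrite -ler_pdivlMr // -ltr_pdivrMr //.
by apply: truncn_itv; rewrite divr_ge0 // ltW.
Qed.

Lemma level_quant_dist r : `|level (quant r) - clip r| <= mesh.
Proof. by have := level_quant r; rewrite ler_norml; lra. Qed.

Lemma quant_homo r s : r <= s -> (quant r <= quant s)%N.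
Proof.
move=> rs; rewrite !quantE le_truncn // ler_pM2r ?invr_gt0 ?mesh_gt0 //.
exact: clip_homo.
Qed.

Lemma measurable_quant v : measurable (quant @^-1` [set v]).
Proof.
apply: is_interval_measurable => r s /= rv sv t /andP[rt ts].
apply/val_inj/eqP; rewrite eqn_leq -{1}sv -rv.
by rewrite !quant_homo.
Qed.

Lemma measurable_clip : measurable_fun setT clip.
Proof. by apply: nondecreasing_measurable => // r s; exact: clip_homo. Qed.

End Quantizer.

(** Let [c] be the left end of the support of [mu]. As [c] is not an atom, some mass lies at
    distance at least [n.+1%:R^-1] to the right of [c]; by definition of [c] there is also mass up
    to a point closer to [c]. Here the continuity of the law enters. *)
Lemma exists_split_quantiles (R : realType) (mu : probability (measurableTypeR R) R) (b : R) :
  0 < b -> (forall x : R, mu [set x] = 0%E) -> mu `]0, b]%classic = 1%E ->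
  exists x1 x3 : R, [/\ 0 <= x1, x1 < x3, x3 <= b,
    mu `]-oo, x1]%classic != 0%E & mu `[x3, +oo[%classic != 0%E].
Proof.
move=> b0 atomless mu0b.
have out (D : set R) : measurable D -> D `&` `]0, b]%classic = set0 -> mu D = 0%E.
  move=> mD D0.
  have DI : D `<=` ~` `]0, b]%classic.
    by move=> r Dr /= rI; have : (D `&` `]0, b]%classic) r by []; rewrite D0.
  have h : mu (~` `]0, b]%classic) = 0%E.
    by rewrite probability_setC // mu0b subee.
  apply/eqP; rewrite -measure_le0 -h.
  by apply: le_measure; rewrite ?inE //; exact: measurableC.
have itv_out x : x <= 0 -> mu `]-oo, x]%classic = 0%E.
  move=> x0; apply: out => //; apply/seteqP; split => // r [] /=.
  by rewrite !in_itv /= => rx /andP[r0 _]; have := lt_le_trans r0 (le_trans rx x0); rewrite ltxx.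
pose A := [set x : R | mu `]-oo, x]%classic != 0%E].
have Apos x : A x -> 0 <= x.
  by move=> Ax; rewrite leNgt; apply/negP => x0; move: Ax; rewrite /A /= itv_out ?eqxx // ltW.
have Ab : A b.
  rewrite /A /= gt_eqF //; apply: (@lt_le_trans _ _ (mu `]0, b]%classic)).
    by rewrite mu0b lte01.
  by apply: le_measure; rewrite ?inE //; apply: subset_itvr.
have iA : has_inf A by split; [exists b|exists 0].
pose c := inf A.
have belowc x : x < c -> mu `]-oo, x]%classic = 0%E.
  move=> xc; apply/eqP; apply: contraTT xc => Ax; rewrite -leNgt.
  exact: ge_inf (iA.2) _ Ax.
have muc : mu `]-oo, c]%classic = 0%E.
  apply/negligibleP => //.
  apply: (@negligibleS _ _ _ mu ((\bigcup_n `]-oo, c - n.+1%:R^-1]%classic) `|` [set c])).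
    move=> r /=; rewrite in_itv /= le_eqVlt => /orP[/eqP ->|rc]; [by right|left].
    have cr0 : 0 < c - r by rewrite subr_gt0.
    have [n hn] := ltr_add_invr cr0.
    exists n => //=; rewrite in_itv /=; move: hn; rewrite add0r; set y := _^-1; lra.
  apply: negligibleU; last by apply/negligibleP => //; exact: atomless.
  apply: negligible_bigcup => n; apply/negligibleP => //; apply: belowc.
  by rewrite ltrBlDr ltrDl invr_gt0.
have [n hn] : exists n, mu `[c + n.+1%:R^-1, +oo[%classic != 0%E.
  apply: contrapT => nex.
  have : mu setT = 0%E; last by rewrite probability_setT => /eqP; rewrite onee_eq0.
  apply/negligibleP => //.
  apply: (@negligibleS _ _ _ mu (`]-oo, c]%classic `|` \bigcup_n `[c + n.+1%:R^-1, +oo[%classic)).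
    move=> r _ /=; rewrite in_itv /=; have [rc|rc] := leP r c; [by left|right].
    have cr0 : 0 < r - c by rewrite subr_gt0.
    have [n hn] := ltr_add_invr cr0.
    exists n => //=; rewrite in_itv /= andbT; move: hn; rewrite add0r; set y := _^-1; lra.
  apply: negligibleU; first by apply/negligibleP.
  apply: negligible_bigcup => n; apply/negligibleP => //; apply/eqP/negPn/negP => h.
  by apply: nex; exists n.
have [a Aa ac] : exists2 a, A a & a < c + n.+1%:R^-1.
  have e0 : 0 < n.+1%:R^-1 :> R by rewrite invr_gt0.
  by have [a Aa ac] := inf_adherent e0 iA; exists a.
exists a, (c + n.+1%:R^-1); split => //; first exact: Apos.
rewrite leNgt; apply/negP => bx; move: hn; rewrite out ?eqxx //.
apply/seteqP; split => // r [] /=; rewrite !in_itv /= andbT => h1 /andP[_ h2].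
by have := lt_le_trans bx (le_trans h1 h2); rewrite ltxx.
Qed.

(** * Volume and boundary of boxes *)

Section Growth.
Variable d : nat.
Hypothesis d_gt0 : (0 < d)%N.

Lemma cube_edges_ge n : (0 < n)%N -> ((2 * n).-1 ^ d <= #|` cube_edges d n|)%N.
Proof.
case: n => // n _; apply: leq_trans (card_cube_edges n d_gt0).
by rewrite card_cube mulnS.
Qed.

Lemma leq_exp2r_w a c e : (a <= c)%N -> (a ^ e <= c ^ e)%N.
Proof. by case: e => // e; rewrite leq_exp2r. Qed.

Lemma cube_edges_ge_size n : (n <= #|` cube_edges d n|)%N.
Proof.
case: n => // n; apply: leq_trans (cube_edges_ge (ltn0Sn n)).
apply: leq_trans (_ : (2 * n.+1).-1 ^ 1 <= _)%N; first by rewrite expn1; lia.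
by apply: leq_pexp2l => //; lia.
Qed.

(** The shell of width [k] has at most [2 * k * d * (2 * n).+1 ^ d.-1] points. With [Q] the side
    length of [cube d n.-1], both [(2 * n).+1 <= 3 * Q] and [n <= Q] hold, so the boundary fraction
    is of order [1 / n]. *)
Lemma boundary_count n k : (0 < n)%N -> (k <= n)%N ->
  ((#|` cube d n| - #|` cube d (n - k)|) * d * n <=
   (2 * k * d * 3 ^ d.-1 * d) * #|` cube_edges d n|)%N.
Proof.
move=> n0 kn; rewrite !card_cube subn_exp.
have -> : ((2 * n).+1 - (2 * (n - k)).+1 = 2 * k)%N by lia.
set Q := (2 * n).-1.
have Q0 : (0 < Q)%N by rewrite /Q; lia.
apply: leq_trans (leq_mul (leqnn _) (cube_edges_ge n0)); rewrite -/Q.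
apply: leq_trans (_ : 2 * k * (d * (3 * Q) ^ d.-1) * d * n <= _)%N.
  rewrite !leq_mul2r; apply/orP; right; apply/orP; right.
  rewrite leq_mul2l; apply/orP; right.
  apply: leq_trans (_ : \sum_(i < d) (3 * Q) ^ d.-1 <= _)%N; last by rewrite sum_nat_const card_ord.
  apply: leq_sum => i _.
  have id : (i <= d.-1)%N by rewrite -ltnS prednK.
  rewrite -[in leqRHS](subnK id) expnD.
  have -> : (d.-1 - i = d - i.+1)%N by lia.
  by apply: leq_mul; apply: leq_exp2r_w; lia.
have -> : (Q ^ d = Q * Q ^ d.-1)%N by rewrite -expnS prednK.
rewrite expnMn; have nQ : (n <= Q)%N by rewrite /Q; lia.
have := leq_mul (leqnn (2 * k * d * 3 ^ d.-1 * d * Q ^ d.-1)%N) nQ; lia.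
Qed.

End Growth.

(** * Expectations of bounded variables *)

Section BoundedExpectation.
Variables (R : realType) (dT : measure_display) (T : measurableType dT).
Variable P : probability T R.
Implicit Types X Y : T -> R.

Lemma integrable_bounded X (c : R) : measurable_fun setT X -> (forall t, `|X t| <= c) ->
  P.-integrable setT (EFin \o X).
Proof.
move=> mX Xc; apply: measurable_bounded_integrable => //.
  exact: le_lt_trans (probability_le1 P measurableT) (ltry 1).
exists c; split; first exact: num_real.
by move=> y cy t _; apply: le_trans (Xc t) _; exact: ltW.
Qed.

Lemma Rintegral_prob_cst (r : R) : (\int[P]_t r)%R = r.
Proof.
rewrite Rintegral_cst // -[RHS]mulr1; congr (_ * _).
exact: (congr1 fine (probability_setT P)).
Qed.

Lemma Rintegral_dist X Y (eps : R) :
  P.-integrable setT (EFin \o X) -> P.-integrable setT (EFin \o Y) ->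
  (forall t, `|X t - Y t| <= eps) -> `|(\int[P]_t X t)%R - (\int[P]_t Y t)%R| <= eps.
Proof.
move=> iX iY XY.
have iXY : P.-integrable setT (EFin \o (fun t => X t - Y t)).
  by apply: eq_integrable (integrableB measurableT iX iY).
rewrite -RintegralB //; apply: le_trans (le_normr_Rintegral measurableT iXY) _.
rewrite -[leRHS]Rintegral_prob_cst; apply: le_Rintegral => //.
- exact: (integrable_norm iXY).
- exact: finite_measure_integrable_cst.
Qed.

End BoundedExpectation.

(** * Weights clipped to a bounded interval *)

Section Clipped.
Variables (R : realType) (dT : measure_display) (T : measurableType dT).
Variables (P : probability T R) (d : nat) (omega : edge d -> {RV P >-> R}) (b : R).

(** Clipping makes the bounds on the weights hold everywhere instead of almost surely, so the
    estimates can be pointwise. *)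
Definition clipped (e : edge d) (t : T) : R := clip b (omega e t).

Lemma measurable_clipped e : measurable_fun setT (clipped e).
Proof.
apply: measurableT_comp; first exact: measurable_clip.
exact: measurable_funPT.
Qed.

HB.instance Definition _ e := isMeasurableFun.Build _ _ _ _ (clipped e) (measurable_clipped e).

Definition clipped_tree (n : nat) : {RV P >-> R} :=
  mst_weight (fun e => clipped e : {RV P >-> R}) n.

Hypothesis b_gt0 : 0 < b.

Lemma clipped_treeE n t : clipped_tree n t =
  connector_weight (fun e : edge d => val e) (box d n) (cube_edges d n) (clipped ^~ t).
Proof.
rewrite /clipped_tree /= /mst_weight; apply: mst_connector => e _.
by have /andP[] := clip_bound b_gt0 (omega e t).
Qed.

End Clipped.

(** * Errors caused by the rounding *)

Section Approximation.
Variables (R : realType) (dT : measure_display) (T : measurableType dT).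
Variables (P : probability T R) (d : nat) (omega : edge d -> {RV P >-> R}) (b : R).
Variable mu : probability (measurableTypeR R) R.
Hypotheses (b_gt0 : 0 < b) (omega_iid : iid P omega mu).

Let E n := enum_fset (cube_edges d n).
Let N n : R := (#|` cube_edges d n|)%:R.
Let Y := clipped_tree omega b.
Let p m : 'I_m.+2 -> R := mass mu (quant b m).
Let x m : 'I_m.+2 -> R := @level R b m.
Let D m t : edge d -> 'I_m.+2 := disc omega (quant b m) t.
Let mean n := (\int[P]_t Y n t)%R.

Let p_ge0 m v : 0 <= p (m := m) v.
Proof. exact: mass_ge0. Qed.

Let p_sum1 m : \sum_v p (m := m) v = 1.
Proof. exact: mass_sum1 (measurable_quant b_gt0). Qed.

Let x_bound m v : 0 <= x (m := m) v <= b.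
Proof. exact: level_bound. Qed.

Lemma mesh_cvg0 (eps : R) : 0 < eps ->
  exists m0, forall m, (m0 <= m)%N -> mesh b m <= eps.
Proof.
move=> e0; have be : 0 <= b / eps by rewrite divr_ge0 // ltW.
exists (Num.truncn (b / eps)) => m m0m; rewrite /mesh ler_pdivrMr //.
rewrite mulrC -ler_pdivrMr //; apply: ltW; apply: lt_le_trans (truncnS_gt _) _.
by rewrite ler_nat.
Qed.

Lemma N_ge0 n : 0 <= N n.
Proof. exact: ler0n. Qed.

Lemma tree_approx m n t : `|Y n t - tree (@x m) n (D m t)| <= N n * mesh b m.
Proof.
rewrite /Y clipped_treeE // /tree; apply: connector_weight_lipschitz.
- exact: cube_connector.
- by apply: ltW; exact: mesh_gt0.
- by move=> e _; rewrite distrC; exact: level_quant_dist.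
Qed.

Lemma tree_bound m n (a : edge d -> 'I_m.+2) : 0 <= tree (@x m) n a <= N n * b.
Proof.
have [F [FS cF FE]] := connector_weight_attained (@x m \o a) (@cube_connector d n).
rewrite /tree FE; apply/andP; split; first by apply: sumr_ge0 => e _; case/andP: (x_bound (a e)).
apply: le_trans (_ : \sum_(e <- F) b <= _).
  by apply: ler_sum => e _; case/andP: (x_bound (a e)).
rewrite big_const_seq count_predT iter_addr_0 -mulr_natl ler_wpM2r ?(ltW b_gt0) //.
by rewrite ler_nat; exact: fsubset_leq_card.
Qed.

Lemma clipped_tree_bound n t : 0 <= Y n t <= N n * b.
Proof.
rewrite /Y clipped_treeE //.
have [F [FS cF ->]] := connector_weight_attained (clipped omega b ^~ t) (@cube_connector d n).
have cb e := clip_bound b_gt0 (omega e t).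
apply/andP; split; first by apply: sumr_ge0 => e _; case/andP: (cb e).
apply: le_trans (_ : \sum_(e <- F) b <= _).
  by apply: ler_sum => e _; case/andP: (cb e).
rewrite big_const_seq count_predT iter_addr_0 -mulr_natl ler_wpM2r ?(ltW b_gt0) //.
by rewrite ler_nat; exact: fsubset_leq_card.
Qed.

Lemma integrable_comp_disc m s (F : (edge d -> 'I_m.+2) -> R) (c : R) :
  uniq s -> dep (mem s) F -> (forall a, `|F a| <= c) ->
  P.-integrable setT (EFin \o (fun t => F (D m t))).
Proof.
move=> us dF Fc; apply: (@integrable_bounded _ _ _ P _ c) => //.
exact: (measurable_disc omega (measurable_quant b_gt0) us dF).
Qed.

Lemma Rintegral_disc m s (F : (edge d -> 'I_m.+2) -> R) (a : edge d -> 'I_m.+2) : uniq s -> dep (mem s) F ->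
  (\int[P]_t F (D m t))%R = avgs (@p m) s F a.
Proof.
move=> us dF.
by rewrite /Rintegral (integral_disc omega_iid (measurable_quant b_gt0) a us dF).
Qed.

Lemma integrable_clipped_tree n : P.-integrable setT (EFin \o Y n).
Proof.
apply: (@integrable_bounded _ _ _ P _ (N n * b)); first exact: measurable_funPT.
by move=> t; have /andP[h1 h2] := clipped_tree_bound n t; rewrite ger0_norm.
Qed.

Lemma mean_approx m n (a : edge d -> 'I_m.+2) : `|mean n - avgs (@p m) (E n) (tree (@x m) n) a| <= N n * mesh b m.
Proof.
have dt : dep (mem (E n)) (tree (@x m) n) by exact: tree_dep.
have uE : uniq (E n) by exact: fset_uniq.
rewrite -(Rintegral_disc a uE dt); apply: Rintegral_dist => [||t].
- exact: integrable_clipped_tree.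
- apply: (integrable_comp_disc uE dt (c := N n * b)) => c.
  by have /andP[h1 h2] := tree_bound n c; rewrite ger0_norm.
- exact: tree_approx.
Qed.

Lemma mean_bound n : 0 <= mean n <= N n * b.
Proof.
have iY := integrable_clipped_tree n; apply/andP; split.
  by apply: Rintegral_ge0 => t _; case/andP: (clipped_tree_bound n t).
rewrite -(Rintegral_prob_cst P (N n * b)); apply: le_Rintegral => //.
- exact: finite_measure_integrable_cst.
- by move=> t _; case/andP: (clipped_tree_bound n t).
Qed.

(** Rounding moves the tree weight and its mean by at most [N n * mesh b m] each. Both sides are
    scaled by the same [s0], so the standard deviation of the rounded tree does not appear. *)
Lemma test_approx m n (k : R -> R) (s0 L eps : R) (a : edge d -> 'I_m.+2) : continuous k ->
  (forall y, `|k y| <= L) -> 0 < s0 ->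
  (forall y z, `|y - z| <= 2 * (N n * mesh b m) / s0 -> `|k y - k z| <= eps) ->
  `|(\int[P]_t k ((Y n t - mean n) / s0))%R -
    avgs (@p m) (E n) (fun a => k ((tree (@x m) n a - avgs (@p m) (E n) (tree (@x m) n) a) / s0)) a|
  <= eps.
Proof.
move=> ck kL s00 kE.
have dt : dep (mem (E n)) (tree (@x m) n) by exact: tree_dep.
have uE : uniq (E n) by exact: fset_uniq.
have avgE c c' : avgs (@p m) (E n) (tree (@x m) n) c = avgs (@p m) (E n) (tree (@x m) n) c'.
  exact: avgs_dep_const.
have dk : dep (mem (E n)) (fun a => k ((tree (@x m) n a - avgs (@p m) (E n) (tree (@x m) n) a) / s0)).
  by move=> c c' cc'; rewrite (avgE c c') (dt c c').
rewrite -(Rintegral_disc a uE dk); apply: Rintegral_dist => [||t].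
- apply: (@integrable_bounded _ _ _ P _ L) => [|t //].
  apply: measurableT_comp; first exact: measurable_continuous.
  apply: measurable_funM; last exact: measurable_cst.
  by apply: measurable_funB; [exact: measurable_funPT|exact: measurable_cst].
- exact: (integrable_comp_disc uE dk (c := L)).
apply: kE; rewrite -mulrBl normrM [X in _ * X]gtr0_norm ?invr_gt0 // ler_pM2r ?invr_gt0 //.
have := mean_approx n (D m t); have := tree_approx m n t.
set u := Y n t; set v := tree _ _ _; set w := mean n; set z := avgs _ _ _ _ => h1 h2.
have -> : u - w - (v - z) = (u - v) - (w - z) by lra.
by apply: le_trans (ler_normB _ _) _; lra.
Qed.

(** In the factored difference of squares one factor is a rounding error and the other at most
    [2 * (N n * b)]. The power of [N n] is harmless, as the mesh is chosen after [n]. *)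
Lemma variance_approx m n (a : edge d -> 'I_m.+2) :
  `|(\int[P]_t ((Y n t - mean n) ^+ 2))%R - avgs_variance (@p m) (E n) (tree (@x m) n) a| <=
  8 * N n ^+ 2 * b * mesh b m.
Proof.
have dt : dep (mem (E n)) (tree (@x m) n) by exact: tree_dep.
have uE : uniq (E n) by exact: fset_uniq.
have avgE c c' : avgs (@p m) (E n) (tree (@x m) n) c = avgs (@p m) (E n) (tree (@x m) n) c'.
  exact: avgs_dep_const.
have dv : dep (mem (E n)) (fun a => (tree (@x m) n a - avgs (@p m) (E n) (tree (@x m) n) a) ^+ 2).
  by move=> c c' cc'; rewrite (avgE c c') (dt c c').
have bd (u v : R) : 0 <= u <= N n * b -> 0 <= v <= N n * b -> `|u - v| <= N n * b.
  by move=> /andP[u0 u1] /andP[v0 v1]; rewrite ler_norml; lra.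
have avgb c : 0 <= avgs (@p m) (E n) (tree (@x m) n) c <= N n * b.
  apply/andP; split; first by apply: avgs_ge0 => // c'; case/andP: (tree_bound n c').
  rewrite -[leRHS](congr1 (fun f => f c) (avgs_cst (@p_sum1 m) (E n) (N n * b))).
  by apply: avgs_le => // c'; case/andP: (tree_bound n c').
rewrite /avgs_variance -(Rintegral_disc a uE dv); apply: Rintegral_dist => [||t].
- apply: (@integrable_bounded _ _ _ P _ ((N n * b) ^+ 2)).
    apply: measurable_funX; apply: measurable_funB; first exact: measurable_funPT.
    exact: measurable_cst.
  move=> t; rewrite normrX lerXn2r ?nnegrE //; first by rewrite mulr_ge0 ?N_ge0 // ltW.
  by apply: bd; [exact: clipped_tree_bound|exact: mean_bound].
- apply: (integrable_comp_disc uE dv (c := (N n * b) ^+ 2)) => c.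
  rewrite normrX lerXn2r ?nnegrE //; first by rewrite mulr_ge0 ?N_ge0 // ltW.
  by apply: bd; [exact: tree_bound|exact: avgb].
have := bd _ _ (clipped_tree_bound n t) (mean_bound n).
have := bd _ _ (tree_bound n (D m t)) (avgb (D m t)).
have := mean_approx n (D m t); have := tree_approx m n t.
set u := Y n t; set v := tree _ _ _; set w := mean n; set z := avgs _ _ _ _ => h1 h2 h3 h4.
have -> : (u - w) ^+ 2 - (v - z) ^+ 2 = ((u - v) - (w - z)) * ((u - w) + (v - z)) by rewrite !expr2; lra.
rewrite normrM.
have h5 : `|(u - v) - (w - z)| <= 2 * (N n * mesh b m).
  by apply: le_trans (ler_normB _ _) _; lra.
have h6 : `|(u - w) + (v - z)| <= 2 * (N n * b).
  by apply: le_trans (ler_normD _ _) _; lra.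
apply: le_trans (ler_pM _ _ h5 h6) _ => //.
have : 0 <= N n ^+ 2 * b * mesh b m.
  by rewrite !mulr_ge0 ?sqr_ge0 ?(ltW b_gt0) // ltW // mesh_gt0.
by rewrite expr2; lra.
Qed.

(** Bottlenecks are 1-Lipschitz for the supremum norm of the weights, so the bound is free of the
    radius [k]; the convergence of the mean critical weight is thus uniform over fine roundings. *)
Lemma mean_crit_approx m m' k (i : 'I_d) (a : edge d -> 'I_m.+2) (a' : edge d -> 'I_m'.+2) :
  `|mean_crit (@p m) (@x m) b k i a - mean_crit (@p m') (@x m') b k i a'| <=
  mesh b m + mesh b m'.
Proof.
have b0 := ltW b_gt0.
have uE : uniq (E k) by exact: fset_uniq.
have dc l : dep (mem (E k)) (crit (@x l) b (cube_edges d k) (mk_edge 0 i)).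
  by move=> c c' cc'; apply: alpha_dep => // e ek _; rewrite /= cc'.
have cb l c : `|crit (@x l) b (cube_edges d k) (mk_edge 0 i) c| <= b.
  by rewrite ger0_norm ?crit_le ?crit_ge0.
rewrite /mean_crit -(Rintegral_disc a uE (dc m)) -(Rintegral_disc a' uE (dc m')).
apply: Rintegral_dist => [||t].
- exact: (integrable_comp_disc uE (dc m) (cb m)).
- exact: (integrable_comp_disc uE (dc m') (cb m')).
have dist e : `|x (D m t e) - x (D m' t e)| <= mesh b m + mesh b m'.
  have := level_quant_dist m b_gt0 (omega e t); have := level_quant_dist m' b_gt0 (omega e t).
  rewrite /x /D /disc; set u := level _ _; set v := level _ _; set w := clip _ _ => h1 h2.
  have -> : v - u = (v - w) - (u - w) by lra.
  by apply: le_trans (ler_normB _ _) _; lra.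
have m0 : 0 <= mesh b m + mesh b m' by rewrite addr_ge0 // ltW // mesh_gt0.
rewrite ler_norml; apply/andP; split.
  rewrite lerBrDl lerBlDr; apply: bottleneck_lipschitz => // e _ /=.
  by have := dist e; rewrite ler_norml; lra.
rewrite lerBlDl; apply: bottleneck_lipschitz => // e _ /=.
by have := dist e; rewrite ler_norml; lra.
Qed.

Lemma mass_low m (x1 : R) : 0 <= x1 ->
  fine (mu `]-oo, x1]%classic) <= \sum_(v | x v <= x1) p (m := m) v.
Proof.
move=> x10; rewrite -lee_fin /p (mass_sum mu (measurable_quant b_gt0)).
rewrite fineK; last by apply: fin_num_measure; exact: measurable_itv.
apply: le_measure; rewrite ?inE; first exact: measurable_itv.
  exact: (measurable_pred (@measurable_quant R b m b_gt0) (fun v => x v <= x1)).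
move=> r /=; rewrite in_itv /= => rx.
have /andP[h _] := level_quant m b_gt0 r; apply: le_trans h _.
by rewrite /clip ge_min ge_max rx x10.
Qed.

Lemma mass_high m (x2 x3 : R) : x3 <= b -> x2 + mesh b m <= x3 ->
  fine (mu `[x3, +oo[%classic) <= \sum_(v | x2 <= x v) p (m := m) v.
Proof.
move=> x3b x23; rewrite -lee_fin /p (mass_sum mu (measurable_quant b_gt0)).
rewrite fineK; last by apply: fin_num_measure; exact: measurable_itv.
apply: le_measure; rewrite ?inE; first exact: measurable_itv.
  exact: (measurable_pred (@measurable_quant R b m b_gt0) (fun v => x2 <= x v)).
move=> r /=; rewrite in_itv /= andbT => rx.
have /andP[_ h] := level_quant m b_gt0 r.
have : x3 <= clip b r by rewrite /clip le_min le_max rx x3b.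
rewrite /x; lra.
Qed.

End Approximation.

(** * The limit *)

Section SteinLimit.
Variables (R : realType) (dT : measure_display) (T : measurableType dT).
Variables (P : probability T R) (d : nat) (omega : edge d -> {RV P >-> R}) (b : R).
Variable mu : probability (measurableTypeR R) R.
Hypotheses (b_gt0 : 0 < b) (omega_iid : iid P omega mu) (d_gt0 : (0 < d)%N).
Hypotheses (atomless : forall x : R, mu [set x] = 0%E) (mu_b : mu `]0, b]%classic = 1%E).

Let E n := enum_fset (cube_edges d n).
Let N n : R := (#|` cube_edges d n|)%:R.
Let Y := clipped_tree omega b.
Let p m : 'I_m.+2 -> R := mass mu (quant b m).
Let x m : 'I_m.+2 -> R := @level R b m.
Let mean n := (\int[P]_t Y n t)%R.
Let s2 n := (\int[P]_t ((Y n t - mean n) ^+ 2))%R.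
Let conf m : edge d -> 'I_m.+2 := fun=> ord0.

Let p_ge0 m v : 0 <= p (m := m) v.
Proof. exact: mass_ge0. Qed.

Let p_sum1 m : \sum_v p (m := m) v = 1.
Proof. exact: mass_sum1 (measurable_quant b_gt0). Qed.

Let x_bound m v : 0 <= x (m := m) v <= b.
Proof. exact: level_bound. Qed.

(** The lower bound of [tree_variance_lower] involves only [pi], [x1] and [x2], none of which
    depends on the rounding, and so survives as the mesh tends to 0. *)
Lemma variance_linear_growth : exists2 c0, 0 < c0 & forall n, N n * c0 <= s2 n.
Proof.
have [x1 [x3 [x10 x13 x3b m1 m3]]] := exists_split_quantiles b_gt0 atomless mu_b.
pose pi1 := fine (mu `]-oo, x1]%classic).
pose pi3 := fine (mu `[x3, +oo[%classic).
have pos (A : set R) : measurable A -> mu A != 0%E -> 0 < fine (mu A).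
  move=> mA A0; rewrite fine_gt0 // lt0e A0 measure_ge0 /=.
  by rewrite ltey_eq fin_num_measure.
have pi10 : 0 < pi1 by exact: pos.
have pi30 : 0 < pi3 by exact: pos.
pose pi := Num.min pi1 pi3.
have pi0 : 0 < pi by rewrite lt_min pi10.
have pi1' : pi <= pi1 by rewrite ge_min lexx.
have pi3' : pi <= pi3 by rewrite ge_min lexx orbT.
have pile1 : pi <= 1.
  apply: le_trans pi1' _; rewrite -lee_fin fineK ?fin_num_measure //.
  exact: probability_le1.
(* Rounding down may bring weights below [x3]; the midpoint leaves [x3 - x2] as room for the
   mesh. *)
pose x2 := (x1 + x3) / 2.
pose c0 := pi * (((x2 - x1) * pi ^+ (2 * d)) ^+ 2 / 4).
have x12 : x1 < x2 by rewrite /x2; lra.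
exists c0.
  rewrite mulr_gt0 // divr_gt0 // exprn_gt0 // mulr_gt0 ?exprn_gt0 // subr_gt0 //.
move=> n; apply/ler_addgt0Pr => eps e0.
have K0 : 0 < 8 * N n ^+ 2 * b + 1.
  by rewrite ltr_wpDl // mulr_ge0 ?(ltW b_gt0) // mulr_ge0 // sqr_ge0.
have [m0 hm0] : exists m0, forall m, (m0 <= m)%N -> mesh b m <= Num.min (x3 - x2) (eps / (8 * N n ^+ 2 * b + 1)).
  by apply: mesh_cvg0 => //; rewrite lt_min divr_gt0 // andbT /x2; lra.
have := hm0 m0 (leqnn _); rewrite le_min => /andP[h1 h2].
have mp0 := mesh_gt0 m0 b_gt0.
have v1 : N n * c0 <= avgs_variance (@p m0) (E n) (tree (@x m0) n) (conf m0).
  apply: (tree_variance_lower (@p_ge0 m0) (@p_sum1 m0) (@x_bound m0) (ltW b_gt0)) => //.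
  - by rewrite /x2; lra.
  - by rewrite (ltW pi0).
  - by apply: le_trans pi1' _; exact: mass_low.
  - by apply: le_trans pi3' _; apply: mass_high => //; lra.
have := variance_approx b_gt0 omega_iid n (conf m0); rewrite ler_norml => /andP[v2 _].
have : 8 * N n ^+ 2 * b * mesh b m0 <= eps.
  move: h2; rewrite ler_pdivlMr //; lra.
by move: v1 v2; rewrite -/(s2 n) -/(N n) -/Y -/(mean n); lra.
Qed.

(** Take [k0] with [h k0] within [tau] of the infimum; the bound then holds against every [m]. *)
Lemma nonincreasing_tail (h : nat -> R) (tau : R) : 0 < tau ->
  (forall k, 0 <= h k) -> (forall k m, (k <= m)%N -> h m <= h k) ->
  exists k0, forall k m, (k0 <= k)%N -> h k - h m <= tau.
Proof.
move=> t0 h0 hh.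
have iA : has_inf (range h).
  by split; [exists (h 0%N), 0%N|exists 0 => _ [k _ <-]].
have [_ [k0 _ <-] hk0] := inf_adherent t0 iA.
exists k0 => k m k0k.
have : inf (range h) <= h m by apply: ge_inf; [exact: iA.2|exists m].
have := hh _ _ k0k; lra.
Qed.

(** The bound is [tree_stein_bound] for the rounded tree. Choices are made in the order [tau],
    [delta1], [delta2], radius [k0], threshold for [n], and last the rounding [m], which may depend
    on [n]. *)
Lemma stein_limit (G G' : R -> R) (L eps : R) :
  (forall y, `|G' y| <= L) ->
  (forall eta, 0 < eta -> exists2 delta, 0 < delta & forall y z,
     `|y - z| <= delta -> `|G y - G z - G' y * (y - z)| <= eta * `|y - z|) ->
  let k y := G' y - y * G y in
  continuous k -> (forall y, `|k y| <= L) ->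
  (forall eta, 0 < eta -> exists2 delta, 0 < delta & forall y z,
     `|y - z| <= delta -> `|k y - k z| <= eta) ->
  0 < eps -> exists n0, forall n, (n0 <= n)%N ->
    `|(\int[P]_t k ((Y n t - mean n) / Num.sqrt (s2 n)))%R| <= eps.
Proof.
move=> G'L linG k ck kL uk eps0.
have b0 := ltW b_gt0.
have L0 : 0 <= L by apply: le_trans (kL 0).
have [c0 c00 s2N] := variance_linear_growth.
(* [tau * M] is the total error: 1 for passing to the rounded tree, the term with [L] for the
   variance and the fluctuation of [steinT], and [b ^+ 2 / c0] for the linearisation of [G]. *)
pose M := 1 + L * (1 + (8 * b + 6 * b ^+ 2) / c0) + b ^+ 2 / c0.
have bc : 0 <= (8 * b + 6 * b ^+ 2) / c0.
  by rewrite divr_ge0 ?(ltW c00) // addr_ge0 // mulr_ge0 // sqr_ge0.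
have M0 : 0 < M.
  have : 0 <= L * (1 + (8 * b + 6 * b ^+ 2) / c0) by rewrite mulr_ge0 // addr_ge0.
  have : 0 <= b ^+ 2 / c0 by rewrite divr_ge0 ?sqr_ge0 // ltW.
  by rewrite /M; lra.
pose tau := eps / M.
have tau0 : 0 < tau by rewrite divr_gt0.
have [delta1 d10 lin1] := linG _ tau0.
have [delta2 d20 uk2] := uk _ tau0.
have dR0 : 0 < d%:R :> R by rewrite ltr0n.
have t8 : 0 < tau / (8 * d%:R) by rewrite divr_gt0 // mulr_gt0.
(* The reference rounding, chosen before [n]: it decides [k0], and [cE] below carries the estimate
   over to [m], whose mesh obeys the same bound. *)
have [mr /(_ mr (leqnn _)) hmr] := mesh_cvg0 b_gt0 t8.
pose h kk := \sum_i mean_crit (@p mr) (@x mr) b kk i (conf mr).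
have [k0 hk0] : exists k0, forall k m, (k0 <= k)%N -> h k - h m <= tau / 2.
  apply: nonincreasing_tail; first by rewrite divr_gt0.
    move=> kk; apply: sumr_ge0 => i _; by apply: mean_crit_ge0.
  move=> k1 k2 k12; apply: ler_sum => i _.
  by apply: mean_crit_homo.
pose Dk := (#|` cube d (k0.+1 + k0.+1)| * d)%N.
pose C := (2 * k0.+1 * d * 3 ^ d.-1 * d)%N.
(* The three terms control the boundary edges, the square root in [locality_bound], and the
   increment [b / s0], which must not exceed [delta1]. *)
pose bnd := C%:R / tau + Dk%:R / tau ^+ 2 + (b / delta1) ^+ 2 / c0.
exists (maxn k0.+2 (Num.truncn bnd).+1) => n; rewrite geq_max => /andP[kn nb].
have n0 : (0 < n)%N by apply: leq_trans kn.
have nR0 : 0 < n%:R :> R by rewrite ltr0n.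
have bn : bnd <= n%:R.
  by apply: ltW; apply: lt_le_trans (truncnS_gt _) _; rewrite ler_nat.
have Nn : n%:R <= N n by rewrite ler_nat; exact: cube_edges_ge_size.
have N0 : 0 < N n by apply: lt_le_trans Nn.
have bnd3 : [/\ C%:R / tau <= n%:R, Dk%:R / tau ^+ 2 <= n%:R & (b / delta1) ^+ 2 / c0 <= n%:R].
  have h1 : 0 <= C%:R / tau by rewrite divr_ge0 // ltW.
  have h2 : 0 <= Dk%:R / tau ^+ 2 by rewrite divr_ge0 // sqr_ge0.
  have h3 : 0 <= (b / delta1) ^+ 2 / c0 by rewrite divr_ge0 ?sqr_ge0 // ltW.
  by move: bn; rewrite /bnd; split; lra.
have [bC bD bdel] := bnd3.
have s2n := s2N n.
have s20 : 0 < s2 n by apply: lt_le_trans s2n; rewrite mulr_gt0.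
pose s0 := Num.sqrt (s2 n).
have s00 : 0 < s0 by rewrite sqrtr_gt0.
have s0E : s0 ^+ 2 = s2 n by rewrite sqr_sqrtr // ltW.
have Nr : N n / s2 n <= c0^-1.
  by rewrite ler_pdivrMr // mulrC ler_pdivlMr.
have bs0 : b / s0 <= delta1.
  rewrite ler_pdivrMr // -(@ler_pXn2r _ 2) ?nnegrE ?mulr_ge0 ?(ltW d10) ?(ltW s00) //.
  rewrite exprMn s0E mulrC -ler_pdivrMr ?exprn_gt0 // -exprVn -exprMn.
  apply: le_trans s2n; rewrite -ler_pdivrMr //; exact: le_trans bdel Nn.
have NNb : 0 < 8 * N n ^+ 2 * b by rewrite mulr_gt0 // mulr_gt0 // exprn_gt0.
have N2 : 0 < 2 * N n by rewrite mulr_gt0.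
(* The three constraints serve [cE], [vE] and [A1], in this order. *)
have [m hm] : exists m, mesh b m <= Num.min (tau / (8 * d%:R))
    (Num.min (tau * s2 n / (8 * N n ^+ 2 * b)) (delta2 * s0 / (2 * N n))).
  have [m0 /(_ m0 (leqnn _)) hm0] : exists m0, forall m, (m0 <= m)%N -> mesh b m <= Num.min (tau / (8 * d%:R))
    (Num.min (tau * s2 n / (8 * N n ^+ 2 * b)) (delta2 * s0 / (2 * N n))).
    apply: mesh_cvg0 => //; rewrite !lt_min t8 /=; apply/andP.
    by split; apply: divr_gt0 => //; apply: mulr_gt0.
  by exists m0.
move: hm; rewrite !le_min => /and3P[hm1 hm2 hm3].
have vE : `|1 - avgs_variance (@p m) (E n) (tree (@x m) n) (conf m) / s0 ^+ 2| <= tau.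
  have := variance_approx b_gt0 omega_iid n (conf m).
  rewrite -/Y -/(mean n) -/(s2 n) -/(N n) s0E => hv.
  have -> : 1 - avgs_variance (@p m) (E n) (tree (@x m) n) (conf m) / s2 n =
    (s2 n - avgs_variance (@p m) (E n) (tree (@x m) n) (conf m)) / s2 n.
    by rewrite mulrBl divff // gt_eqF.
  rewrite normrM [X in _ * X]gtr0_norm ?invr_gt0 // ler_pdivrMr //; apply: le_trans hv _.
  by move: hm2; rewrite ler_pdivlMr // mulrC.
have cE : \sum_i (mean_crit (@p m) (@x m) b k0.+1 i (conf m) -
    mean_crit (@p m) (@x m) b (n + n) i (conf m)) <= tau.
  have step i : mean_crit (@p m) (@x m) b k0.+1 i (conf m) -
      mean_crit (@p m) (@x m) b (n + n) i (conf m) <=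
      (mean_crit (@p mr) (@x mr) b k0.+1 i (conf mr) -
      mean_crit (@p mr) (@x mr) b (n + n) i (conf mr)) + tau / (2 * d%:R).
    have := mean_crit_approx b_gt0 omega_iid k0.+1 i (conf m) (conf mr).
    have := mean_crit_approx b_gt0 omega_iid (n + n) i (conf m) (conf mr).
    have e1 : tau / (8 * d%:R) = tau / (2 * d%:R) / 4.
      by rewrite -!mulrA -!invfM; congr (_ * _^-1); lra.
    rewrite -/(@p m) -/(@x m) -/(@p mr) -/(@x mr) !ler_norml.
    move: hmr hm1; rewrite e1; lra.
  apply: le_trans (ler_sum _ (fun i _ => step i)) _.
  rewrite big_split /= sumr_const card_ord sumrB -/(h k0.+1) -/(h (n + n)%N).
  have -> : tau / (2 * d%:R) *+ d = tau / 2.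
    by rewrite -mulr_natr invfM mulrA mulfVK // gt_eqF.
  have := hk0 k0.+1 (n + n)%N (leqnSn _); lra.
have bdE : ((#|` cube d n| - #|` cube d (n - k0.+1)|) * d)%:R <= tau * N n.
  have hb : ((#|` cube d n| - #|` cube d (n - k0.+1)|) * d)%:R * n%:R <= C%:R * N n.
    by have := boundary_count d_gt0 n0 (ltnW kn); rewrite -(ler_nat R) !(natrM _ _ n) !(natrM _ C).
  rewrite -(ler_pM2r nR0); apply: le_trans hb _.
  rewrite mulrAC ler_wpM2r // ?(ltW N0) //.
  by move: bC; rewrite ler_pdivrMr // mulrC.
have sqE : Num.sqrt ((size (E n) * Dk)%:R * (2 * b ^+ 2) ^+ 2) <= N n * tau * (2 * b ^+ 2).
  rewrite -[leRHS]ger0_norm; last first.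
    by apply: mulr_ge0; apply: mulr_ge0 => //; [exact: ltW|exact: sqr_ge0].
  rewrite -sqrtr_sqr; apply: ler_wsqrtr; rewrite [leRHS]exprMn; apply: ler_wpM2r; first exact: sqr_ge0.
  rewrite natrM -/(N n) exprMn expr2 -mulrA.
  rewrite ler_wpM2l ?(ltW N0) //; move: bD; rewrite ler_pdivrMr ?exprn_gt0 // => bD'.
  by apply: le_trans bD' _; rewrite ler_wpM2r ?sqr_ge0.
have hG w w' : `|w - w'| <= b / s0 ->
     `|G w - G w' - G' w * (w - w')| <= tau * `|w - w'|.
  by move=> ww'; apply: lin1; exact: le_trans bs0.
have := @tree_stein_bound d R _ (@p m) (@x m) b (@p_ge0 m) (@p_sum1 m) (@x_bound m) b0
   k0 n G G' s0 tau L (conf m) (ltnW kn) s00 (ltW tau0) hG G'L.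
rewrite /= -/(E n) -/(k _).
set AV := avgs _ _ _ _; set var := `|1 - _|; set X := 4 * b * _ + _ => A2.
have A1 : `|(\int[P]_t k ((Y n t - mean n) / s0))%R - AV| <= tau.
  apply: (test_approx b_gt0 omega_iid _ ck kL s00) => y z yz; apply: uk2.
  apply: le_trans yz _; rewrite -/(N n) ler_pdivrMr //.
  by move: hm3; rewrite ler_pdivlMr //; lra.
(* [8 * b] comes from the interior edges, [4 * b ^+ 2] from the boundary and [2 * b ^+ 2] from the
   square root. *)
have XN : X <= N n * tau * (8 * b + 6 * b ^+ 2).
  rewrite /X -/Dk -/(N n); move: cE; set S := \sum_i _ => cE.
  have e1 : 4 * b * (N n * (2 * S)) <= 4 * b * (N n * (2 * tau)).
    by rewrite ler_wpM2l ?mulr_ge0 // ler_wpM2l ?(ltW N0) // ler_wpM2l.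
  have e2 : 4 * b * (((#|` cube d n| - #|` cube d (n - k0.+1)|) * d)%:R * b) <= 4 * b * (tau * N n * b).
    by rewrite ler_wpM2l ?mulr_ge0 // ler_wpM2r.
  move: e1 e2 sqE; lra.
have Xs : X / s0 ^+ 2 <= tau * ((8 * b + 6 * b ^+ 2) / c0).
  rewrite s0E; apply: le_trans (_ : N n * tau * (8 * b + 6 * b ^+ 2) / s2 n <= _).
    by rewrite ler_wpM2r // invr_ge0 ltW.
  have q0 : 0 <= tau * (8 * b + 6 * b ^+ 2).
    by rewrite mulr_ge0 ?(ltW tau0) // addr_ge0 // mulr_ge0 // sqr_ge0.
  have := ler_wpM2l q0 Nr; lra.
have Ns : (size (E n))%:R * b ^+ 2 * tau / s0 ^+ 2 <= tau * (b ^+ 2 / c0).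
  rewrite s0E -/(N n); have q0 : 0 <= tau * b ^+ 2 by rewrite mulr_ge0 ?(ltW tau0) // sqr_ge0.
  by have := ler_wpM2l q0 Nr; lra.
have A3 : `|AV| <= L * (tau + tau * ((8 * b + 6 * b ^+ 2) / c0)) + tau * (b ^+ 2 / c0).
  apply: le_trans A2 _; apply: lerD Ns; rewrite ler_wpM2l //.
  exact: lerD vE Xs.
have tM : tau * M = eps by rewrite /tau divfK // gt_eqF.
apply: le_trans (_ : tau + `|AV| <= _).
  rewrite -lerBlDr; apply: le_trans A1; exact: lerB_dist.
by rewrite -tM /M; move: A3; lra.
Qed.

End SteinLimit.

(** * The limit theorem for clipped weights *)

Section ClippedLimit.
Variables (R : realType) (dT : measure_display) (T : measurableType dT).
Variables (P : probability T R) (d : nat) (omega : edge d -> {RV P >-> R}) (b : R).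
Variable mu : probability (measurableTypeR R) R.
Hypotheses (b_gt0 : 0 < b) (omega_iid : iid P omega mu) (d_gt0 : (0 < d)%N).
Hypotheses (atomless : forall x : R, mu [set x] = 0%E) (mu_b : mu `]0, b]%classic = 1%E).

Let Y := clipped_tree omega b.
Let mean n := (\int[P]_t Y n t)%R.
Let s2 n := (\int[P]_t ((Y n t - mean n) ^+ 2))%R.
Let W n t := (Y n t - mean n) / Num.sqrt (s2 n).

Lemma standardize_clipped n t : standardize P (Y n) t = W n t.
Proof.
rewrite /standardize /W /mean /s2 /mean; congr ((_ - _) / Num.sqrt _).
  by rewrite unlock.
rewrite /random_variable.variance unlock unlock; congr (fine _).
Qed.

Lemma measurable_W n : measurable_fun setT (W n).
Proof.
apply: measurable_funM; last exact: measurable_cst.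
by apply: measurable_funB; [exact: measurable_funPT|exact: measurable_cst].
Qed.

Lemma W_bound n : exists c : R, forall t, `|W n t| <= c.
Proof.
exists ((#|` cube_edges d n|)%:R * b / Num.sqrt (s2 n)) => t.
rewrite normrM [X in _ * X]ger0_norm ?invr_ge0 ?sqrtr_ge0 //.
rewrite ler_wpM2r ?invr_ge0 ?sqrtr_ge0 //.
have := clipped_tree_bound omega b_gt0 n t; have := mean_bound omega b_gt0 n.
rewrite -/Y -/(mean n) ler_norml; lra.
Qed.

Lemma integrable_bounded_W (f : R -> R) n (L : R) : continuous f -> (forall y, `|f y| <= L) ->
  P.-integrable setT (EFin \o (fun t => f (W n t))).
Proof.
move=> cf fL; apply: (@integrable_bounded _ _ _ P _ L) => //.
apply: measurableT_comp; [exact: measurable_continuous|exact: measurable_W].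
Qed.

Lemma integrable_W2 n : P.-integrable setT (EFin \o (fun t => 1 + W n t ^+ 2)).
Proof.
have [c hc] := W_bound n.
apply: (@integrable_bounded _ _ _ P _ (1 + c ^+ 2)).
  apply: measurable_funD; first exact: measurable_cst.
  by apply: measurable_funX; exact: measurable_W.
move=> t; rewrite ger0_norm ?addr_ge0 ?sqr_ge0 // lerD2l -real_normK ?num_real //.
by rewrite lerXn2r ?nnegrE //; apply: le_trans (hc t).
Qed.

Lemma second_moment_W n : 0 < s2 n -> (\int[P]_t (1 + W n t ^+ 2))%R = 2.
Proof.
move=> s20.
have iS : P.-integrable setT (EFin \o (fun t => (Y n t - mean n) ^+ 2)).
  have [c hc] := W_bound n.
  have s0 : Num.sqrt (s2 n) != 0 by rewrite gt_eqF // sqrtr_gt0.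
  apply: (@integrable_bounded _ _ _ P _ (s2 n * c ^+ 2)).
    apply: measurable_funX; apply: measurable_funB; first exact: measurable_funPT.
    exact: measurable_cst.
  move=> t; rewrite ger0_norm ?sqr_ge0 //.
  have -> : (Y n t - mean n) ^+ 2 = s2 n * W n t ^+ 2.
    by rewrite /W exprMn exprVn sqr_sqrtr ?(ltW s20) // mulrCA divff ?mulr1 // gt_eqF.
  rewrite ler_wpM2l ?(ltW s20) // -real_normK ?num_real //.
  by rewrite lerXn2r ?nnegrE //; apply: le_trans (hc t).
have -> : (\int[P]_t (1 + W n t ^+ 2))%R = (\int[P]_t (1 + (s2 n)^-1 * (Y n t - mean n) ^+ 2))%R.
  apply: eq_Rintegral => t _.
  by rewrite /W exprMn exprVn sqr_sqrtr ?(ltW s20) // mulrC.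
rewrite RintegralD //; last 2 first.
- exact: finite_measure_integrable_cst.
- have := @integrableZl _ _ _ P setT measurableT (s2 n)^-1 _ iS.
  by apply: eq_integrable => // t _ /=; rewrite EFinM.
by rewrite Rintegral_prob_cst RintegralZl // mulVf ?gt_eqF.
Qed.

(** In [h - c = k + u], [stein_limit] bounds the integral of [k] by [eps / 4], while [u] is at most
    [eps / 4 * (1 + W n ^+ 2)] and contributes at most [eps / 2], as [W n] has unit variance. *)
Lemma clipped_limit (h : R -> R) (B eps : R) : continuous h -> (forall y, `|h y| <= B) ->
  0 < eps -> exists n0, forall n, (n0 <= n)%N ->
    `|(\int[P]_t h (W n t))%R - (\int[lebesgue_measure]_y (h y * normal_pdf 0 1 y))%R| <= eps.
Proof.
move=> ch hB e0.
have e40 : 0 < eps / 4 by rewrite divr_gt0.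
have [G [G' [L [G'L linG [ck kL uk hk]]]]] := stein_test ch hB e40.
set c := (\int[lebesgue_measure]_y _)%R in hk *.
pose k y := G' y - y * G y.
have [c0 c00 s2N] := variance_linear_growth b_gt0 omega_iid atomless mu_b.
have [n0 hn0] := stein_limit b_gt0 omega_iid d_gt0 atomless mu_b G'L linG ck kL uk e40.
exists (maxn 1 n0) => n; rewrite geq_max => /andP[n1 nn0].
have s20 : 0 < s2 n.
  apply: lt_le_trans (s2N n); rewrite mulr_gt0 // ltr0n.
  exact: leq_trans n1 (cube_edges_ge_size d_gt0 n).
have := hn0 n nn0; rewrite -/Y -/(mean n) -/(s2 n) => kn.
have ih := integrable_bounded_W n ch hB.
have ik : P.-integrable setT (EFin \o (fun t => k (W n t))) by exact: integrable_bounded_W ck kL.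
have ic : P.-integrable setT (EFin \o (fun _ : T => c)) by exact: finite_measure_integrable_cst.
pose u t := h (W n t) - c - k (W n t).
have iu : P.-integrable setT (EFin \o u).
  have i1 : P.-integrable setT (EFin \o (fun t => h (W n t) - c)).
    by apply: eq_integrable (integrableB measurableT ih ic).
  by apply: eq_integrable (integrableB measurableT i1 ik).
have E : (\int[P]_t h (W n t))%R - c = (\int[P]_t u t)%R + (\int[P]_t k (W n t))%R.
  have i1 : P.-integrable setT (EFin \o (fun t => h (W n t) - c)).
    by apply: eq_integrable (integrableB measurableT ih ic).
  rewrite /u RintegralB // RintegralB // Rintegral_prob_cst; lra.
rewrite E; apply: le_trans (ler_normD _ _) _.
have h1 : `|(\int[P]_t u t)%R| <= eps / 4 * 2.
  apply: le_trans (le_normr_Rintegral measurableT iu) _.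
  rewrite -(second_moment_W s20) -RintegralZl //; last exact: integrable_W2.
  apply: le_Rintegral => //.
  - exact: (integrable_norm iu).
  - have := @integrableZl _ _ _ P setT measurableT (eps / 4) _ (integrable_W2 n).
    by apply: eq_integrable => // t _ /=; rewrite EFinM.
  - by move=> t _; exact: hk.
have h2 : `|(\int[P]_t k (W n t))%R| <= eps / 4 by exact: kn.
lra.
Qed.

End ClippedLimit.

(** * Back to the original weights *)

Section Transfer.
Variables (R : realType) (dT : measure_display) (T : measurableType dT).
Variables (P : probability T R) (d : nat) (omega : edge d -> {RV P >-> R}) (b : R).
Variable mu : probability (measurableTypeR R) R.
Hypotheses (b_gt0 : 0 < b) (omega_iid : iid P omega mu) (mu_b : mu `]0, b]%classic = 1%E).

Let A n : set T := \big[setU/set0]_(e <- enum_fset (cube_edges d n))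
  (omega e @^-1` (~` `]0, b]%classic)).

Lemma negligible_out_of_range n : P.-negligible (A n).
Proof.
rewrite /A; apply: (big_ind (fun B => P.-negligible B)) => [|B C hB hC|e _].
- exact: negligible_set0.
- exact: negligibleU.
have [_ ident] := omega_iid.
have mI : measurable (~` `]0, b]%classic) by exact: measurableC.
apply/negligibleP; first exact: measurable_preimage.
have := ident e _ mI; rewrite /distribution /pushforward /= => ->.
by rewrite probability_setC // mu_b subee.
Qed.

(** Off [A n] all weights of the box lie in []0, b]]: clipping leaves them unchanged, and they are
    nonnegative as [mst_connector] demands. *)
Lemma mst_weight_clipped n t : ~ A n t -> mst_weight omega n t = clipped_tree omega b n t.
Proof.
move=> nA.
have h e : e \in cube_edges d n -> omega e t = clipped omega b e t /\ 0 <= omega e t.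
  move=> en.
  have : (omega e t \in `]0, b]).
    apply: contrapT => out; apply: nA; rewrite /A -bigcup_seq; exists e => //=.
  rewrite in_itv /= => /andP[h1 h2]; split; last exact: ltW.
  by rewrite /clipped clip_id // (ltW h1).
rewrite clipped_treeE // /mst_weight mst_connector; last by move=> e /h [].
by apply: connector_weight_dep; [exact: cube_connector|move=> e /h []].
Qed.

Lemma integral_off_negligible n (X X' : T -> R) : measurable_fun setT X -> measurable_fun setT X' ->
  (forall t, ~ A n t -> X t = X' t) -> (\int[P]_t (X t)%:E = \int[P]_t (X' t)%:E)%E.
Proof.
move=> mX mX' XX'; apply: ae_eq_integral => //; [exact/measurable_EFinP|exact/measurable_EFinP|].
apply: (negligibleS _ (negligible_out_of_range n)) => t /= h.
apply: contrapT => nA; apply: h => _; rewrite /= XX' //.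
Qed.

(** Mean and variance are integrals and ignore the null event [A n], so the same centring and
    scaling are applied on both sides. *)
Lemma standardize_mst_weight n t : ~ A n t ->
  standardize P (mst_weight omega n) t = standardize P (clipped_tree omega b n) t.
Proof.
move=> nA.
have mM : measurable_fun setT (mst_weight omega n) by exact: measurable_mst_weight.
have mY : measurable_fun setT (clipped_tree omega b n) by exact: measurable_funPT.
have EE : ('E_P[mst_weight omega n] = 'E_P[clipped_tree omega b n])%E.
  by rewrite unlock; apply: (@integral_off_negligible n) => // s; exact: mst_weight_clipped.
have VV : ('V_P[mst_weight omega n] = 'V_P[clipped_tree omega b n])%E.
  have EI (X : T -> R) : ('E_P[X] = \int[P]_t (X t)%:E)%E by rewrite unlock.
  rewrite /random_variable.variance unlock EE !EI.
  apply: (@integral_off_negligible n) => [||s nAs].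
  - by apply: measurable_funM; apply: measurable_funB => //; exact: measurable_cst.
  - by apply: measurable_funM; apply: measurable_funB => //; exact: measurable_cst.
  - by have e := mst_weight_clipped nAs; congr ((_ - _) * (_ - _)).
by rewrite /standardize EE VV mst_weight_clipped.
Qed.

Lemma expectation_mst_weight (g : R -> R) n (B : R) : continuous g -> (forall y, `|g y| <= B) ->
  ('E_P[g \o standardize P (mst_weight omega n)] =
    (\int[P]_t g (standardize P (clipped_tree omega b n) t))%R%:E)%E.
Proof.
move=> cg gB.
have mg := measurable_continuous cg.
have mZ : measurable_fun setT (g \o standardize P (mst_weight omega n)).
  by apply: measurableT_comp => //; exact: measurable_standardize.
have mZ' : measurable_fun setT (g \o standardize P (clipped_tree omega b n)).
  by apply: measurableT_comp => //; exact: measurable_standardize.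
rewrite unlock (@integral_off_negligible n _ (g \o standardize P (clipped_tree omega b n))) //.
  rewrite /Rintegral fineK //; apply: integrable_fin_num => //.
  by apply: (@integrable_bounded _ _ _ P _ B) => // t; exact: gB.
by move=> t nA; rewrite /= standardize_mst_weight.
Qed.

End Transfer.

Theorem theorem4p1 (R : realType) (dT : measure_display)
    (T : measurableType dT) (P : probability T R) (d : nat)
    (mu : probability (measurableTypeR R) R)
    (omega : edge d -> {RV P >-> R})
    (d_ge1 : (1 <= d)%N)
    (mu_continuous : forall x : R, mu [set x] = 0%E)
    (mu_positive : mu `]0%R, +oo[%classic = 1%E)
    (mu_bounded : exists b : R, mu `[- b, b]%classic = 1%E)
    (omega_iid : iid P omega mu) :
  cvg_in_law P (fun n => standardize P (mst_weight omega n))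
    (normal_prob 0 1).
Proof.
have [b' mub'] := mu_bounded.
(* Adding 1 makes [b] positive whatever [b'] is; the complement of []0, b]] is covered by the two
   null sets that the hypotheses on [mu] provide. *)
pose b := `|b'| + 1.
have b0 : 0 < b by rewrite ltr_wpDl.
have mub : mu `]0, b]%classic = 1%E.
  apply/eqP; rewrite eq_le probability_le1 //=.
  have out (D : set R) : measurable D -> mu D = 1%E -> mu (~` D) = 0%E.
    by move=> mD D1; rewrite probability_setC // D1 subee.
  have : mu (~` `]0, b]%classic) = 0%E.
    apply/negligibleP; first exact: measurableC.
    apply: (@negligibleS _ _ _ mu ((~` `[- b', b']%classic) `|` (~` `]0%R, +oo[%classic))).
      move=> r /=; apply: contra_notP => /not_orP[/contrapT h1 /contrapT h2].
      move: h1 h2; rewrite !in_itv /= andbT => /andP[_ rb] ->.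
      rewrite /b /=; apply: le_trans rb _; apply: le_trans (ler_norm _) _.
      by rewrite lerDl.
    apply: negligibleU; apply/negligibleP; try exact: (out _ (measurable_itv _)).
      by apply: measurableC; exact: measurable_itv.
    by apply: measurableC; exact: measurable_itv.
  by rewrite probability_setC // => /eqP; rewrite sube_eq // add0e => /eqP <-.
move=> g cg [M [Mr hM]].
have gB y : `|g y| <= M + 1 by apply: hM => //; rewrite ltrDl.
have -> : (\int[normal_prob 0 1]_x (g x)%:E = (\int[lebesgue_measure]_x (g x * normal_pdf 0 1 x))%R%:E)%E.
  rewrite (integral_normal_prob cg gB) /Rintegral fineK //.
  apply: integrable_fin_num => //; exact: integrable_bounded_phi cg gB.
under eq_cvg do rewrite (expectation_mst_weight b0 omega_iid mub _ cg gB).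
apply: cvg_EFin; first exact: nearW.
apply/cvgrPdist_le => eps e0; have [n0 hn0] :=
  clipped_limit b0 omega_iid d_ge1 mu_continuous mub cg gB e0.
near=> n; rewrite distrC /=; under eq_Rintegral do rewrite standardize_clipped.
by apply: hn0; near: n; exact: nbhs_infty_ge.
Unshelve. all: by end_near.
Qed.
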